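(* Let $\mathcal{G}_\delta$ be either the non-commutative polydisk or the non-commutative (column) ball in $d$ variables, and let $\phi\in\mathcal{S}(\mathcal{G}_\delta)$. Suppose $T \in \mathcal{I}_\delta\cap\mathbb{M}_1^d$ is a B-point of $\phi$. Then $$\eta(H) = \lim_{t \downarrow 0} \frac{\phi(T^{(m)} + t H) - \phi(T^{(m)})}{t}$$ exists for all $m\ge1$ and for all $H\in\mathbb{M}_m^d$ satisfying $T^{(m)} + tH \in \mathcal{G}_\delta$ for $t$ small and positive. Moreover $\eta$ is a free function (i.e. an nc-function) of $H$, which is homogeneous of degree $1$.
   Context: $\mathbb{M}_n$ is the set of $n\times n$ complex matrices and $\mathbb{M}^{[d]} = \bigcup_{n\ge 1} \mathbb{M}_n^d$. For a matrix $\delta$ of non-commutative polynomials in $d$ variables, $\mathcal{G}_\delta=\bigcup_{n\ge1}\{x\in\mathbb{M}_n^d:\|\delta(x)\|<1\}$ (operator norm). The non-commutative polydisk is $\mathcal{G}_\delta$ for $\delta(x)$ the diagonal $d\times d$ matrix with entries $x^1,\dots,x^d$, i.e. $\{x\in\mathbb{M}^{[d]}:\max_{r}\|x^r\|<1\}$. The non-commutative column ball is $\mathcal{G}_\delta$ for $\delta(x)$ the column with entries $x^1,\dots,x^d$, i.e. $\{x:\|\sum_{r}x^{r*}x^r\|<1\}$. $\mathcal{B}_\delta$ is the topological boundary of $\mathcal{G}_\delta$ (in each $\mathbb{M}_n^d$), and $\mathcal{I}_\delta=\{x\in\mathcal{B}_\delta:\delta(x)\text{ is an isometry}\}$. $T^{(m)}\in\mathbb{M}_m^d$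 is the direct sum of $m$ copies of $T$. An nc-function (free function) on $\Omega\subseteq\mathbb{M}^{[d]}$ is a graded function $\phi$ ($x\in\mathbb{M}_n^d\Rightarrow\phi(x)\in\mathbb{M}_n$) with $\phi(x\oplus y)=\phi(x)\oplus\phi(y)$ and $\phi(s^{-1}xs)=s^{-1}\phi(x)s$ ($s\in\mathbb{M}_n$ invertible, acting componentwise) whenever the arguments on both sides lie in $\Omega$. $\mathcal{S}(\mathcal{G}_\delta)$ is the set of nc-functions $\phi$ on $\mathcal{G}_\delta$ with $\|\phi(x)\|<1$ for all $x\in\mathcal{G}_\delta$. $S\in\mathcal{B}_\delta\cap\mathbb{M}_n^d$ is a B-point for $\phi$ if $\lim_{j\to\infty}\frac{\|I-\phi(Z_j)^*\phi(Z_j)\|}{1-\|\delta(Z_j)\|^2}<\infty$ for some sequence $Z_j$ in $\mathcal{G}_\delta\cap\mathbb{M}_n^d$ converging to $S$. If $S$ is a B-point, $\phi(S)$ denotes the unique unitary matrix $W\in\mathbb{M}_n$ such that $\phi(Z_j)\to W$ for every sequence $Z_j\to S$ in $\mathcal{G}_\delta\cap\mathbb{M}_n^d$ along which $\frac{\|I-\phi(Z_j)^*\phi(Z_j)\|}{1-\|\delta(Z_j)\|^2}$ is bounded. If $T\in\mathbb{M}_1^d$ is a B-point, then so is each $T^{(m)}$. The domain of $\eta$ is the union over $m$ of the sets of $H\in\mathbb{M}_m^d$ with $T^{(m)}+tH\in\mathcal{G}_\delta$ for all sufficiently small $t>0$. Homogeneous of degree $1$ means $\eta(zH)=z\eta(H)$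 for scalars $z$ whenever $H$ and $zH$ are both in this domain. *)

(* Defs.v *)
From HB Require Import structures.
From mathcomp Require Import all_boot all_order all_algebra.
From mathcomp Require Import spectral.
From mathcomp Require Import complex.
From mathcomp Require Import all_classical all_reals all_analysis.

Set Implicit Arguments.
Unset Strict Implicit.
Unset Printing Implicit Defensive.

Import Order.TTheory GRing.Theory Num.Theory.
Import numFieldNormedType.Exports.

Local Open Scope classical_set_scope.
Local Open Scope ring_scope.
Local Open Scope complex_scope.
Local Open Scope sesquilinear_scope.

(* The complex numbers are [R[i]] over a [realType] R; they carry the topology
   of the modulus, and matrices over them the (entrywise) library topology. *)
HB.instance Definition _ (R : rcfType) := NormedModule.copy R[i] R[i]^o.

Section MatrixNorm.
Variable R : realType.

Definition l2norm n (v : 'cV[R[i]]_n) : R :=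
  Num.sqrt (\sum_(i < n) (complex.Re (v i 0) ^+ 2 + complex.Im (v i 0) ^+ 2)).

Definition opnorm m n (A : 'M[R[i]]_(m, n)) : R :=
  sup [set l2norm (A *m v) | v in [set v : 'cV[R[i]]_n | l2norm v <= 1]].

Definition isometrymx m n (A : 'M[R[i]]_(m, n)) : Prop :=
  forall v : 'cV[R[i]]_n, l2norm (A *m v) = l2norm v.

End MatrixNorm.

(* d-tuples of n x n matrices; the size 0 is excluded in [ncG] below. *)
Definition nctuple (R : realType) (d n : nat) : Type := 'I_d -> 'M[R[i]]_n.

HB.instance Definition _ (R : realType) (d n : nat) :=
  GRing.Lmodule.copy (nctuple R d n) ('I_d -> 'M[R[i]]_n).
HB.instance Definition _ (R : realType) (d n : nat) :=
  Uniform.copy (nctuple R d n) {ptws 'I_d -> 'M[R[i]]_n}.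

Section NcFunctions.
Variables (R : realType) (d : nat).

Definition ncset : Type := forall n, set (nctuple R d n).

Definition gradedfun : Type := forall n, nctuple R d n -> 'M[R[i]]_n.

Definition ncdsum m n (x : nctuple R d m) (y : nctuple R d n) :
  nctuple R d (m + n) := fun r => block_mx (x r) 0 0 (y r).

Definition ncconj n (s : 'M[R[i]]_n) (x : nctuple R d n) : nctuple R d n :=
  fun r => invmx s *m x r *m s.

Definition is_ncfun (Omega : ncset) (f : gradedfun) : Prop :=
  (forall m n (x : nctuple R d m) (y : nctuple R d n),
     Omega m x -> Omega n y -> Omega (m + n)%N (ncdsum x y) ->
     f (m + n)%N (ncdsum x y) = block_mx (f m x) 0 0 (f n y)) /\
  (forall n (s : 'M[R[i]]_n) (x : nctuple R d n),
     s \in unitmx -> Omega n x -> Omega n (ncconj s x) ->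
     f n (ncconj s x) = invmx s *m f n x *m s).

Definition homogeneous1 (Omega : ncset) (f : gradedfun) : Prop :=
  forall n (z : R[i]) (H : nctuple R d n),
    Omega n H -> Omega n (z *: H) -> f n (z *: H) = z *: f n H.

(* The direct sum of m copies of a tuple of 1 x 1 matrices. *)
Definition ncampl m (T : nctuple R d 1) : nctuple R d m :=
  fun r => (T r 0 0)%:M.

(* Non-commutative polynomials in d variables, as formal sums (lists) of terms
   [(c, w)]: a coefficient c and a word w, read as the ordered product of its
   letters. *)
Definition ncpoly : Type := seq (R[i] * seq 'I_d).

Definition ncpolyX (r : 'I_d) : ncpoly := [:: (1, [:: r])].

Definition nceval n (P : ncpoly) (x : nctuple R d n) : 'M[R[i]]_n :=
  \sum_(a <- P) a.1 *: \prod_(r <- a.2) x r.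

Definition ncmxeval p q n (delta : 'M[ncpoly]_(p, q)) (x : nctuple R d n) :
    'M[R[i]]_(\sum_(i < p) n, \sum_(j < q) n) :=
  \mxblock_(i < p, j < q) nceval (delta i j) x.

Definition polydisk_delta : 'M[ncpoly]_(d, d) :=
  \matrix_(i, j) (if i == j then ncpolyX i else [::]).

Definition column_ball_delta : 'M[ncpoly]_(d, 1) := \col_i ncpolyX i.

Variant polydisk_or_ball : forall p q, 'M[ncpoly]_(p, q) -> Prop :=
| Polydisk : polydisk_or_ball polydisk_delta
| ColumnBall : polydisk_or_ball column_ball_delta.

Section Domain.
Variables (p q : nat) (delta : 'M[ncpoly]_(p, q)).

Definition ncG : ncset :=
  fun n => [set x | (0 < n)%N /\ opnorm (ncmxeval delta x) < 1].

Definition ncB : ncset := fun n => closure (ncG (n := n)) `\` (ncG (n := n))°.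

Definition ncI : ncset :=
  fun n => [set x | ncB x /\ isometrymx (ncmxeval delta x)].

Definition schur_class (phi : gradedfun) : Prop :=
  is_ncfun ncG phi /\
  forall n (x : nctuple R d n), ncG x -> opnorm (phi n x) < 1.

Section BPoint.
Variable phi : gradedfun.

Definition bquot n (x : nctuple R d n) : R :=
  opnorm (1%:M - (phi x)^t* *m phi x) /
  (1 - opnorm (ncmxeval delta x) ^+ 2).

Definition Bpoint n (S : nctuple R d n) : Prop :=
  ncB S /\
  exists Z : nat -> nctuple R d n,
    [/\ forall j, ncG (Z j), Z @ \oo --> S & cvg (bquot (Z j) @[j --> \oo])].

Definition is_boundary_value n (S : nctuple R d n) (W : 'M[R[i]]_n) : Prop :=
  W \is unitarymx /\
  forall Z : nat -> nctuple R d n,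
    (forall j, ncG (Z j)) -> Z @ \oo --> S ->
    (exists M : R, forall j, bquot (Z j) <= M) ->
    phi (Z j) @[j --> \oo] --> W.

(* phi(S) at a B-point S; the default value 0 is only reached if no unitary
   matrix qualifies. *)
Definition boundary_value n (S : nctuple R d n) : 'M[R[i]]_n :=
  xget 0 (is_boundary_value S).

End BPoint.

Definition dirdom (T : nctuple R d 1) : ncset :=
  fun m => [set H | \forall t \near 0^'+,
                      ncG (ncampl m T + t%:C *: H)].

End Domain.
End NcFunctions.

(* Main.v *)
Require Import Defs.
From mathcomp Require Import all_boot all_order all_algebra.
From mathcomp Require Import spectral.
From mathcomp Require Import complex.
From mathcomp Require Import all_classical all_reals all_analysis.
From mathcomp Require Import ring lra.
Import Order.TTheory GRing.Theory Num.Theory.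
Import numFieldNormedType.Exports.
Local Open Scope classical_set_scope.
Local Open Scope ring_scope.
Local Open Scope complex_scope.

Set Implicit Arguments.
Unset Strict Implicit.
Unset Printing Implicit Defensive.

(* [^*] denotes the conjugation of [numClosedFieldType]. *)
Local Open Scope ring_scope.

(** Both domains are treated at once as polyballs: the indices [i] are
    distributed into blocks by a map [kap], and a tuple belongs to the domain when
    each of its block columns is a strict contraction. The proof uses neither a
    realization formula for [phi] nor complex analysis. Everything is extracted
    from the behaviour of [phi] on block triangular tuples: a triangular tuple
    whose corner is a Sylvester expression is similar to a direct sum, so the
    corner of its value is a difference of values of [phi], and contractivity of
    this value bounds the difference ([ncfun_triang], [scontr_triangular]).

    Boundedness. For two diagonal entries, one of them a scalar point that tends
    to [T] with bounded quotient, this gives a Julia inequality ([julia]). It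
    shows that [phi] has a scalar boundary value [om] at [T] and that the
    difference quotients [dquot H t] stay bounded as [t] decreases to zero, with a
    bound that only depends on how far [H] points inwards and on the size of [H]
    ([dquot_bound]). Here [H] points inwards if the components [tcomp k H] of [H]
    along [T] have negative definite real parts, and these are exactly the
    directions in the domain of the derivative ([dirdomE]).

    Convergence for Hermitian components. If all components of [H] along [T] are
    Hermitian, the triangular tuples over the ray in the direction [H] dominate
    those of a disc touching the boundary. Each quadratic form of [phi] along the
    ray then satisfies the Schwarz--Pick inequality of the disc, and the classical
    argument of Julia and Caratheodory yields the limit ([sym_convdir]).

    Convergence in general. An inward direction is the value at ['i] of an affine
    pencil whose values at real parameters have Hermitian components. Evaluating
    the difference quotient at bidiagonal staircase tuples produces its divided
    differences along the pencil, and the bounds of the first step do not depend on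
    the length of the staircase ([stair_inward]). Hence Newton interpolation
    converges geometrically, uniformly in [t], and convergence as [t] tends to zero
    spreads from the nodes to nearby parameters ([vitali_step]). Finitely many
    steps lead from the real parameters to ['i] ([inward_convdir]).

    Properties of the limit. Being a limit of nc-functions, the derivative is an
    nc-function. It is homogeneous under positive factors by rescaling [t]. The same
    interpolation, now applied to the derivative itself along the pencil
    [l |-> l *: H] with real nodes, extends this to complex factors near one, and a
    chain of such factors reaches every admissible one ([dderiv_near_one],
    [dderiv_homogeneous]). *)

(** * Hermitian forms and contractions *)

Section Vectors.
Variable R : realType.
Local Notation C := R[i].
Local Notation im := ('i%C : C).
Implicit Types (x y z : C).

Lemma conjM (x y : C) : (x * y)^* = x^* * y^*. Proof. exact: rmorphM. Qed.

Lemma conjD (x y : C) : (x + y)^* = x^* + y^*. Proof. exact: rmorphD. Qed.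

Lemma conj_sum (I : finType) (F : I -> C) : (\sum_i F i)^* = \sum_i (F i)^*.
Proof. exact: rmorph_sum. Qed.

Definition sqn z : R := complex.Re z ^+ 2 + complex.Im z ^+ 2.

Lemma sqn_ge0 z : 0 <= sqn z.
Proof. by rewrite addr_ge0 // sqr_ge0. Qed.

Lemma sqnM x y : sqn (x * y) = sqn x * sqn y.
Proof. by case: x y => [a b] [c d]; rewrite /sqn /=; ring. Qed.

Lemma sqnC (a : R) : sqn a%:C = a ^+ 2.
Proof. by rewrite /sqn /= expr0n /= addr0. Qed.

Lemma sqn0 : sqn 0 = 0. Proof. by rewrite (sqnC 0) expr0n. Qed.

Lemma sqn1 : sqn 1 = 1. Proof. by rewrite (sqnC 1) expr1n. Qed.

Lemma sqnN z : sqn (- z) = sqn z.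
Proof. by case: z => a b; rewrite /sqn /= !sqrrN. Qed.

Lemma sqn_conj z : sqn z^* = sqn z.
Proof. by case: z => a b; rewrite /sqn /= sqrrN. Qed.

Lemma sqn_eq0 z : sqn z = 0 -> z = 0.
Proof.
case: z => a b; rewrite /sqn /= => /eqP; rewrite paddr_eq0 ?sqr_ge0 //.
by rewrite !sqrf_eq0 => /andP[/eqP-> /eqP->].
Qed.

Lemma sqnV z : sqn z^-1 = (sqn z)^-1.
Proof.
have [->|z0] := eqVneq z 0; first by rewrite invr0 sqn0 invr0.
have n0 : sqn z != 0 by apply: contra_neq z0; exact: sqn_eq0.
by apply: (mulfI n0); rewrite -sqnM mulfV // sqn1 mulfV.
Qed.

Lemma sqnD2 x y : sqn (x + y) <= 2 * sqn x + 2 * sqn y.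
Proof.
case: x y => [a b] [c d]; rewrite /sqn /=.
by have := sqr_ge0 (a - c); have := sqr_ge0 (b - d); nra.
Qed.

Lemma mul_conjc z : z^* * z = (sqn z)%:C.
Proof.
case: z => a b; apply/eqP; rewrite eq_complex /sqn /=.
by apply/andP; split; apply/eqP; ring.
Qed.

Definition n2 n (v : 'cV[C]_n) : R := \sum_i sqn (v i 0).

Definition dot n (u v : 'cV[C]_n) : C := \sum_i (u i 0)^* * v i 0.

Lemma n2_ge0 n (v : 'cV[C]_n) : 0 <= n2 v.
Proof. by apply: sumr_ge0 => i _; exact: sqn_ge0. Qed.

Lemma n2_eq0 n (v : 'cV[C]_n) : n2 v = 0 -> v = 0.
Proof.
move/eqP; rewrite psumr_eq0 => [/allP h|i _]; last exact: sqn_ge0.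
apply/matrixP => i j; rewrite ord1 mxE; apply: sqn_eq0; apply/eqP.
by apply: h; rewrite mem_index_enum.
Qed.

Lemma n2_0 n : n2 (0 : 'cV[C]_n) = 0.
Proof. by rewrite /n2 big1 // => i _; rewrite mxE sqn0. Qed.

Lemma n2Z n c (v : 'cV[C]_n) : n2 (c *: v) = sqn c * n2 v.
Proof. by rewrite /n2 mulr_sumr; apply: eq_bigr => i _; rewrite mxE sqnM. Qed.

Lemma n2N n (v : 'cV[C]_n) : n2 (- v) = n2 v.
Proof. by rewrite /n2; apply: eq_bigr => i _; rewrite mxE sqnN. Qed.

Lemma n2D n (u v : 'cV[C]_n) :
  n2 (u + v) = n2 u + n2 v + 2 * complex.Re (dot u v).
Proof.
rewrite /n2 /dot (raddf_sum (@complex.Re R : Rcomplex R -> R)) mulr_sumr -!big_split /=.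
apply: eq_bigr => i _; rewrite mxE.
by case: (u i 0) (v i 0) => [a b] [c d]; rewrite /sqn /=; ring.
Qed.

Lemma n2_col m n (u : 'cV[C]_m) (v : 'cV[C]_n) :
  n2 (col_mx u v) = n2 u + n2 v.
Proof.
rewrite /n2 big_split_ord /=.
by congr (_ + _); apply: eq_bigr => i _; rewrite ?col_mxEu ?col_mxEd.
Qed.

Lemma dot_col m n (u u' : 'cV[C]_m) (v v' : 'cV[C]_n) :
  dot (col_mx u v) (col_mx u' v') = dot u u' + dot v v'.
Proof.
rewrite /dot big_split_ord /=.
by congr (_ + _); apply: eq_bigr => i _; rewrite ?col_mxEu ?col_mxEd.
Qed.

Lemma dotDr n (u v w : 'cV[C]_n) : dot u (v + w) = dot u v + dot u w.
Proof. by rewrite /dot -big_split; apply: eq_bigr => i _; rewrite mxE mulrDr. Qed.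

Lemma dotDl n (u v w : 'cV[C]_n) : dot (u + v) w = dot u w + dot v w.
Proof.
by rewrite /dot -big_split; apply: eq_bigr => i _; rewrite mxE rmorphD mulrDl.
Qed.

Lemma dotZr n c (u v : 'cV[C]_n) : dot u (c *: v) = c * dot u v.
Proof. by rewrite /dot mulr_sumr; apply: eq_bigr => i _; rewrite mxE mulrCA. Qed.

Lemma dotZl n c (u v : 'cV[C]_n) : dot (c *: u) v = c^* * dot u v.
Proof.
by rewrite /dot mulr_sumr; apply: eq_bigr => i _; rewrite mxE rmorphM mulrA.
Qed.

Lemma dotNr n (u v : 'cV[C]_n) : dot u (- v) = - dot u v.
Proof. by rewrite -scaleN1r dotZr mulN1r. Qed.

Lemma dotBr n (u v w : 'cV[C]_n) : dot u (v - w) = dot u v - dot u w.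
Proof. by rewrite dotDr dotNr. Qed.

Lemma dot0r n (u : 'cV[C]_n) : dot u 0 = 0.
Proof. by rewrite /dot big1 // => i _; rewrite mxE mulr0. Qed.

Lemma dotC n (u v : 'cV[C]_n) : dot v u = (dot u v)^*.
Proof.
rewrite /dot conj_sum; apply: eq_bigr => i _.
by rewrite conjM conjCK mulrC.
Qed.

Lemma dotvv n (v : 'cV[C]_n) : dot v v = (n2 v)%:C.
Proof. by rewrite /dot /n2 rmorph_sum; apply: eq_bigr => i _; exact: mul_conjc. Qed.

Lemma dot_sumr n (I : finType) (P : pred I) u (F : I -> 'cV[C]_n) :
  dot u (\sum_(i | P i) F i) = \sum_(i | P i) dot u (F i).
Proof.
apply: (big_morph (dot u)); [exact: dotDr | exact: dot0r].
Qed.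

(** Cauchy--Schwarz, from the expansion of the squared norm of
    [n2 u *: v - dot u v *: u]. *)
Lemma dot_CS n (u v : 'cV[C]_n) : sqn (dot u v) <= n2 u * n2 v.
Proof.
have [u0|un0] := eqVneq (n2 u) 0.
  by rewrite (n2_eq0 u0) dotC dot0r sqn_conj sqn0 n2_0 mul0r.
have up : 0 < n2 u by rewrite lt_neqAle eq_sym un0 n2_ge0.
have := n2_ge0 ((n2 u)%:C *: v + (- dot u v) *: u).
rewrite n2D !n2Z sqnN sqnC dotZl dotZr (dotC u v).
case: (dot u v) => a b; rewrite /sqn /= => h.
have {h} : 0 <= n2 u * (n2 u * n2 v - (a ^+ 2 + b ^+ 2)) by nra.
by rewrite pmulr_rge0 // subr_ge0.
Qed.

Definition ecol n (i : 'I_n) : 'cV[C]_n := delta_mx i 0.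

Lemma n2_ecol n (i : 'I_n) : n2 (ecol i) = 1.
Proof.
rewrite /n2 (bigD1 i) //= mxE !eqxx sqn1 big1 ?addr0 // => j ji.
by rewrite mxE (negbTE ji) sqn0.
Qed.

Lemma dot_ecol n m (A : 'M[C]_(m, n)) i j : dot (ecol i) (A *m ecol j) = A i j.
Proof.
rewrite /dot (bigD1 i) //= big1 ?addr0 => [|k ki]; last first.
  by rewrite mxE (negbTE ki) rmorph0 mul0r.
by rewrite mxE !eqxx rmorph1 mul1r -colE mxE.
Qed.

Definition contracts c m n (A : 'M[C]_(m, n)) : Prop :=
  forall v, n2 (A *m v) <= c * n2 v.

Definition scontr m n (A : 'M[C]_(m, n)) : Prop :=
  exists2 c, c < 1 & contracts c A.

(** The two-by-two Schwarz--Pick estimate. Compressing a block upper triangular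
    strict contraction to the unit vectors [x] and [v] leaves an upper triangular
    scalar contraction with entries [a], [b], [d]; its value at the vector with
    components [a^* b] and [1 - |a|^2] gives the claim. *)
Lemma scontr_triangular m n (A : 'M[C]_m) (B : 'M[C]_(m, n)) (D : 'M[C]_n)
    (x : 'cV[C]_m) (v : 'cV[C]_n) :
  scontr (block_mx A B 0 D) -> n2 x = 1 -> n2 v = 1 ->
  sqn (dot x (B *m v)) <=
    (1 - sqn (dot x (A *m x))) * (1 - sqn (dot v (D *m v))).
Proof.
case=> c c1 cM x1 v1.
set a := dot x (A *m x); set b := dot x (B *m v); set d := dot v (D *m v).
have key (al be : C) :
    sqn (al * a + be * b) + sqn be * sqn d <= c * (sqn al + sqn be).
  have := cM (col_mx (al *: x) (be *: v)).
  rewrite mul_block_col mul0mx add0r -!scalemxAr !n2_col !n2Z x1 v1 !mulr1.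
  have h1 : sqn (al * a + be * b) <= n2 (al *: (A *m x) + be *: (B *m v)).
    by rewrite -2!dotZr -dotDr (le_trans (dot_CS _ _)) // x1 mul1r.
  have h2 : sqn d <= n2 (D *m v) by rewrite (le_trans (dot_CS _ _)) // v1 mul1r.
  have := ler_wpM2l (sqn_ge0 be) h2; lra.
have a1 : sqn a < 1.
  by have := key 1 0; rewrite sqn0 mul0r addr0 mul1r mul0r addr0 sqn1; lra.
have := key (a^* * b) (1 - sqn a)%:C.
have -> : a^* * b * a + (1 - sqn a)%:C * b = b.
  by rewrite mulrAC mul_conjc -mulrDl -rmorphD addrCA subrr addr0 mul1r.
rewrite sqnC sqnM sqn_conj.
have := sqn_ge0 b; have := sqn_ge0 d; have := sqn_ge0 a.
set p := sqn a in a1 *; set q := sqn b; set r := sqn d => p0 r0 q0 h.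
have {}h : q + (1 - p) ^+ 2 * r <= p * q + (1 - p) ^+ 2.
  apply: le_trans h _; rewrite -[leRHS]mul1r; apply: ler_wpM2r; last exact: ltW.
  by rewrite addr_ge0 ?sqr_ge0 ?mulr_ge0.
have p1 : 0 < 1 - p by rewrite subr_gt0.
rewrite -(ler_pM2l p1); nra.
Qed.

Lemma Re_realM (a : R) (z : C) : complex.Re (a%:C * z) = a * complex.Re z.
Proof. by case: z => x y /=; ring. Qed.

Lemma Re_lmul (z w : C) : complex.Re (z * w) =
  complex.Re z * complex.Re w - complex.Im z * complex.Im w.
Proof. by case: z w => [a b] [c e]. Qed.

Lemma conj_fixed_Im (z : C) : z = z^* -> complex.Im z = 0.
Proof.
case: z => a b /eqP; rewrite eq_complex /= => /andP[_ /eqP h]; lra.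
Qed.

Lemma scal_dot (n : nat) (x v : 'cV[C]_n) (A : 'M[C]_n) (a : C) :
  dot x ((A - a%:M) *m v) = dot x (A *m v) - a * dot x v.
Proof. by rewrite mulmxBl mul_scalar_mx dotBr dotZr. Qed.

Lemma quadratic_comb n (L : 'M[C]_n) (x y : R) u v :
  (forall u v, complex.Re (dot u (L *m v)) = complex.Re (dot v (L *m u))) ->
  complex.Re (dot (x%:C *: u + y%:C *: v) (L *m (x%:C *: u + y%:C *: v))) =
    x ^+ 2 * complex.Re (dot u (L *m u)) + 2 * x * y * complex.Re (dot u (L *m v))
    + y ^+ 2 * complex.Re (dot v (L *m v)).
Proof.
move=> hs; rewrite mulmxDr -!scalemxAr dotDl !dotDr !dotZl !dotZr.
have hvu := hs v u.
move: hvu; case: (dot u (L *m u)) => a1 b1; case: (dot u (L *m v)) => a2 b2.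
by case: (dot v (L *m u)) => a3 b3; case: (dot v (L *m v)) => a4 b4 /= ->; ring.
Qed.

Lemma quad_expand n (A : 'M[C]_n) u v (c : C) :
  dot (u + c *: v) (A *m (u + c *: v)) =
    dot u (A *m u) + c * dot u (A *m v) + c^* * dot v (A *m u)
    + c^* * c * dot v (A *m v).
Proof. by rewrite mulmxDr -scalemxAr dotDl !dotDr !dotZl !dotZr; ring. Qed.

Lemma dot_polarize n (A : 'M[C]_n) u v (Q := fun c : C =>
    dot (u + c *: v) (A *m (u + c *: v))) :
  4 * dot u (A *m v) = Q 1 - Q (-1) - im * (Q im - Q (- im)).
Proof.
have QE c c' : c^* = c' -> Q c = dot u (A *m u) + c * dot u (A *m v)
    + c' * dot v (A *m u) + c' * c * dot v (A *m v).
  by move=> <-; exact: quad_expand.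
have c1 : (1 : C)^* = 1 by rewrite rmorph1.
have c2 : (-1 : C)^* = -1 by rewrite rmorphN rmorph1.
have c3 : (im : C)^* = - im.
  by apply/eqP; rewrite eq_complex /= ?oppr0 ?opprK !eqxx.
have c4 : (- im : C)^* = im.
  by apply/eqP; rewrite eq_complex /= ?oppr0 ?opprK !eqxx.
have ii : im * im = -1 :> C by rewrite -expr2 sqr_i.
move: (QE _ _ c1) (QE _ _ c2) (QE _ _ c3) (QE _ _ c4) ii.
generalize (Q 1) (Q (-1)) (Q im) (Q (- im)) => q1 q2 q3 q4 -> -> -> ->.
generalize im => z ii.
ring: ii.
Qed.

Definition adjmx n (L : 'M[C]_n) : 'M[C]_n := map_mx Num.conj L^T.

Lemma dot_adj n (L : 'M[C]_n) u v : dot u (adjmx L *m v) = (dot v (L *m u))^*.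
Proof.
rewrite /dot conj_sum.
under eq_bigr do rewrite mxE mulr_sumr.
rewrite exchange_big /=; apply: eq_bigr => i _.
rewrite conjM conjCK mxE conj_sum mulr_sumr.
apply: eq_bigr => j _; rewrite !mxE conjM; ring.
Qed.

(** [hre L] and [him L] are the Hermitian parts in the Cartesian decomposition
    [L = hre L + 'i *: him L]. *)
Definition hre n (L : 'M[C]_n) : 'M[C]_n := 2^-1 *: (L + adjmx L).
Definition him n (L : 'M[C]_n) : 'M[C]_n := (2 * 'i%C)^-1 *: (L - adjmx L).

Lemma two_i_neq0 : (2 * 'i%C : C) != 0.
Proof.
rewrite mulf_neq0 ?pnatr_eq0 //; apply/eqP => h.
by have := congr1 (@complex.Im R) h => /eqP; rewrite /= oner_eq0.
Qed.

Lemma hre_him n (L : 'M[C]_n) : hre L + 'i%C *: him L = L.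
Proof.
rewrite /hre /him scalerA invfM mulrCA mulfV; last first.
  by apply: contra_neq two_i_neq0 => ->; rewrite mulr0.
rewrite mulr1 -scalerDr addrACA subrr addr0.
have -> : L + L = (2 : C) *: L by rewrite scaler_nat mulr2n.
by rewrite scalerA mulVf ?scale1r // pnatr_eq0.
Qed.

Lemma hre_form n (L : 'M[C]_n) u v : dot u (hre L *m v) = (dot v (hre L *m u))^*.
Proof.
have c2 : (2^-1 : C)^* = 2^-1.
  by transitivity (((2 : C)^*)^-1); [exact: fmorphV | rewrite rmorph_nat].
by rewrite -!scalemxAl !mulmxDl !dotZr !dotDr !dot_adj conjM conjD conjCK c2 addrC.
Qed.

Lemma him_form n (L : 'M[C]_n) u v : dot u (him L *m v) = (dot v (him L *m u))^*.
Proof.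
have c2 : ((2 * 'i%C)^-1 : C)^* = - (2 * 'i%C)^-1.
  transitivity (((2 * 'i%C : C)^*)^-1); first exact: fmorphV.
  rewrite -invrN; congr (_^-1).
  by apply/eqP; rewrite eq_complex /=; apply/andP; split; apply/eqP; ring.
rewrite -!scalemxAl !mulmxBl !dotZr !dotBr !dot_adj conjM c2.
have conjB (x y : C) : (x - y)^* = x^* - y^* by exact: rmorphB.
by rewrite conjB conjCK mulNr -mulrN opprB.
Qed.

(** The form of [him L] takes real values on the diagonal, so only the real part
    of [l] is felt: along a vertical strip of parameters [l] the real part of the
    form of [hre L + l *: him L] is under control. *)
Lemma him_comb_form n (L : 'M[C]_n) (l : C) v :
  complex.Re (dot v ((hre L + l *: him L) *m v)) =
    complex.Re (dot v (L *m v)) + complex.Re l * complex.Re (dot v (him L *m v)).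
Proof.
have im0 := conj_fixed_Im (him_form L v v).
have expand (z : C) : complex.Re (dot v ((hre L + z *: him L) *m v)) =
    complex.Re (dot v (hre L *m v)) + complex.Re z * complex.Re (dot v (him L *m v)).
  by rewrite mulmxDl -scalemxAl dotDr dotZr raddfD /= Re_lmul im0 mulr0 subr0.
have e0 := expand 'i%C; rewrite hre_him /= mul0r addr0 in e0.
by rewrite expand e0.
Qed.

Lemma real_form_sym n (L : 'M[C]_n) :
  (forall u v, dot u (L *m v) = (dot v (L *m u))^*) ->
  forall u v, complex.Re (dot u (L *m v)) = complex.Re (dot v (L *m u)).
Proof. by move=> h u v; rewrite h; case: (dot v _). Qed.

Lemma real_comb_sym n (P Q : 'M[C]_n) (x : R) :
  (forall u v, complex.Re (dot u (P *m v)) = complex.Re (dot v (P *m u))) ->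
  (forall u v, complex.Re (dot u (Q *m v)) = complex.Re (dot v (Q *m u))) ->
  forall u v, complex.Re (dot u ((P + x%:C%C *: Q) *m v)) =
    complex.Re (dot v ((P + x%:C%C *: Q) *m u)).
Proof.
move=> hP hQ u v.
by rewrite !mulmxDl -!scalemxAl !dotDr !dotZr !raddfD /= !Re_realM hP hQ.
Qed.

End Vectors.

(** * Polyballs and block triangular tuples *)

Section TupleAlgebra.
Variables (R : realType) (d : nat).
Local Notation C := R[i].

Definition nctriang m n (A : nctuple R d m) (B : 'I_d -> 'M[C]_(m, n))
    (D : nctuple R d n) : nctuple R d (m + n) :=
  fun i => block_mx (A i) (B i) 0 (D i).

Lemma invmx_unitriangular m n (X : 'M[C]_(m, n)) :
  (block_mx 1%:M X 0 1%:M \in unitmx) /\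
  invmx (block_mx 1%:M X 0 1%:M) = block_mx 1%:M (- X) 0 1%:M.
Proof.
set s := block_mx _ X _ _; set s' := block_mx _ (- X) _ _.
have e : s *m s' = 1%:M.
  rewrite mulmx_block !mul1mx !mulmx1 !mul0mx !mulmx0 !addr0 !add0r addNr.
  by rewrite -scalar_mx_block.
have us : s \in unitmx by case/mulmx1_unit: e.
by split=> //; rewrite -[s']mul1mx -(mulVmx us) -mulmxA e mulmx1.
Qed.

(** Block triangular tuples whose corner is a Sylvester expression [A X - X D]
    are similar to direct sums, so the corner of the value of an nc-function is
    the same expression in the diagonal values. This is the difference calculus
    on which all estimates below rest. *)
Lemma ncfun_triang (Omega : ncset R d) (f : gradedfun R d) m n
    (A : nctuple R d m) (D : nctuple R d n) (X : 'M[C]_(m, n)) :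
  is_ncfun Omega f -> Omega m A -> Omega n D -> Omega (m + n)%N (ncdsum A D) ->
  Omega (m + n)%N (nctriang A (fun i => A i *m X - X *m D i) D) ->
  f (m + n)%N (nctriang A (fun i => A i *m X - X *m D i) D) =
    block_mx (f m A) (f m A *m X - X *m f n D) 0 (f n D).
Proof.
case=> fD fS OA OD OAD OT.
have [us es] := invmx_unitriangular X.
have conjE (P : 'M[C]_m) (Q : 'M[C]_n) :
    invmx (block_mx 1%:M X 0 1%:M) *m block_mx P 0 0 Q
      *m block_mx 1%:M X 0 1%:M = block_mx P (P *m X - X *m Q) 0 Q.
  rewrite es !mulmx_block !mul1mx !mulmx1 !mul0mx !mulmx0 !addr0 !add0r.
  by rewrite mulNmx mul0mx add0r.
have tE : nctriang A (fun i => A i *m X - X *m D i) D =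
    ncconj (block_mx 1%:M X 0 1%:M) (ncdsum A D).
  by apply/funext => i; rewrite /ncconj /ncdsum conjE.
by rewrite tE fS // -?tE // fD // conjE.
Qed.

Lemma conj_scalar n (s : 'M[C]_n) (a : C) : s \in unitmx ->
  invmx s *m a%:M *m s = a%:M.
Proof. by move=> us; rewrite mul_mx_scalar -scalemxAl mulVmx // scalemx1. Qed.

Lemma ncampl1 (z : nctuple R d 1) : ncampl 1 z = z.
Proof.
by apply/funext => i; apply/matrixP => a b; rewrite !ord1 mxE eqxx mulr1n.
Qed.

Lemma ncamplS m (z : nctuple R d 1) : ncampl m.+1 z = ncdsum z (ncampl m z).
Proof.
apply/funext => i; rewrite /ncampl /ncdsum -[m.+1]/(1 + m)%N.
by rewrite (@scalar_mx_block _ 1 m) -/(ncampl 1 z i) ncampl1.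
Qed.

End TupleAlgebra.

Section Polyball.
Variables (R : realType) (d q : nat) (kap : 'I_d -> 'I_q).
Local Notation C := R[i].

(** The polydisk ([kap] injective) and the column ball ([kap] constant) are both
    of this form: the [k]-th block is the column of those [x i] with
    [kap i = k], and [blockn2 k x v] is the squared norm of its value at [v]. *)
Definition blockn2 m n (k : 'I_q) (x : 'I_d -> 'M[C]_(m, n)) (v : 'cV[C]_n) : R :=
  \sum_(i | kap i == k) n2 (x i *m v).

Definition polyb c m n (x : 'I_d -> 'M[C]_(m, n)) : Prop :=
  forall k v, blockn2 k x v <= c * n2 v.

Definition polyball : ncset R d :=
  fun n => [set x | (0 < n)%N /\ exists2 c, c < 1 & polyb c x].

Lemma blockn2_ge0 m n k (x : 'I_d -> 'M[C]_(m, n)) v : 0 <= blockn2 k x v.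
Proof. by apply: sumr_ge0 => i _; exact: n2_ge0. Qed.

Lemma polyb_le c c' m n (x : 'I_d -> 'M[C]_(m, n)) :
  c <= c' -> polyb c x -> polyb c' x.
Proof.
move=> cc h k v; apply: le_trans (h k v) _; apply: ler_wpM2r => //.
exact: n2_ge0.
Qed.

Lemma blockn2Z a m n k (x : 'I_d -> 'M[C]_(m, n)) v :
  blockn2 k (fun i => a *: x i) v = sqn a * blockn2 k x v.
Proof.
by rewrite /blockn2 mulr_sumr; apply: eq_bigr => i _; rewrite -scalemxAl n2Z.
Qed.

Lemma n2D_young n (u v : 'cV[C]_n) t : 0 < t ->
  n2 (u + v) <= (1 + t) * n2 u + (1 + t^-1) * n2 v.
Proof.
move=> t0; have := n2_ge0 (t%:C *: u - v).
rewrite (n2D (t%:C *: u)) n2N n2Z sqnC dotNr dotZl.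
have -> : complex.Re (- ((t%:C)^* * dot u v)) = - (t * complex.Re (dot u v)).
  by case: (dot u v) => a b /=; ring.
move=> h; rewrite n2D -(ler_pM2l t0).
have -> : t * ((1 + t) * n2 u + (1 + t^-1) * n2 v) =
    t * n2 u + t ^+ 2 * n2 u + t * n2 v + n2 v.
  by field; rewrite gt_eqF.
lra.
Qed.

Lemma blockn2D_le m n p k (x : 'I_d -> 'M[C]_(m, n)) (y : 'I_d -> 'M[C]_(m, p)) u v t :
  0 < t -> \sum_(i | kap i == k) n2 (x i *m u + y i *m v) <=
    (1 + t) * blockn2 k x u + (1 + t^-1) * blockn2 k y v.
Proof.
move=> t0; rewrite /blockn2 !mulr_sumr -big_split /=.
by apply: ler_sum => i _; exact: n2D_young.
Qed.

Lemma polybD a b m n (x y : 'I_d -> 'M[C]_(m, n)) :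
  polyb a x -> polyb b y -> polyb (2 * a + 2 * b) (fun i => x i + y i).
Proof.
move=> hx hy k v; rewrite /blockn2.
under eq_bigr do rewrite mulmxDl.
have := blockn2D_le k x y v v ltr01; rewrite invr1.
have := hx k v; have := hy k v; lra.
Qed.

Definition frob m n (A : 'M[C]_(m, n)) : R := \sum_i \sum_j sqn (A i j).

Lemma frob_ge0 m n (A : 'M[C]_(m, n)) : 0 <= frob A.
Proof. by do 2!(apply: sumr_ge0 => ? _); exact: sqn_ge0. Qed.

Lemma contracts_frob m n (A : 'M[C]_(m, n)) : contracts (frob A) A.
Proof.
move=> v; rewrite mulr_suml; apply: ler_sum => i _; rewrite mxE.
have -> : \sum_j A i j * v j 0 = dot (\col_j (A i j)^*) v.
  by apply: eq_bigr => j _; rewrite mxE conjCK.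
apply: le_trans (dot_CS _ _) _; rewrite /n2.
rewrite (eq_bigr (fun j => sqn (A i j))) // => j _.
by rewrite mxE sqn_conj.
Qed.

Lemma polyb_frob m n (x : 'I_d -> 'M[C]_(m, n)) : polyb (\sum_i frob (x i)) x.
Proof.
move=> k v; rewrite mulr_suml /blockn2 big_mkcond /=; apply: ler_sum => i _.
case: ifP => _; first exact: contracts_frob.
by rewrite mulr_ge0 ?frob_ge0 ?n2_ge0.
Qed.

Lemma polyb_exists m n (x : 'I_d -> 'M[C]_(m, n)) : exists2 c, 0 < c & polyb c x.
Proof.
exists (1 + \sum_i frob (x i)).
  by rewrite ltr_wpDr // sumr_ge0 // => i _; exact: frob_ge0.
by apply: polyb_le (polyb_frob x); rewrite lerDr.
Qed.

Lemma blockn2_triang m n k (A : nctuple R d m) (B : 'I_d -> 'M[C]_(m, n))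
    (D : nctuple R d n) u v :
  blockn2 k (nctriang A B D) (col_mx u v) =
    \sum_(i | kap i == k) n2 (A i *m u + B i *m v) + blockn2 k D v.
Proof.
rewrite /blockn2 -big_split; apply: eq_bigr => i _.
by rewrite /nctriang mul_block_col mul0mx add0r n2_col.
Qed.

Lemma ncdsum_triang m n (A : nctuple R d m) (D : nctuple R d n) :
  ncdsum A D = nctriang A (fun=> 0) D.
Proof. by []. Qed.

Lemma polyb_dsum c m n (A : nctuple R d m) (D : nctuple R d n) :
  polyb c A -> polyb c D -> polyb c (ncdsum A D).
Proof.
move=> hA hD k w; rewrite -(vsubmxK w) n2_col ncdsum_triang blockn2_triang.
under eq_bigr do rewrite mul0mx addr0.
by rewrite mulrDr lerD // ?hA ?hD.
Qed.

Lemma polyball_dsum m n (A : nctuple R d m) (D : nctuple R d n) :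
  polyball A -> polyball D -> polyball (ncdsum A D).
Proof.
case=> m0 [a a1 ha] [n0 [b b1 hb]]; split; first by rewrite addn_gt0 m0.
exists (Num.max a b); first by rewrite gt_max a1.
by apply: polyb_dsum; [apply: polyb_le ha | apply: polyb_le hb];
  rewrite le_max lexx ?orbT.
Qed.

Lemma blockn2_ampl m k (z : nctuple R d 1) v :
  blockn2 k (ncampl m z) v = (\sum_(i | kap i == k) sqn (z i 0 0)) * n2 v.
Proof.
rewrite /blockn2 mulr_suml; apply: eq_bigr => i _.
by rewrite /ncampl mul_scalar_mx n2Z.
Qed.

Lemma polyb_ampl m c (z : nctuple R d 1) : polyb c z -> polyb c (ncampl m z).
Proof.
move=> h k v; rewrite blockn2_ampl; apply: ler_wpM2r; first exact: n2_ge0.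
have := h k (ecol R 0); rewrite n2_ecol mulr1; congr (_ <= _).
by rewrite -(ncampl1 z) blockn2_ampl n2_ecol mulr1 ncampl1.
Qed.

Lemma polyball_ampl m z : (0 < m)%N -> polyball z -> polyball (ncampl m z).
Proof.
by move=> m0 [_ [c c1 h]]; split=> //; exists c => //; exact: polyb_ampl.
Qed.

Lemma ncfun_ampl f m z : is_ncfun polyball f -> (0 < m)%N -> polyball z ->
  f m (ncampl m z) = (f 1%N z 0 0)%:M.
Proof.
move=> fnc + hz; have hf : f 1%N z = (f 1%N z 0 0)%:M.
  by apply/matrixP => a b; rewrite !ord1 [RHS]mxE eqxx mulr1n.
case: m => // m _; elim: m => [|m IH]; first by rewrite ncampl1.
have hm := polyball_ampl (ltn0Sn m) hz.
have := fnc.1 1%N m.+1 z (ncampl m.+1 z) hz hm (polyball_dsum hz hm).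
by rewrite -ncamplS IH [X in block_mx X]hf -scalar_mx_block.
Qed.

(** Young's inequality with weight [ga / 2] separates the two columns of the
    first row. The diagonal entry [X] then uses up half of its gap [ga], and the
    corner uses up half of the gap [g] of [Z]. *)
Lemma polyball_triang n (X Z : nctuple R d n) (ga g e : R) (c : C) :
  (0 < n)%N -> 0 < ga <= 1 -> 0 < g ->
  polyb (1 - ga) X -> polyb (1 - g) Z -> polyb e (fun i => X i - Z i) ->
  sqn c * (6 * e) <= ga * g ->
  polyball (nctriang X (fun i => X i *m c%:M - c%:M *m Z i) Z).
Proof.
move=> n0 /andP[ga0 ga1] g0 hX hZ hD hc; split; first by rewrite addn_gt0 n0.
exists (Num.max (1 - ga / 2) (1 - g / 2)); first by rewrite gt_max; lra.
move=> k w; rewrite -(vsubmxK w) n2_col blockn2_triang.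
set u := usubmx w; set v := dsubmx w.
have cE i : X i *m c%:M - c%:M *m Z i = c *: (X i - Z i).
  by rewrite mul_mx_scalar mul_scalar_mx scalerBr.
under eq_bigr do rewrite cE.
have t0 : 0 < ga / 2 by rewrite divr_gt0.
have := blockn2D_le k X (fun i => c *: (X i - Z i)) u v t0.
rewrite blockn2Z => h; apply: le_trans (lerD h (hZ k v)) _ => {h}.
have nu := n2_ge0 u; have nv := n2_ge0 v.
have h1 : (1 + ga / 2) * blockn2 k X u <= (1 - ga / 2) * n2 u.
  apply: (@le_trans _ _ ((1 + ga / 2) * ((1 - ga) * n2 u))).
    by rewrite ler_pM2l // addr_gt0.
  by rewrite mulrA ler_wpM2r //; nra.
have h2 : (1 + (ga / 2)^-1) * (sqn c * blockn2 k (fun i => X i - Z i) v)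
     <= (g / 2) * n2 v.
  have i1 : 1 + (ga / 2)^-1 <= 3 / ga.
    by rewrite -subr_ge0; have -> : 3 / ga - (1 + (ga / 2)^-1) = (1 - ga) / ga;
      [field; rewrite gt_eqF | rewrite divr_ge0 ?subr_ge0 // ltW].
  apply: (@le_trans _ _ (3 / ga * (sqn c * (e * n2 v)))).
    apply: ler_pM => //.
    - by rewrite addr_ge0 // invr_ge0 ltW.
    - by rewrite mulr_ge0 ?sqn_ge0 ?blockn2_ge0.
    - by apply: ler_wpM2l; [exact: sqn_ge0 | exact: hD].
  rewrite !mulrA ler_wpM2r // -!mulrA mulrCA ler_pdivrMl //.
  by nra.
have l1 : 1 - ga / 2 <= Num.max (1 - ga / 2) (1 - g / 2) by rewrite le_max lexx.
have l2 : 1 - g / 2 <= Num.max (1 - ga / 2) (1 - g / 2) by rewrite le_max lexx orbT.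
rewrite mulrDr.
have := ler_wpM2r nu l1; have := ler_wpM2r nv l2; nra.
Qed.

Lemma gap_polyball n (X : nctuple R d n) ga :
  (0 < n)%N -> 0 < ga -> polyb (1 - ga) X -> polyball X.
Proof. by move=> n0 g0 h; split=> //; exists (1 - ga); [lra | exact: h]. Qed.

End Polyball.

(** * One-sided limits at zero of complex-valued functions *)

Section OneSidedLimits.
Variable R : realType.
Local Notation C := R[i].

(** Limits are measured by the squared modulus [sqn], which is real-valued and
    polynomial in the real and imaginary parts. *)
Definition cauchy0 (f : R -> C) : Prop :=
  forall e, 0 < e -> exists2 d, 0 < d &
    forall s t, 0 < s < d -> 0 < t < d -> sqn (f s - f t) <= e.

Definition tends0 (f : R -> C) (l : C) : Prop :=
  forall e, 0 < e -> exists2 d, 0 < d & forall t, 0 < t < d -> sqn (f t - l) <= e.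

(** The eventual lower bounds of [f] at zero; their supremum is the lower
    limit. *)
Definition elower (f : R -> R) : set R :=
  [set x | exists2 d, 0 < d & forall t, 0 < t < d -> x <= f t].

Lemma real_cauchy0 (f : R -> R) :
  (forall e, 0 < e -> exists2 d, 0 < d &
    forall s t, 0 < s < d -> 0 < t < d -> `|f s - f t| <= e) ->
  exists l, forall e, 0 < e -> exists2 d, 0 < d &
    forall t, 0 < t < d -> `|f t - l| <= e.
Proof.
move=> hf.
have below e d : 0 < d ->
    (forall s t, 0 < s < d -> 0 < t < d -> `|f s - f t| <= e) ->
    forall t, 0 < t < d -> elower f (f t - e) /\ ubound (elower f) (f t + e).
  move=> d0 h t td; split.
    exists d => // s sd; have := h _ _ sd td; rewrite ler_norml; lra.
  move=> x [d' d'0 hx].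
  have m0 : 0 < Num.min d d' by rewrite lt_min d0.
  have l1 : Num.min d d' <= d by rewrite ge_min lexx.
  have l2 : Num.min d d' <= d' by rewrite ge_min lexx orbT.
  have sd : 0 < Num.min d d' / 2 < d by apply/andP; split; lra.
  have := hx (Num.min d d' / 2); have := h _ _ sd td; rewrite ler_norml.
  move=> h1 /(_ _); lra.
have half (d : R) : 0 < d -> 0 < d / 2 < d by move=> d0; apply/andP; split; lra.
have hs : has_sup (elower f).
  have [d d0 h] := hf 1 ltr01; have [h1 h2] := below _ _ d0 h _ (half _ d0).
  by split; [exists (f (d / 2) - 1) | exists (f (d / 2) + 1)].
exists (sup (elower f)) => e e0; have [d d0 h] := hf e e0.
exists d => // t td; have [h1 h2] := below _ _ d0 h _ td.
have := ub_le_sup hs.2 h1; have := ge_sup hs.1 h2; rewrite ler_norml; lra.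
Qed.

Lemma sqn_ReIm (z : C) e : 0 <= e ->
  `|complex.Re z| <= e -> `|complex.Im z| <= e -> sqn z <= 2 * e ^+ 2.
Proof.
case: z => a b /= e0 ha hb; rewrite /sqn /=.
have := lerXn2r 2 (normr_ge0 a) e0 ha; have := lerXn2r 2 (normr_ge0 b) e0 hb.
by rewrite !real_normK ?num_real //; lra.
Qed.

Lemma ReIm_sqn (z : C) e : 0 <= e -> sqn z <= e ^+ 2 ->
  `|complex.Re z| <= e /\ `|complex.Im z| <= e.
Proof.
case: z => a b /= e0; rewrite /sqn /= => h.
have := sqr_ge0 a; have := sqr_ge0 b => b2 a2.
by split; rewrite -ler_sqr ?nnegrE // real_normK ?num_real //; lra.
Qed.

Lemma cauchy0_tends f : cauchy0 f -> exists l, tends0 f l.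
Proof.
move=> hf.
have [a ha] : exists l, forall e, 0 < e -> exists2 d, 0 < d &
    forall t, 0 < t < d -> `|complex.Re (f t) - l| <= e.
  apply: real_cauchy0 => e e0; have [d d0 h] := hf _ (exprn_gt0 2 e0).
  exists d => // s t hs ht; have [] := ReIm_sqn (ltW e0) (h _ _ hs ht).
  by case: (f s) (f t) => [? ?] [? ?].
have [b hb] : exists l, forall e, 0 < e -> exists2 d, 0 < d &
    forall t, 0 < t < d -> `|complex.Im (f t) - l| <= e.
  apply: real_cauchy0 => e e0; have [d d0 h] := hf _ (exprn_gt0 2 e0).
  exists d => // s t hs ht; have [] := ReIm_sqn (ltW e0) (h _ _ hs ht).
  by case: (f s) (f t) => [? ?] [? ?].
exists (a +i* b) => e e0.
have e1 : 0 < Num.min 1 (e / 2) by rewrite lt_min ltr01 divr_gt0.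
have [d d0 hd] := ha _ e1; have [d' d'0 hd'] := hb _ e1.
exists (Num.min d d'); first by rewrite lt_min d0.
move=> t; rewrite lt_min => /and3P[t0 td td'].
have h1 : `|complex.Re (f t - (a +i* b))| <= Num.min 1 (e / 2).
  by have := hd t; rewrite t0 td => /(_ isT); case: (f t).
have h2 : `|complex.Im (f t - (a +i* b))| <= Num.min 1 (e / 2).
  by have := hd' t; rewrite t0 td' => /(_ isT); case: (f t).
apply: le_trans (sqn_ReIm (ltW e1) h1 h2) _.
have l1 : Num.min 1 (e / 2) <= 1 by rewrite ge_min lexx.
have l2 : Num.min 1 (e / 2) <= e / 2 by rewrite ge_min lexx orbT.
nra.
Qed.

(** The difference of the two squared moduli is the real part of
    [(x - y) (x + y)^*]. *)
Lemma sqnB_le (x y : C) : (sqn x - sqn y) ^+ 2 <= sqn (x - y) * sqn (x + y).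
Proof.
case: x y => [a b] [c d]; rewrite /sqn /=.
rewrite -subr_ge0 (_ : _ - _ = ((a - c) * (b + d) - (b - d) * (a + c)) ^+ 2).
  exact: sqr_ge0.
ring.
Qed.

Lemma sqn_continuous (x : C) eta : 0 < eta -> exists2 e, 0 < e &
  forall y, sqn (x - y) <= e -> `|sqn x - sqn y| <= eta.
Proof.
move=> eta0.
have c0 : 0 < 8 * sqn x + 2 by have := sqn_ge0 x; lra.
exists (Num.min 1 (eta ^+ 2 / (8 * sqn x + 2))).
  by rewrite lt_min ltr01 divr_gt0 // exprn_gt0.
move=> y; rewrite le_min ler_pdivlMr // => /andP[h1 h2].
rewrite -(ger0_norm (ltW eta0)) -ler_sqr ?nnegrE // !real_normK ?num_real //.
apply: le_trans h2.
have := sqnB_le x y.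
have : sqn (x + y) <= 8 * sqn x + 2 * sqn (x - y).
  have -> : x + y = (2 : R)%:C * x + - (x - y).
    by rewrite rmorphD rmorph1; ring.
  by apply: le_trans (sqnD2 _ _) _; rewrite sqnM sqnC sqnN; lra.
have := sqn_ge0 (x - y); nra.
Qed.

Lemma sqn_le_closed (x : C) K :
  (forall e, 0 < e -> exists2 y, sqn (x - y) <= e & sqn y <= K) -> sqn x <= K.
Proof.
move=> h; apply/ler_addgt0Pr => eta eta0.
have [e e0 he] := sqn_continuous x eta0; have [y xy yK] := h e e0.
by have := he y xy; rewrite ler_norml; lra.
Qed.

Lemma tends0_unique f l l' : tends0 f l -> tends0 f l' -> l = l'.
Proof.
move=> h h'; apply/eqP; rewrite -subr_eq0; apply/eqP/sqn_eq0/le_anti.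
rewrite sqn_ge0 andbT; apply/ler_addgt0Pr => e e0; rewrite add0r.
have e4 : 0 < e / 4 by rewrite divr_gt0.
have [d d0 hd] := h _ e4; have [d' d'0 hd'] := h' _ e4.
have m0 : 0 < Num.min d d' by rewrite lt_min d0.
have l1 : Num.min d d' <= d by rewrite ge_min lexx.
have l2 : Num.min d d' <= d' by rewrite ge_min lexx orbT.
set t := Num.min d d' / 2.
have := hd t; have := hd' t.
have -> : 0 < t < d by apply/andP; split; rewrite /t; lra.
have -> : 0 < t < d' by apply/andP; split; rewrite /t; lra.
move=> /(_ isT) i1 /(_ isT) i2.
have -> : l - l' = - (f t - l) + (f t - l') by ring.
by apply: le_trans (sqnD2 _ _) _; rewrite sqnN; lra.
Qed.

Lemma cauchy0D (f g : R -> C) : cauchy0 f -> cauchy0 g ->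
  cauchy0 (fun t => f t + g t).
Proof.
move=> hf hg e e0; have e4 : 0 < e / 4 by rewrite divr_gt0.
have [a a0 ha] := hf _ e4; have [b b0 hb] := hg _ e4.
exists (Num.min a b); first by rewrite lt_min a0.
move=> s t; rewrite !lt_min => /and3P[s0 sa sb] /and3P[t0 ta tb].
have := ha s t; rewrite s0 sa t0 ta => /(_ isT isT) h1.
have := hb s t; rewrite s0 sb t0 tb => /(_ isT isT) h2.
by rewrite opprD addrACA; apply: le_trans (sqnD2 _ _) _; lra.
Qed.

Lemma cauchy0Z (c : C) (f : R -> C) : cauchy0 f -> cauchy0 (fun t => c * f t).
Proof.
move=> hf e e0; have c1 : 0 < sqn c + 1 by have := sqn_ge0 c; lra.
have [a a0 ha] := hf _ (divr_gt0 e0 c1); exists a => // s t hs ht.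
have := ha s t hs ht; rewrite -mulrBr sqnM ler_pdivlMr //.
by have := sqn_ge0 (f s - f t); lra.
Qed.

Lemma cauchy0_cst (c : C) : cauchy0 (fun=> c : C).
Proof. by move=> e e0; exists 1 => // s t _ _; rewrite subrr sqn0 ltW. Qed.

Lemma cauchy0_near (f g : R -> C) e : 0 < e -> (forall t, 0 < t < e -> f t = g t) ->
  cauchy0 f -> cauchy0 g.
Proof.
move=> e0 h hf a a0; have [dl dl0 hd] := hf _ a0.
exists (Num.min e dl); first by rewrite lt_min e0.
move=> s t; rewrite !lt_min => /and3P[s0 se sd] /and3P[t0 te td].
by rewrite -!h ?s0 ?t0 //; apply: hd; rewrite ?s0 ?t0.
Qed.

Lemma tends0_cauchy (f : R -> C) l : tends0 f l -> cauchy0 f.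
Proof.
move=> h e e0; have [dl dl0 hd] := h _ (divr_gt0 e0 (ltr0n _ 4)).
exists dl => // s t hs ht; have -> : f s - f t = (f s - l) + - (f t - l) by ring.
by apply: le_trans (sqnD2 _ _) _; rewrite sqnN; have := hd s hs; have := hd t ht; lra.
Qed.

Lemma tends0_cst (c : C) : tends0 (fun=> c) c.
Proof. by move=> e e0; exists 1 => // t _; rewrite subrr sqn0 ltW. Qed.

Lemma tends0D (f g : R -> C) l l' : tends0 f l -> tends0 g l' ->
  tends0 (fun t => f t + g t) (l + l').
Proof.
move=> hf hg e e0; have e4 : 0 < e / 4 by rewrite divr_gt0.
have [a a0 ha] := hf _ e4; have [b b0 hb] := hg _ e4.
exists (Num.min a b); first by rewrite lt_min a0.
move=> t; rewrite !lt_min => /and3P[t0 ta tb].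
have := ha t; rewrite t0 ta => /(_ isT) h1.
have := hb t; rewrite t0 tb => /(_ isT) h2.
by rewrite opprD addrACA; apply: le_trans (sqnD2 _ _) _; lra.
Qed.

Lemma tends0Z (c : C) (f : R -> C) l : tends0 f l ->
  tends0 (fun t => c * f t) (c * l).
Proof.
move=> hf e e0; have c1 : 0 < sqn c + 1 by have := sqn_ge0 c; lra.
have [a a0 ha] := hf _ (divr_gt0 e0 c1); exists a => // t ht.
have := ha t ht; rewrite -mulrBr sqnM ler_pdivlMr //.
by have := sqn_ge0 (f t - l); lra.
Qed.

Lemma tends0_sum (I : finType) (F : I -> R -> C) (l : I -> C) :
  (forall i, tends0 (F i) (l i)) -> tends0 (fun t => \sum_i F i t) (\sum_i l i).
Proof.
move=> h; rewrite (_ : (fun t => _) = \sum_i F i); last first.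
  by apply/funext => t; rewrite fct_sumE.
apply: (big_ind2 (fun f l => tends0 f l)) => [|f a g b hf hg|i _].
- exact: tends0_cst.
- exact: tends0D.
- exact: h.
Qed.

Lemma tends0_near (f g : R -> C) l e : 0 < e -> (forall t, 0 < t < e -> f t = g t) ->
  tends0 f l -> tends0 g l.
Proof.
move=> e0 h hf a a0; have [dl dl0 hd] := hf _ a0.
exists (Num.min e dl); first by rewrite lt_min e0.
move=> t; rewrite !lt_min => /and3P[t0 te td].
by rewrite -h ?t0 //; apply: hd; rewrite t0.
Qed.

Lemma tends0_rescale (f : R -> C) l r : 0 < r -> tends0 f l ->
  tends0 (fun t => f (r * t)) l.
Proof.
move=> r0 hf e e0; have [dl dl0 hd] := hf e e0.
exists (dl / r); first by rewrite divr_gt0.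
by move=> t /andP[t0]; rewrite ltr_pdivlMr // mulrC => h; apply: hd; rewrite mulr_gt0.
Qed.

Lemma tends0_le (f : R -> C) l K e : 0 < e ->
  (forall t, 0 < t < e -> sqn (f t) <= K) -> tends0 f l -> sqn l <= K.
Proof.
move=> e0 h hf; apply: sqn_le_closed => a a0; have [dl dl0 hd] := hf a a0.
have m0 : 0 < Num.min e dl by rewrite lt_min e0.
have l1 : Num.min e dl <= e by rewrite ge_min lexx.
have l2 : Num.min e dl <= dl by rewrite ge_min lexx orbT.
exists (f (Num.min e dl / 2)).
  by rewrite -sqnN opprB; apply: hd; apply/andP; split; lra.
by apply: h; apply/andP; split; lra.
Qed.

Lemma tends0_mulmx m n p r (P : 'M[C]_(m, n)) (Q : 'M[C]_(p, r))
    (F : R -> 'M[C]_(n, p)) (N : 'M[C]_(n, p)) :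
  (forall i j, tends0 (fun t => F t i j) (N i j)) ->
  forall i j, tends0 (fun t => (P *m F t *m Q) i j) ((P *m N *m Q) i j).
Proof.
move=> h i j; rewrite mxE; under eq_fun do rewrite mxE.
apply: tends0_sum => k; rewrite mulrC; under eq_fun do rewrite mulrC.
apply: tends0Z; rewrite mxE; under eq_fun do rewrite mxE.
by apply: tends0_sum => k'; exact: tends0Z.
Qed.

Lemma le_of_scaled (x y : R) :
  (forall th, 0 < th < 1 -> th * x <= y) -> 0 <= y -> x <= y.
Proof.
move=> h y0; rewrite leNgt; apply/negP => yx.
have x0 : 0 < x by lra.
have h1 : 0 < (x + y) / (2 * x) < 1.
  by apply/andP; split; [rewrite divr_gt0 //; lra | rewrite ltr_pdivrMr; lra].
have e : (x + y) / (2 * x) * x = (x + y) / 2 by field; rewrite gt_eqF.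
by have := h _ h1; rewrite e; lra.
Qed.

End OneSidedLimits.

(** * The scalar Julia--Caratheodory theorem *)

Section ScalarJuliaCaratheodory.
Variable R : realType.
Local Notation C := R[i].

Variables (g : R -> C) (om : C) (Cc K t0 : R).
Hypothesis om_unit : sqn om = 1.
Hypothesis Cc_gt0 : 0 < Cc.
Hypothesis K_ge0 : 0 <= K.
Hypothesis t0_gt0 : 0 < t0.
Hypothesis t0_Cc : t0 * Cc <= 1.
Hypothesis g_le1 : forall t, 0 < t < t0 -> sqn (g t) <= 1.
Hypothesis g_bound : forall t, 0 < t < t0 -> sqn (g t - om) <= K * t ^+ 2.
Hypothesis g_pick : forall s t, 0 < s < t0 -> 0 < t < t0 -> s != t ->
  (2 * t - Cc * t ^+ 2) * (2 * s - Cc * s ^+ 2) * sqn (g t - g s) <=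
    (t - s) ^+ 2 * ((1 - sqn (g t)) * (1 - sqn (g s))).

Let gap t := 2 * t - Cc * t ^+ 2.
Let quot t := (1 - sqn (g t)) / gap t.
Let slope t := (t^-1)%:C * (om - g t) * om^*.

Let gap_ge t : 0 < t < t0 -> t <= gap t.
Proof.
move=> /andP[h1 h2]; rewrite /gap.
have : t * Cc <= 1 by apply: le_trans t0_Cc; rewrite ler_pM2r // ltW.
nra.
Qed.

Let gap_gt0 t : 0 < t < t0 -> 0 < gap t.
Proof. by move=> h; apply: lt_le_trans (gap_ge h); case/andP: h. Qed.

Let gE t : 0 < t -> g t = om * (1 - t%:C * slope t).
Proof.
move=> h; have n0 : t%:C != 0 :> C by rewrite eq_complex /= eqxx andbT gt_eqF.
have o1 : om * om^* = 1 by rewrite mulrC mul_conjc om_unit.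
rewrite /slope fmorphV /= !mulrA mulfV // mul1r mulrBr mulr1 mulrCA o1 mulr1.
by ring.
Qed.

Let one_sub t : 0 < t -> 1 - sqn (g t) =
  2 * t * complex.Re (slope t) - t ^+ 2 * sqn (slope t).
Proof.
move=> h; rewrite gE // sqnM om_unit mul1r.
by case: (slope t) => a b; rewrite /sqn /=; ring.
Qed.

Let sub_om t : 0 < t -> sqn (g t - om) = t ^+ 2 * sqn (slope t).
Proof.
move=> h; rewrite gE //.
have -> : om * (1 - t%:C * slope t) - om = - (om * (t%:C * slope t)) by ring.
by rewrite sqnN !sqnM om_unit mul1r sqnC.
Qed.

Let quot_ge0 t : 0 < t < t0 -> 0 <= quot t.
Proof. by move=> h; apply: divr_ge0; [rewrite subr_ge0; exact: g_le1 | exact/ltW/gap_gt0]. Qed.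

Let slope_le t : 0 < t < t0 -> sqn (slope t) <= K.
Proof.
move=> h; have /andP[h0 _] := h; have := g_bound h; rewrite sub_om // mulrC.
by rewrite ler_pM2r // exprn_gt0.
Qed.

(** The lower limit [al] of [quot] bounds the distance of [g t] to the boundary
    value by its defect [1 - |g t|^2]: the variable [s] of the Schwarz--Pick
    inequality is sent to zero along points where [quot] is close to [al]. *)
Let boundary_pick al : (forall e dl, 0 < e -> 0 < dl -> exists2 s,
      0 < s < Num.min dl t0 & quot s <= al + e) ->
  forall t, 0 < t < t0 -> gap t * sqn (g t - om) <= t ^+ 2 * (1 - sqn (g t)) * al.
Proof.
move=> hal t ht; have /andP[h0 _] := ht; have gt := gap_gt0 ht.
have o1 : 0 <= 1 - sqn (g t) by rewrite subr_ge0 g_le1.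
have c1 : 0 < t ^+ 2 * (1 - sqn (g t)) + 1.
  by rewrite ltr_wpDl // mulr_ge0 ?sqr_ge0.
apply/ler_addgt0Pr => eta eta0.
rewrite mulrC -ler_pdivlMr //; apply: sqn_le_closed => e e0.
have dl0 : 0 < Num.min (Num.min t 1) (e / (K + 1)).
  by rewrite !lt_min h0 ltr01 divr_gt0 // ltr_wpDl.
have [s] := hal _ _ (divr_gt0 eta0 c1) dl0.
rewrite !lt_min => /andP[s0 /andP[/andP[/andP[st s1] se] st0]] hs.
have hst : 0 < s < t0 by rewrite s0.
have gs := gap_gt0 hst.
exists (g t - g s).
  have -> : g t - om - (g t - g s) = g s - om by ring.
  apply: le_trans (g_bound hst) _.
  by move: se; rewrite ltr_pdivlMr ?ltr_wpDl //; nra.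
rewrite ler_pdivlMr // mulrC.
have := g_pick hst ht; rewrite lt_eqF // -/(gap t) -/(gap s) => /(_ isT).
have -> : 1 - sqn (g s) = quot s * gap s by rewrite mulfVK // gt_eqF.
set S := sqn _; move: o1 c1 hs; set A := 1 - sqn (g t) => o1 c1 hs h.
have {}h : gap t * S <= (t - s) ^+ 2 * (A * quot s).
  by rewrite -(ler_pM2r gs); lra.
apply: le_trans h _.
have q0 := quot_ge0 hst.
apply: (@le_trans _ _ (t ^+ 2 * (A * quot s))).
  apply: ler_wpM2r; first exact: mulr_ge0.
  by rewrite ler_sqr ?nnegrE; lra.
apply: (@le_trans _ _ (t ^+ 2 * A * (al + eta / (t ^+ 2 * A + 1)))).
  by rewrite mulrA ler_wpM2l // mulr_ge0 ?sqr_ge0.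
rewrite mulrDr lerD2l mulrA ler_pdivrMr // mulrC ler_wpM2l ?lerDl //.
exact: ltW.
Qed.

(** The slopes converge to the lower limit [al] of [quot]. Writing [D] for the
    slope at [t], the boundary inequality reads
    [(2 - Cc t) |D|^2 <= 2 al Re D], whereas the definition of [al] gives
    [(al - eps) (2 - Cc t) <= 2 Re D]. Together they make
    [|D - al|^2 = |D|^2 - 2 al Re D + al^2] small. *)
Lemma scalar_julia_caratheodory :
  exists al : R, tends0 (fun t => (t^-1)%:C * (om - g t) * om^*) al%:C.
Proof.
have slow : 0 \in elower quot.
  by rewrite inE; exists t0 => // t ht; exact: quot_ge0.
have hs : has_sup (elower quot).
  split; first by exists 0; rewrite -inE.
  exists (K + 1) => x [dl dl0 hx].
  have m0 : 0 < Num.min dl t0 by rewrite lt_min dl0.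
  have l1 : Num.min dl t0 <= dl by rewrite ge_min lexx.
  have l2 : Num.min dl t0 <= t0 by rewrite ge_min lexx orbT.
  set t := Num.min dl t0 / 2.
  have ht : 0 < t < t0 by apply/andP; split; rewrite /t; lra.
  have htd : 0 < t < dl by apply/andP; split; rewrite /t; lra.
  apply: le_trans (hx t htd) _; rewrite /quot ler_pdivrMr ?gap_gt0 //.
  have /andP[tp _] := ht; rewrite one_sub //.
  have := slope_le ht; have := gap_ge ht.
  have : 2 * complex.Re (slope t) <= 1 + sqn (slope t).
    case: (slope t) => a b; rewrite /sqn /=.
    by have := sqr_ge0 (1 - a); have := sqr_ge0 b; lra.
  by have := sqn_ge0 (slope t); nra.
set al := sup (elower quot).
have al0 : 0 <= al by apply: (ub_le_sup hs.2); rewrite -inE.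
have below e : 0 < e -> exists2 dl, 0 < dl & forall t, 0 < t < dl -> al - e <= quot t.
  move=> e0; have [x [dl dl0 hx] xe] := sup_adherent e0 hs.
  by exists dl => // t ht; apply: le_trans (hx t ht); exact: ltW.
have above e dl : 0 < e -> 0 < dl ->
    exists2 s, 0 < s < Num.min dl t0 & quot s <= al + e.
  move=> e0 dl0; apply: contrapT => hn.
  have : elower quot (al + e).
    exists (Num.min dl t0); first by rewrite lt_min dl0.
    move=> s hst; rewrite leNgt; apply/negP => hq; apply: hn.
    by exists s => //; exact: ltW.
  by move/(ub_le_sup hs.2); rewrite -/al; lra.
exists al => e e0.
have e2 : 0 < e / (2 * (al + 1)) by rewrite divr_gt0 // mulr_gt0 // ltr_wpDl.
have [dl dl0 hdl] := below _ e2.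
have k0 : 0 < 2 * (al ^+ 2 * Cc + 1).
  by rewrite mulr_gt0 // ltr_wpDl // mulr_ge0 ?sqr_ge0 // ltW.
exists (Num.min (Num.min dl t0) (e / (2 * (al ^+ 2 * Cc + 1)))).
  by rewrite !lt_min dl0 t0_gt0 divr_gt0.
move=> t; rewrite !lt_min ltr_pdivlMr // => /andP[tp /andP[/andP[td tt0] te]].
have ht : 0 < t < t0 by rewrite tp.
have htd : 0 < t < dl by rewrite tp.
have := boundary_pick above ht; have := hdl t htd.
rewrite /quot ler_pdivlMr ?gap_gt0 // one_sub // sub_om // -/(slope t) => h1 h2.
have tC : t * Cc <= 1 by apply: le_trans t0_Cc; rewrite ler_pM2r // ltW.
have e3 : al * (e / (2 * (al + 1))) <= e / 2.
  rewrite mulrA ler_pdivrMr ?mulr_gt0 ?ltr_wpDl //.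
  by nra.
move: h1 h2 e3; set eps := e / (2 * _); rewrite /gap.
case: (slope t) => x y; rewrite /sqn /= subr0.
have s0 : 0 <= x ^+ 2 + y ^+ 2 by rewrite addr_ge0 ?sqr_ge0.
move: s0; rewrite (_ : (x - al) ^+ 2 + y ^+ 2 =
  (x ^+ 2 + y ^+ 2) - 2 * al * x + al ^+ 2); last by ring.
set S := x ^+ 2 + y ^+ 2 => s0 h1 h2 e3.
have {}h1 : (al - eps) * (2 - Cc * t) <= 2 * x.
  have tS : 0 <= t * S by rewrite mulr_ge0 // ltW.
  by rewrite -(ler_pM2l tp); nra.
have {}h2 : (2 - Cc * t) * S <= 2 * al * x.
  have t3 : 0 < t ^+ 3 by rewrite exprn_gt0.
  have t4 : 0 <= t ^+ 4 by rewrite exprn_ge0 // ltW.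
  have a4 : 0 <= al * t ^+ 4 * S by apply: mulr_ge0 => //; exact: mulr_ge0.
  rewrite -(ler_pM2l t3); nra.
have c1 : 0 < 2 - Cc * t by lra.
rewrite -(ler_pM2l c1).
(* the two bounds combine with the weights [1] and [al * (1 - C t)] *)
have h3 : al * (1 - Cc * t) * ((al - eps) * (2 - Cc * t)) <=
    al * (1 - Cc * t) * (2 * x).
  by rewrite ler_wpM2l // mulr_ge0 // subr_ge0 mulrC.
have h4 : al ^+ 2 * Cc * t + al * eps * (1 - Cc * t) <= e.
  have : 0 <= al * eps * (Cc * t).
    have ct := ltW (mulr_gt0 Cc_gt0 tp).
    by apply: mulr_ge0 => //; apply: mulr_ge0 => //; exact: ltW e2.
  by nra.
have := ler_wpM2l (ltW c1) h4.
by nra.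
Qed.

End ScalarJuliaCaratheodory.

(** * Inward directions *)

Section Directions.
Variables (R : realType) (d q : nat) (kap : 'I_d -> 'I_q).
Variable T : nctuple R d 1.
Local Notation C := R[i].

(** The inner product of the [k]-th block of [H] with the [k]-th block of [T]. Its
    real part is half the derivative of the squared norm of the block at [T] in
    the direction [H]. *)
Definition tcomp k m n (H : 'I_d -> 'M[C]_(m, n)) : 'M[C]_(m, n) :=
  \sum_(i | kap i == k) (T i 0 0)^* *: H i.

Definition inward (mu : R) n (H : nctuple R d n) : Prop :=
  forall k v, complex.Re (dot v (tcomp k H *m v)) <= - mu * n2 v.

Definition ray n (H : nctuple R d n) (t : R) : nctuple R d n :=
  fun i => (T i 0 0)%:M + t%:C *: H i.

Hypothesis T_unit : forall k, \sum_(i | kap i == k) sqn (T i 0 0) = 1.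

Lemma shift_n2 k n (u : 'cV[C]_n) (w : 'I_d -> 'cV[C]_n) :
  \sum_(i | kap i == k) n2 (T i 0 0 *: u + w i) =
    n2 u + 2 * complex.Re (dot u (\sum_(i | kap i == k) (T i 0 0)^* *: w i))
    + \sum_(i | kap i == k) n2 (w i).
Proof.
rewrite dot_sumr (raddf_sum (@complex.Re R : Rcomplex R -> R)) mulr_sumr.
have -> : n2 u = \sum_(i | kap i == k) sqn (T i 0 0) * n2 u.
  by rewrite -mulr_suml T_unit mul1r.
rewrite -!big_split /=.
apply: eq_bigr => i _; rewrite n2D n2Z dotZl dotZr.
ring.
Qed.

Lemma tcomp_mul k n (H : nctuple R d n) (u : 'cV[C]_n) :
  \sum_(i | kap i == k) (T i 0 0)^* *: (H i *m u) = tcomp k H *m u.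
Proof. by rewrite /tcomp mulmx_suml; apply: eq_bigr => i _; rewrite scalemxAl. Qed.

Lemma ray_blockn2 k n (H : nctuple R d n) t v :
  blockn2 kap k (ray H t) v =
    n2 v + 2 * t * complex.Re (dot v (tcomp k H *m v)) + t ^+ 2 * blockn2 kap k H v.
Proof.
rewrite /blockn2 (eq_bigr (fun i => n2 (T i 0 0 *: v + t%:C *: (H i *m v)))).
  rewrite shift_n2; congr (_ + _ + _).
    under eq_bigr do rewrite scalerA mulrC -scalerA.
    by rewrite -scaler_sumr tcomp_mul dotZr Re_realM mulrA.
  by rewrite mulr_sumr; apply: eq_bigr => i _; rewrite n2Z sqnC.
by move=> i _; rewrite /ray mulmxDl mul_scalar_mx -scalemxAl.
Qed.

Lemma ray_polyb n (H : nctuple R d n) mu B t : inward mu H -> polyb kap B H ->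
  0 < t -> t * B <= mu -> polyb kap (1 - t * mu) (ray H t).
Proof.
move=> hm hB t0 htB k v; rewrite ray_blockn2.
have h1 : t * complex.Re (dot v (tcomp k H *m v)) <= t * (- mu * n2 v).
  by rewrite ler_pM2l.
have h2 : t ^+ 2 * blockn2 kap k H v <= t * (t * B * n2 v).
  by rewrite expr2 -!mulrA ler_pM2l // ler_pM2l.
have h3 : t * (t * B * n2 v) <= t * (mu * n2 v).
  by rewrite ler_pM2l // ler_wpM2r // n2_ge0.
lra.
Qed.

Lemma ray_polyball n (H : nctuple R d n) mu B t : (0 < n)%N -> 0 < mu ->
  inward mu H -> polyb kap B H -> 0 < t -> t * B <= mu ->
  polyball kap (ray H t).
Proof.
move=> n0 mu0 hm hB t0 htB; apply: (@gap_polyball _ _ _ _ _ _ (t * mu)) => //.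
  by rewrite mulr_gt0.
exact: ray_polyb.
Qed.

End Directions.

Section InwardDirections.
Variables (R : realType) (d q : nat) (kap : 'I_d -> 'I_q) (T : nctuple R d 1).
Local Notation C := R[i].

Lemma tcompD k m n (x y : 'I_d -> 'M[C]_(m, n)) :
  tcomp kap T k (fun i => x i + y i) = tcomp kap T k x + tcomp kap T k y.
Proof. by rewrite /tcomp -big_split; apply: eq_bigr => i _; rewrite scalerDr. Qed.

Lemma tcompZ k m n a (x : 'I_d -> 'M[C]_(m, n)) :
  tcomp kap T k (fun i => a *: x i) = a *: tcomp kap T k x.
Proof.
by rewrite /tcomp scaler_sumr; apply: eq_bigr => i _; rewrite !scalerA mulrC.
Qed.

Lemma tcomp_triang k n1 n (X : nctuple R d n1) (Y : 'I_d -> 'M[C]_(n1, n))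
    (Z : nctuple R d n) :
  tcomp kap T k (nctriang X Y Z) =
    block_mx (tcomp kap T k X) (tcomp kap T k Y) 0 (tcomp kap T k Z).
Proof.
rewrite /tcomp /nctriang; apply/matrixP => i j; rewrite summxE.
case: (split_ordP i) => i' ->; case: (split_ordP j) => j' ->.
- by rewrite block_mxEul summxE; apply: eq_bigr => r _; rewrite [LHS]mxE block_mxEul [RHS]mxE.
- by rewrite block_mxEur summxE; apply: eq_bigr => r _; rewrite [LHS]mxE block_mxEur [RHS]mxE.
- by rewrite block_mxEdl mxE big1 // => r _; rewrite mxE block_mxEdl mxE mulr0.
by rewrite block_mxEdr summxE; apply: eq_bigr => r _; rewrite [LHS]mxE block_mxEdr [RHS]mxE.
Qed.

Lemma ray_dsum m n (x : nctuple R d m) (y : nctuple R d n) t :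
  ray T (ncdsum x y) t = ncdsum (ray T x t) (ray T y t).
Proof.
apply/funext => i; rewrite /ray /ncdsum scalar_mx_block scale_block_mx.
by rewrite add_block_mx !scaler0 !addr0.
Qed.

Lemma ray_conj n (s : 'M[C]_n) (x : nctuple R d n) t : s \in unitmx ->
  ray T (ncconj s x) t = ncconj s (ray T x t).
Proof.
move=> us; apply/funext => i; rewrite /ray /ncconj mulmxDr mulmxDl conj_scalar //.
by rewrite -scalemxAr -scalemxAl.
Qed.

Lemma inward_le mu mu' n (H : nctuple R d n) :
  mu' <= mu -> inward kap T mu H -> inward kap T mu' H.
Proof.
move=> h hm k v; apply: le_trans (hm k v) _.
by rewrite !mulNr lerN2 ler_wpM2r // n2_ge0.
Qed.

Lemma inward_scale mu n (H : nctuple R d n) (r : R) : 0 < r ->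
  inward kap T mu H -> inward kap T (r * mu) (fun i => r%:C%C *: H i).
Proof.
move=> r0 hm k v; rewrite tcompZ -scalemxAl dotZr Re_realM mulNr -mulrA -mulrN.
by rewrite -mulNr ler_pM2l.
Qed.

Definition inward_set : ncset R d :=
  fun n => [set H | (0 < n)%N /\ exists2 mu, 0 < mu & inward kap T mu H].

Lemma inward_set_dsum m n (x : nctuple R d m) (y : nctuple R d n) :
  inward_set x -> inward_set y -> inward_set (ncdsum x y).
Proof.
case=> m0 [a a0 ha] [n0 [b b0 hb]]; split; first by rewrite addn_gt0 m0.
have ab0 : 0 < Num.min a b by rewrite lt_min a0.
exists (Num.min a b) => // k w.
have {}ha := inward_le (_ : Num.min a b <= a) ha.
have {}hb := inward_le (_ : Num.min a b <= b) hb.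
rewrite -(vsubmxK w) ncdsum_triang tcomp_triang.
have -> : tcomp kap T k (fun=> 0 : 'M[C]_(m, n)) = 0.
  by rewrite /tcomp big1 // => i _; rewrite scaler0.
rewrite mul_block_col !mul0mx addr0 add0r dot_col n2_col raddfD mulrDr /=.
by apply: lerD; [apply: ha; rewrite ge_min lexx | apply: hb; rewrite ge_min lexx orbT].
Qed.

Hypothesis T_unit : forall k, \sum_(i | kap i == k) sqn (T i 0 0) = 1.

Lemma polyb_T : polyb kap 1 T.
Proof. by move=> k v; rewrite -(ncampl1 T) blockn2_ampl T_unit. Qed.

Lemma tcomp_along k m (L : 'I_q -> 'M[C]_m) :
  tcomp kap T k (fun i => T i 0 0 *: L (kap i)) = L k.
Proof.
rewrite /tcomp (eq_bigr (fun i => (sqn (T i 0 0))%:C *: L k)).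
  by rewrite -scaler_suml -rmorph_sum T_unit scale1r.
by move=> i /eqP <-; rewrite scalerA mul_conjc.
Qed.

(** The squared norm of the [k]-th block of [H v - T u] is non-negative; expanding
    it leaves twice the form. *)
Lemma tcomp_form b k n (H : nctuple R d n) (u v : 'cV[C]_n) :
  polyb kap b H -> complex.Re (dot u (tcomp kap T k H *m v)) <=
    (n2 u + b * n2 v) / 2.
Proof.
move=> hb.
have := shift_n2 T_unit k (- u) (fun i => H i *m v).
rewrite tcomp_mul n2N -scaleN1r dotZl rmorphN rmorph1 mulN1r raddfN /=.
have : 0 <= \sum_(i | kap i == k) n2 (T i 0 0 *: (-1 *: u) + H i *m v).
  by apply: sumr_ge0 => i _; exact: n2_ge0.
have := hb k v; rewrite /blockn2.
set S := \sum_(i | _) n2 (H i *m v); set S' := \sum_(i | _) _; lra.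
Qed.

(** Satisfied when the components of [H] along [T] are Hermitian. *)
Definition symdir n (H : nctuple R d n) : Prop :=
  forall k u v, complex.Re (dot u (tcomp kap T k H *m v)) =
    complex.Re (dot v (tcomp kap T k H *m u)).

(** Along a direction with Hermitian components, the triangular tuples with
    diagonal [ray H t], [ray H s] and corner [c *: H] behave as upper triangular
    two-by-two matrices over a disc that touches the boundary at [T]. The
    condition on [c] is the sharp one for that disc; sharpness is what makes the
    resulting Schwarz--Pick inequality strong enough for the existence of
    limits. *)
Lemma sym_triang n (H : nctuple R d n) mu B s t (c : R) :
  (0 < n)%N -> 0 < mu -> 0 < B -> inward kap T mu H -> polyb kap B H -> symdir H ->
  0 < s -> 0 < t -> t * (B / mu) <= 1 -> s * (B / mu) <= 1 -> s != t ->
  c ^+ 2 < (2 * t - B / mu * t ^+ 2) * (2 * s - B / mu * s ^+ 2) ->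
  polyball kap (nctriang (ray T H t)
    (fun i => ray T H t i *m (c / (t - s))%:C%:M
              - (c / (t - s))%:C%:M *m ray T H s i) (ray T H s)).
Proof.
move=> n0 mu0 B0 hm hB hs s0 t0 tC sC st hc; split; first by rewrite addn_gt0 n0.
set Cc := B / mu in tC sC hc.
have Cc0 : 0 < Cc by rewrite divr_gt0.
set ga := 2 * t - Cc * t ^+ 2 in hc; set gb := 2 * s - Cc * s ^+ 2 in hc.
have ga0 : 0 < ga by rewrite /ga; nra.
(* [ga], [gb'] and [c * (1 - Cc * t)] are the entries of the Gram matrix of the
   defect; [de] is its determinant divided by its trace *)
set gb' := gb - Cc * c ^+ 2.
have det : ga * gb' - (c * (1 - Cc * t)) ^+ 2 = ga * gb - c ^+ 2.
  by rewrite /gb' /ga; ring.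
have gb0 : 0 < gb'.
  have : 0 < ga * gb'.
    by have := sqr_ge0 (c * (1 - Cc * t)); lra.
  by rewrite pmulr_rgt0.
set de := (ga * gb - c ^+ 2) / (ga + gb').
have de0 : 0 < de by rewrite divr_gt0 ?subr_gt0 // addr_gt0.
have deE : de * (ga + gb') = ga * gb' - (c * (1 - Cc * t)) ^+ 2.
  by rewrite det divfK // gt_eqF // addr_gt0.
have dea : 0 < ga - de.
  rewrite subr_gt0 -(ltr_pM2r (addr_gt0 ga0 gb0)) deE.
  by have := sqr_ge0 (c * (1 - Cc * t)); nra.
exists (1 - de * mu); first by rewrite ltrBlDr ltrDl mulr_gt0.
move=> k w; rewrite -(vsubmxK w) n2_col blockn2_triang.
set u := usubmx w; set v := dsubmx w.
set L := tcomp kap T k H.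
have cE i : ray T H t i *m (c / (t - s))%:C%:M - (c / (t - s))%:C%:M *m ray T H s i
    = c%:C *: H i.
  rewrite mul_mx_scalar mul_scalar_mx -scalerBr /ray opprD addrACA subrr add0r.
  rewrite -scalerBl scalerA -rmorphB -rmorphM divfK // subr_eq0 eq_sym //.
under eq_bigr do rewrite cE.
have uE i : ray T H t i *m u + c%:C *: H i *m v =
    T i 0 0 *: u + H i *m (t%:C *: u + c%:C *: v).
  by rewrite /ray mulmxDl mul_scalar_mx mulmxDr -!scalemxAr -!scalemxAl addrA.
under eq_bigr do rewrite uE.
rewrite shift_n2 // tcomp_mul -/L ray_blockn2 // -/L.
have -> : complex.Re (dot u (L *m (t%:C *: u + c%:C *: v))) =
    t * complex.Re (dot u (L *m u)) + c * complex.Re (dot u (L *m v)).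
  by rewrite mulmxDr -!scalemxAr dotDr !dotZr raddfD /= !Re_realM.
have bound w' : blockn2 kap k H w' <= Cc * - complex.Re (dot w' (L *m w')).
  apply: le_trans (hB k w') _; rewrite /Cc mulrAC ler_pdivlMr // -mulrA.
  by rewrite ler_pM2l // mulrC; have := hm k w'; rewrite -/L; lra.
have h1 : \sum_(i | kap i == k) n2 (H i *m (t%:C *: u + c%:C *: v)) <=
    Cc * - (t ^+ 2 * complex.Re (dot u (L *m u))
            + 2 * t * c * complex.Re (dot u (L *m v))
            + c ^+ 2 * complex.Re (dot v (L *m v))).
  by rewrite -(quadratic_comb _ _ _ _ (hs k)); exact: bound.
have h2 := ler_wpM2l (sqr_ge0 s) (bound v).
have pu := hm k u; have pv := hm k v; rewrite -/L in pu pv.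
have pos : complex.Re (dot ((ga - de)%:C *: u + (c * (1 - Cc * t))%:C *: v)
    (L *m ((ga - de)%:C *: u + (c * (1 - Cc * t))%:C *: v))) <= 0.
  apply: le_trans (hm k _) _; rewrite mulNr oppr_le0 mulr_ge0 ?n2_ge0 //.
  exact: ltW.
rewrite (quadratic_comb _ _ _ _ (hs k)) -/L in pos.
move: pos h1 h2 pu pv.
set a := complex.Re (dot u (L *m u)); set r := complex.Re (dot u (L *m v)).
set b := complex.Re (dot v (L *m v)).
set nu := n2 u; set nv := n2 v; set S1 := \sum_(i | _) _; set S2 := blockn2 _ _ _ _.
have nu0 : 0 <= nu by exact: n2_ge0.
have nv0 : 0 <= nv by exact: n2_ge0.
clearbody a r b nu nv S1 S2 => pos h1 h2 pu pv.
have b0 : b <= 0 by apply: le_trans pv _; rewrite mulNr oppr_le0 mulr_ge0 // ltW.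
have key : (ga - de) * a + 2 * (c * (1 - Cc * t)) * r + (gb' - de) * b <= 0.
  rewrite -(ler_pM2l dea) mulr0.
  have e1 : (ga - de) * (gb' - de) - (c * (1 - Cc * t)) ^+ 2 = de ^+ 2.
    transitivity (de ^+ 2 + (ga * gb' - (c * (1 - Cc * t)) ^+ 2 - de * (ga + gb'))).
      by ring.
    by rewrite deE subrr addr0.
  have : de ^+ 2 * b <= 0 by rewrite mulr_ge0_le0 // sqr_ge0.
  rewrite -e1; move: pos; clear; clearbody ga gb' de; lra.
have h3 : de * a <= de * (- mu * nu) by rewrite ler_pM2l.
have h4 : de * b <= de * (- mu * nv) by rewrite ler_pM2l.
move: key h1 h2 h3 h4; rewrite /gb' /gb /ga; clear; clearbody Cc de; lra.
Qed.

End InwardDirections.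

(** * Newton interpolation by staircase tuples *)

Section Staircase.
Variables (R : realType) (d m : nat) (A B : nctuple R d m).
Variables (rho : R[i]) (node : nat -> R[i]).
Local Notation C := R[i].

Definition pencil (l : C) : nctuple R d m := fun i => A i + l *: B i.

Fixpoint bdim k : nat := if k is k'.+1 then (m + bdim k')%N else m.

Definition firstcols k : 'M[C]_m -> 'M[C]_(m, bdim k) :=
  if k is k'.+1 then fun Y => row_mx Y 0 else id.

Definition firstrows k : 'cV[C]_(bdim k) -> 'cV[C]_m :=
  if k is k'.+1 then fun w => usubmx w else id.

Fixpoint lastidx k : 'I_m -> 'I_(bdim k) :=
  if k is k'.+1 then fun b => rshift m (lastidx k' b) else id.

Fixpoint lastcols k : 'M[C]_(bdim k, m) :=
  if k is k'.+1 then col_mx 0 (lastcols k') else 1%:M.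

(** [stair k] is the pencil evaluated at the bidiagonal matrix with diagonal
    [node k, ..., node 0] and superdiagonal [rho]; [step k l] puts [l] on top
    of it. *)
Fixpoint stair k : nctuple R d (bdim k) :=
  if k is k'.+1 then
    nctriang (pencil (node k)) (fun i => firstcols k' (rho *: B i)) (stair k')
  else pencil (node 0).

Definition step k (l : C) : nctuple R d (m + bdim k) :=
  nctriang (pencil l) (fun i => firstcols k (rho *: B i)) (stair k).

Definition coef k l : C := rho / (l - node k).

Fixpoint weight k l : C :=
  if k is k'.+1 then coef k l * weight k' l else coef 0 l.

(** The row of scalar blocks solving the Sylvester equation that moves the first
    superdiagonal block of [step k l] into a similarity. *)
Fixpoint solrow k l : 'M[C]_(m, bdim k) :=
  if k is k'.+1 then row_mx (coef k l)%:M (coef k l *: solrow k' l)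
  else (coef 0 l)%:M.

(** [weight k l] times the value at [l] of the Newton interpolant of [h] at the
    nodes [node 0, ..., node k]. *)
Fixpoint newton k l (h : C -> 'M[C]_m) : 'M[C]_m :=
  if k is k'.+1 then
    coef k l *: (weight k' (node k) *: h (node k) - newton k' (node k) h
                 + newton k' l h)
  else coef 0 l *: h (node 0).

Lemma firstcols_mul k Y w : firstcols k Y *m w = Y *m firstrows w.
Proof.
case: k w => [|k] //= w; rewrite -{1}(vsubmxK w) mul_row_col mul0mx addr0 //.
Qed.

Lemma solrow_last k l : solrow k l *m lastcols k = (weight k l)%:M.
Proof.
elim: k => [|k IH] /=; first by rewrite mulmx1.
by rewrite mul_row_col mulmx0 add0r -scalemxAl IH scale_scalar_mx.
Qed.

Lemma mul_lastcols p k (N : 'M[C]_(p, bdim k)) a b :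
  (N *m lastcols k) a b = N a (lastidx k b).
Proof.
elim: k N => [|k IH] /= N; first by rewrite mulmx1.
by rewrite -[N in LHS]hsubmxK mul_row_col mulmx0 add0r IH mxE.
Qed.

Lemma coef_diff k l : l != node k -> coef k l * (l - node k) = rho.
Proof. by move=> h; rewrite /coef divfK // subr_eq0. Qed.

Lemma pencil_diff k l i : l != node k ->
  coef k l *: (pencil l i - pencil (node k) i) = rho *: B i.
Proof.
by move=> h; rewrite /pencil opprD addrACA subrr add0r -scalerBl scalerA coef_diff.
Qed.

(** Two values of the pencil differ by a scalar multiple of [B], so the factor
    [coef k l] creates the block [rho *: B] in the first column; what it leaves
    over in the other columns is cancelled by the solution for [stair k]. *)
Lemma solrow_sylvester k l i : (forall j, (j <= k)%N -> l != node j) ->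
  pencil l i *m solrow k l - solrow k l *m stair k i = firstcols k (rho *: B i).
Proof.
elim: k => [|k IH] h /=.
  by rewrite mul_mx_scalar mul_scalar_mx -scalerBr pencil_diff // h.
rewrite mul_mx_row mul_row_block mulmx0 addr0 opp_row_mx add_row_mx.
rewrite mul_mx_scalar !mul_scalar_mx -scalerBr pencil_diff ?h //.
congr row_mx; rewrite opprD addrCA -scalemxAr -scalemxAl -scalerBr.
rewrite IH => [|j hj]; last by rewrite h // leqW.
by rewrite addNr.
Qed.

Section Interpolation.
Variables (Omega : ncset R d) (F : gradedfun R d).
Arguments F : clear implicits.
Hypothesis F_nc : is_ncfun Omega F.
Hypothesis Omega_dsum : forall p r (x : nctuple R d p) (y : nctuple R d r),
  Omega x -> Omega y -> Omega (ncdsum x y).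

Lemma ncfun_step k l : (forall j, (j <= k)%N -> l != node j) ->
  Omega (pencil l) -> Omega (stair k) -> Omega (step k l) ->
  F _ (step k l) = block_mx (F m (pencil l))
    (F m (pencil l) *m solrow k l - solrow k l *m F _ (stair k)) 0 (F _ (stair k)).
Proof.
move=> hl hp hs; rewrite /step; under eq_fun do rewrite -(solrow_sylvester _ hl).
by move=> ht; apply: (ncfun_triang F_nc) => //; exact: Omega_dsum.
Qed.

Hypothesis node_inj : forall i j, node i = node j -> i = j.

(** The last block column of the value at [stair k] contains the divided
    differences of [l |-> F (pencil l)], and the recursion for them is that of the
    Newton form of the interpolant. *)
Lemma newtonE k l : (forall j, Omega (pencil (node j))) ->
  (forall j, Omega (stair j)) ->
  solrow k l *m F _ (stair k) *m lastcols k = newton k l (fun z => F m (pencil z)).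
Proof.
move=> hp hs; elim: k l => [|k IH] l /=.
  by rewrite mulmx1 mul_scalar_mx.
have hn j : (j <= k)%N -> node k.+1 != node j.
  by move=> jk; apply/eqP => /node_inj e; rewrite -e ltnn in jk.
have := ncfun_step hn (hp k.+1) (hs k) (hs k.+1).
rewrite /step -/(stair k.+1) => ->.
set Fn := F m (pencil (node k.+1)); set FU := F _ (stair k).
have top : (Fn *m solrow k (node k.+1) - solrow k (node k.+1) *m FU) *m lastcols k
    = weight k (node k.+1) *: Fn - newton k (node k.+1) (fun z => F m (pencil z)).
  by rewrite mulmxBl -[X in X - _]mulmxA solrow_last mul_mx_scalar IH.
rewrite mul_row_block mulmx0 addr0 mul_row_col mulmx0 add0r mulmxDl.
by rewrite mul_scalar_mx -!scalemxAl top IH -scalerDr.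
Qed.

(** The corner of the value at [step k l] is a divided difference, hence the
    interpolation error multiplied by [weight k l]. A bound on the values of [F]
    thus controls the error up to the factor [weight k l], which grows
    geometrically in [k] if [l] is close to the nodes. *)
Lemma newton_error k l K a b : (forall j, (j <= k)%N -> l != node j) ->
  (forall j, Omega (pencil (node j))) -> (forall j, Omega (stair j)) ->
  Omega (pencil l) -> Omega (step k l) ->
  (forall i j, sqn (F _ (step k l) i j) <= K) ->
  sqn ((weight k l *: F m (pencil l) - newton k l (fun z => F m (pencil z))) a b)
    <= K.
Proof.
move=> hl hp hs hpl hst hK.
have := hK (lshift _ a) (rshift _ (lastidx k b)).
rewrite ncfun_step // block_mxEur -mul_lastcols mulmxBl -mulmxA solrow_last.
by rewrite mul_mx_scalar newtonE.
Qed.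

End Interpolation.

Lemma newton_ext k l (h h' : C -> 'M[C]_m) :
  (forall j, h (node j) = h' (node j)) -> newton k l h = newton k l h'.
Proof. by move=> e; elim: k l => [|k IH] l /=; rewrite e // !IH. Qed.

Lemma newtonS k l h : newton k.+1 l h =
  coef k.+1 l *: (weight k (node k.+1) *: h (node k.+1) - newton k (node k.+1) h
                  + newton k l h).
Proof. by []. Qed.

(** Interpolation at two or more nodes reproduces linear functions. *)
Lemma newton_linear k l (N : 'M[C]_m) : l != node 0 -> l != node 1 ->
  (forall i j, node i = node j -> i = j) ->
  (forall j, (j <= k.+1)%N -> l != node j) ->
  newton k.+1 l (fun z => z *: N) = (weight k.+1 l * l) *: N.
Proof.
move=> l0 l1 inj.
have base z : z != node 0 -> z != node 1 ->
    newton 1 z (fun z => z *: N) = (weight 1 z * z) *: N.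
  move=> z0 z1 /=; rewrite !scalerA -scalerBl -scalerDl scalerA.
  congr (_ *: N); rewrite -mulrA; congr (_ * _); rewrite /coef.
  have n10 : node 1 != node 0 by apply/eqP => /inj.
  by field; rewrite !subr_eq0 z0 n10.
elim: k l l0 l1 => [|k IH] l l0 l1 hl; first exact: base.
have nk i : (i <= k.+1)%N -> node k.+2 != node i.
  by move=> ik; apply/eqP => /inj e; rewrite -e ltnn in ik.
have IHl := IH l l0 l1 (fun j hj => hl j (leqW hj)).
have IHn := IH (node k.+2) (nk 0 isT) (nk 1 isT) nk.
by rewrite newtonS IHl IHn scalerA subrr add0r scalerA mulrA.
Qed.

Lemma newton_cauchy k l (h : R -> C -> 'M[C]_m) :
  (forall j a b, cauchy0 (fun t => h t (node j) a b)) ->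
  forall a b, cauchy0 (fun t => newton k l (h t) a b).
Proof.
move=> hc; elim: k l => [|k IH] l a b.
  by apply: (cauchy0_near ltr01 _ (cauchy0Z (coef 0 l) (hc 0 a b))) => t _; rewrite !mxE.
have h1 := cauchy0Z (weight k (node k.+1)) (hc k.+1 a b).
have h2 := cauchy0Z (-1) (IH (node k.+1) a b).
have := cauchy0Z (coef k.+1 l) (cauchy0D (cauchy0D h1 h2) (IH l a b)).
by apply: (cauchy0_near ltr01) => t _; rewrite !mxE mulN1r.
Qed.

Lemma weight_large k l : (forall j, 4 <= sqn (coef j l)) ->
  4 ^+ k.+1 <= sqn (weight k l).
Proof.
move=> h; elim: k => [|k IH] /=; first by rewrite expr1.
by rewrite sqnM exprS ler_pM // exprn_ge0.
Qed.

(** The bounds that make a staircase tuple an inward direction do not depend on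
    its length: each superdiagonal block is absorbed by its two diagonal
    neighbours, the stronger bound on the first component leaving room for the
    next one. *)
Section StaircaseBounds.
Variables (q : nat) (kap : 'I_d -> 'I_q) (T : nctuple R d 1) (mu be B0 B1 : R).
Hypothesis be_ge0 : 0 <= be.
Hypothesis B0_ge0 : 0 <= B0.
Hypothesis B1_ge0 : 0 <= B1.
Hypothesis rhoB_form : forall k u v,
  complex.Re (dot u (tcomp kap T k (fun i => rho *: B i) *m v)) <=
    be * (n2 u + n2 v).
Hypothesis rhoB_polyb : polyb kap B1 (fun i => rho *: B i).

Let good (l : C) := inward kap T (mu + 2 * be) (pencil l) /\ polyb kap B0 (pencil l).

Hypothesis node_good : forall j, good (node j).

Let Bt := 2 * B0 + 2 * B1.

Lemma tcomp_firstcols k p (Y : 'I_d -> 'M[C]_m) :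
  tcomp kap T k (fun i => firstcols p (Y i)) = firstcols p (tcomp kap T k Y).
Proof.
case: p => [|p] //=; rewrite /tcomp.
under eq_bigr do rewrite scale_row_mx scaler0.
apply: (big_rec2 (fun x y => x = row_mx y 0)); first by rewrite row_mx0.
by move=> i x y _ ->; rewrite add_row_mx addr0.
Qed.

Lemma stair_step_bounds p l :
  (forall k w, complex.Re (dot w (tcomp kap T k (stair p) *m w)) <=
    - mu * n2 w - be * n2 (firstrows w)) ->
  (forall k w, blockn2 kap k (stair p) w <= Bt * n2 w - 2 * B1 * n2 (firstrows w)) ->
  good l ->
  (forall k w, complex.Re (dot w (tcomp kap T k (step p l) *m w)) <=
    - mu * n2 w - be * n2 (usubmx w)) /\
  (forall k w, blockn2 kap k (step p l) w <= Bt * n2 w - 2 * B1 * n2 (usubmx w)).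
Proof.
move=> h1 h2 [g1 g2]; split=> k w; rewrite -(vsubmxK w) n2_col col_mxKu.
  rewrite /step tcomp_triang mul_block_col mul0mx add0r dot_col tcomp_firstcols.
  rewrite firstcols_mul dotDr !raddfD /=.
  have := g1 k (usubmx w); have := h1 k (dsubmx w).
  have := rhoB_form k (usubmx w) (firstrows (dsubmx w)).
  by lra.
rewrite /step blockn2_triang; under eq_bigr do rewrite firstcols_mul.
have := blockn2D_le kap k (pencil l) (fun i => rho *: B i) (usubmx w)
  (firstrows (dsubmx w)) ltr01.
rewrite invr1; have := g2 k (usubmx w).
have := rhoB_polyb k (firstrows (dsubmx w)); have := h2 k (dsubmx w).
by rewrite /Bt; lra.
Qed.

Lemma stair_bounds p :
  (forall k w, complex.Re (dot w (tcomp kap T k (stair p) *m w)) <=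
    - mu * n2 w - be * n2 (firstrows w)) /\
  (forall k w, blockn2 kap k (stair p) w <= Bt * n2 w - 2 * B1 * n2 (firstrows w)).
Proof.
elim: p => [|p [IH1 IH2]]; last exact: stair_step_bounds.
have [g1 g2] := node_good 0; split=> k w /=.
  apply: le_trans (g1 k w) _; have := mulr_ge0 be_ge0 (n2_ge0 w); lra.
apply: le_trans (g2 k w) _; have := mulr_ge0 B0_ge0 (n2_ge0 w); rewrite /Bt; lra.
Qed.

Lemma stair_inward p : inward kap T mu (stair p) /\ polyb kap Bt (stair p).
Proof.
have [h1 h2] := stair_bounds p; split=> k w.
  by apply: le_trans (h1 k w) _; rewrite gerBl mulr_ge0 ?n2_ge0.
by apply: le_trans (h2 k w) _; rewrite gerBl !mulr_ge0 ?n2_ge0.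
Qed.

Lemma step_inward p l : good l ->
  inward kap T mu (step p l) /\ polyb kap Bt (step p l).
Proof.
have [h1 h2] := stair_bounds p => /(stair_step_bounds h1 h2)[{}h1 {}h2].
split=> k w.
  by apply: le_trans (h1 k w) _; rewrite gerBl mulr_ge0 ?n2_ge0.
by apply: le_trans (h2 k w) _; rewrite gerBl !mulr_ge0 ?n2_ge0.
Qed.

Lemma pencil_inward l : good l ->
  inward kap T mu (pencil l) /\ polyb kap Bt (pencil l).
Proof.
case=> g1 g2; split; last first.
  by apply: polyb_le g2; rewrite /Bt; have := B0_ge0; have := B1_ge0; lra.
move=> k w; apply: le_trans (g1 k w) _.
by have := mulr_ge0 be_ge0 (n2_ge0 w); lra.
Qed.

End StaircaseBounds.
End Staircase.

(** * The Julia inequality at a boundary point *)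

Section SchurFunction.
Variables (R : realType) (d q : nat) (kap : 'I_d -> 'I_q).
Variables (phi : gradedfun R d) (T : nctuple R d 1).
Local Notation C := R[i].
Local Notation im := ('i%C : C).
Arguments phi : clear implicits.
Hypothesis phi_nc : is_ncfun (polyball kap) phi.
Hypothesis phi_contr : forall n x, polyball kap x -> scontr (phi n x).
Hypothesis T_unit : forall k, \sum_(i | kap i == k) sqn (T i 0 0) = 1.

Lemma phi_dot_le1 n (x : nctuple R d n) v : polyball kap x -> n2 v = 1 ->
  sqn (dot v (phi n x *m v)) <= 1.
Proof.
move=> /phi_contr[c c1 h] v1; apply: le_trans (dot_CS _ _) _.
by rewrite v1 mul1r; apply: le_trans (h v) _; rewrite v1 mulr1 ltW.
Qed.

Lemma schwarz_pick n (X Z : nctuple R d n) (c : C) (x v : 'cV[C]_n) :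
  polyball kap X -> polyball kap Z ->
  polyball kap (nctriang X (fun i => X i *m c%:M - c%:M *m Z i) Z) ->
  n2 x = 1 -> n2 v = 1 ->
  sqn c * sqn (dot x ((phi n X - phi n Z) *m v)) <=
    (1 - sqn (dot x (phi n X *m x))) * (1 - sqn (dot v (phi n Z *m v))).
Proof.
move=> hX hZ hT x1 v1; have hXZ := polyball_dsum hX hZ.
have := phi_contr hT; rewrite (ncfun_triang phi_nc) // => h.
have := scontr_triangular h x1 v1.
by rewrite mul_mx_scalar mul_scalar_mx -scalerBr -scalemxAl dotZr sqnM.
Qed.

(** The corner of the largest admissible triangular tuple has size about
    [sqrt (ga * g)]. If the defect of the value at the scalar point [z] is at most
    [M * g], the factor [g] cancels: the estimate survives when [z] approaches the
    boundary. *)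
Lemma schwarz_pick_scalar n (X : nctuple R d n) (z : nctuple R d 1)
    (ga g e M : R) (x v : 'cV[C]_n) :
  (0 < n)%N -> 0 < ga <= 1 -> 0 < g -> 0 < e ->
  polyb kap (1 - ga) X -> polyb kap (1 - g) z ->
  polyb kap e (fun i => X i - ncampl n z i) ->
  1 - sqn (phi 1 z 0 0) <= M * g -> n2 x = 1 -> n2 v = 1 ->
  ga * sqn (dot x (phi n X *m v) - phi 1 z 0 0 * dot x v) <=
    6 * e * M * (1 - sqn (dot x (phi n X *m x))).
Proof.
move=> n0 ga01 g0 e0 hX hz hD hM x1 v1; have /andP[ga0 ga1] := ga01.
have pX := gap_polyball n0 ga0 hX.
have pz := gap_polyball (ltn0Sn 0) g0 hz.
have e6 : 0 < 6 * e by rewrite mulr_gt0.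
(* the largest corner admitted by [polyball_triang] *)
set c := (Num.sqrt (ga * g / (6 * e)))%:C.
have cE : sqn c = ga * g / (6 * e).
  by rewrite sqnC sqr_sqrtr // ltW // !(divr_gt0, mulr_gt0).
have hc : sqn c * (6 * e) <= ga * g by rewrite cE mulfVK // gt_eqF.
have pT := polyball_triang n0 ga01 g0 hX (polyb_ampl hz) hD hc.
have := schwarz_pick pX (polyball_ampl n0 pz) pT x1 v1.
rewrite (ncfun_ampl phi_nc) // mulmxBl mul_scalar_mx dotBr !dotZr dotvv v1.
rewrite mulr1 cE; set s := sqn (_ - _); set A := sqn (dot x _).
have A1 : A <= 1 by exact: phi_dot_le1.
move=> h; have {}h : ga * g / (6 * e) * s <= (1 - A) * (M * g).
  by apply: le_trans h _; rewrite ler_wpM2l ?subr_ge0.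
rewrite mulrAC ler_pdivrMr // in h.
by rewrite -(ler_pM2l g0); lra.
Qed.

Variable M : R.
Hypothesis M_gt0 : 0 < M.

(** The points [z] witness, at scale [e], that [T] is a B-point: [g] is a lower
    bound of the gap of [z], and the defect of the value is at most [M] times
    [g]. *)
Definition approach e (z : nctuple R d 1) : Prop :=
  exists g, [/\ 0 < g <= e, polyb kap (1 - g) z,
    polyb kap e (fun i => z i - T i) & 1 - sqn (phi 1 z 0 0) <= M * g].

Hypothesis T_approach : forall e, 0 < e -> exists z, approach e z.

Definition radial (t : R) : nctuple R d 1 := fun i => (1 - t)%:C *: T i.

Lemma radial_polyb t : 0 < t <= 1 -> polyb kap (1 - t) (radial t).
Proof.
move=> /andP[t0 t1] k v; rewrite blockn2Z sqnC.
apply: (@le_trans _ _ ((1 - t) ^+ 2 * n2 v)).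
  by rewrite ler_wpM2l ?sqr_ge0 // -[leRHS]mul1r (polyb_T T_unit).
by apply: ler_wpM2r; [exact: n2_ge0 | nra].
Qed.

Lemma radial_near t z : 0 < t <= 1 -> approach (t ^+ 2 / 2) z ->
  sqn (phi 1 (radial t) 0 0 - phi 1 z 0 0) <= 18 * M * t.
Proof.
move=> t01 [g [/andP[g0 _] hz hzT hM]]; have /andP[t0 t1] := t01.
have e0 : 0 < 3 * t ^+ 2 by rewrite mulr_gt0 // exprn_gt0.
have hD : polyb kap (3 * t ^+ 2) (fun i => radial t i - ncampl 1 z i).
  have -> : (fun i => radial t i - ncampl 1 z i) =
      (fun i => (-1) *: (z i - T i) + (- t)%:C *: T i).
    apply/funext => i; rewrite ncampl1 /radial rmorphB rmorphN rmorph1.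
    by rewrite scaleN1r scalerBl scale1r scaleNr opprB addrAC.
  have hT : polyb kap (t ^+ 2) (fun i => (- t)%:C *: T i).
    move=> k v; rewrite blockn2Z sqnC sqrrN ler_wpM2l ?sqr_ge0 //.
    by rewrite -[leRHS]mul1r (polyb_T T_unit).
  have hz' : polyb kap (t ^+ 2 / 2) (fun i => -1 *: (z i - T i)).
    by move=> k v; rewrite blockn2Z sqnN sqn1 mul1r.
  by apply: polyb_le (polybD hz' hT); lra.
have := schwarz_pick_scalar (ltn0Sn 0) t01 g0 e0 (radial_polyb t01) hz hD hM
  (n2_ecol R 0) (n2_ecol R 0).
rewrite dot_ecol dotvv n2_ecol mulr1 => h; rewrite -(ler_pM2l t0).
apply: le_trans h _; set A := sqn _.
have : 0 <= A by exact: sqn_ge0.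
have : 0 <= M * t ^+ 2 by rewrite mulr_ge0 ?sqr_ge0 // ltW.
nra.
Qed.

Lemma radial_cauchy : cauchy0 (fun t => phi 1 (radial t) 0 0).
Proof.
move=> e e0; have k0 : 0 < 72 * M by rewrite mulr_gt0.
exists (Num.min 1 (e / (72 * M))); first by rewrite lt_min ltr01 divr_gt0.
move=> s t; rewrite !lt_min !ltr_pdivlMr // => /and3P[s0 s1 se] /and3P[t0 t1 te].
have [z hz] : exists z, approach (Num.min (s ^+ 2 / 2) (t ^+ 2 / 2)) z.
  by apply: T_approach; rewrite lt_min !divr_gt0 ?exprn_gt0.
have weak a : Num.min (s ^+ 2 / 2) (t ^+ 2 / 2) <= a -> approach a z.
  move=> ha; case: hz => g [/andP[g0 ge] h1 h2 h3]; exists g; split => //.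
    by rewrite g0 (le_trans ge).
  exact: polyb_le h2.
have s01 : 0 < s <= 1 by rewrite s0 ltW.
have t01 : 0 < t <= 1 by rewrite t0 ltW.
have hs := radial_near s01 (weak _ _); have ht := radial_near t01 (weak _ _).
move: hs ht; rewrite !ge_min !lexx !orbT => /(_ isT) hs /(_ isT) ht.
have -> : phi 1 (radial s) 0 0 - phi 1 (radial t) 0 0 =
   (phi 1 (radial s) 0 0 - phi 1 z 0 0) - (phi 1 (radial t) 0 0 - phi 1 z 0 0).
  by ring.
by apply: le_trans (sqnD2 _ _) _; rewrite sqnN; lra.
Qed.

(** The radial values form a Cauchy family, because each of them is close to the
    values at all scalar points approaching [T] with bounded quotient. Their limit
    is therefore also the limit of the latter values. *)
Lemma boundary_scalar_exists : exists om : C, [/\ sqn om = 1 &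
  forall e, 0 < e -> exists2 z, approach e z & sqn (phi 1 z 0 0 - om) <= e].
Proof.
have [om hom] := cauchy0_tends radial_cauchy.
have near e : 0 < e -> exists2 z, approach e z & sqn (phi 1 z 0 0 - om) <= e.
  move=> e0; have [dl dl0 hd] := hom (e / 4) (divr_gt0 e0 (ltr0n _ 4)).
  have k0 : 0 < 72 * M by rewrite mulr_gt0.
  have m0 : 0 < Num.min (Num.min 1 (dl / 2)) (e / (72 * M)).
    by rewrite !lt_min ltr01 !divr_gt0.
  have : Num.min (Num.min 1 (dl / 2)) (e / (72 * M)) <=
      Num.min (Num.min 1 (dl / 2)) (e / (72 * M)) by [].
  move: m0; set t := Num.min (Num.min _ _) _ => t0.
  rewrite {2}/t !le_min !ler_pdivlMr // -andbA => /and3P[t1 td te].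
  have t2 : 0 < Num.min e (t ^+ 2 / 2) by rewrite lt_min e0 divr_gt0 ?exprn_gt0.
  have [z [g [/andP[g0 ge] h1 h2 h3]]] := T_approach t2.
  have le1 : Num.min e (t ^+ 2 / 2) <= e by rewrite ge_min lexx.
  have le2 : Num.min e (t ^+ 2 / 2) <= t ^+ 2 / 2 by rewrite ge_min lexx orbT.
  exists z.
    exists g; split=> //; first by rewrite g0 (le_trans ge).
    exact: polyb_le h2.
  have az : approach (t ^+ 2 / 2) z.
    exists g; split=> //; first by rewrite g0 (le_trans ge).
    exact: polyb_le h2.
  have t01 : 0 < t <= 1 by rewrite t0.
  have := radial_near t01 az.
  have -> : phi 1 z 0 0 - om = - (phi 1 (radial t) 0 0 - phi 1 z 0 0) +
    (phi 1 (radial t) 0 0 - om) by ring.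
  have htd : 0 < t < dl by rewrite t0 /=; lra.
  have := hd t htd => i1 i2.
  by apply: le_trans (sqnD2 _ _) _; rewrite sqnN; lra.
exists om; split=> //.
apply/le_anti/andP; split; apply/ler_addgt0Pr => eta eta0.
  have [e e0 he] := sqn_continuous om eta0.
  have [z [g [/andP[g0 ge] h1 _ _]] zo] := near e e0.
  have := phi_dot_le1 (gap_polyball (ltn0Sn 0) g0 h1) (n2_ecol R 0).
  have := he (phi 1 z 0 0); rewrite -sqnN opprB => /(_ zo).
  by rewrite dot_ecol ler_norml; lra.
have [e e0 he] := sqn_continuous om (divr_gt0 eta0 (ltr0n _ 2)).
have m0 : 0 < Num.min e (eta / (2 * M)) by rewrite lt_min e0 divr_gt0 ?mulr_gt0.
have [z [g [/andP[g0 ge] _ _ hM]] zo] := near _ m0.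
have := le_trans zo (_ : _ <= e); rewrite ge_min lexx => /(_ isT) zo'.
have := he (phi 1 z 0 0); rewrite -sqnN opprB => /(_ zo').
have := le_trans ge (_ : _ <= eta / (2 * M)).
rewrite ge_min lexx orbT => /(_ isT); rewrite ler_pdivlMr ?mulr_gt0 // ler_norml.
lra.
Qed.

Variable om : C.
Hypothesis om_unit : sqn om = 1.
Hypothesis T_approach_om :
  forall e, 0 < e -> exists2 z, approach e z & sqn (phi 1 z 0 0 - om) <= e.

(** The limit of the comparison with scalar points [z] as [z] tends to [T]; the
    factor 18 instead of 6 accounts for replacing [X - z] by [X - T]. *)
Lemma julia n (X : nctuple R d n) (ga be : R) (x v : 'cV[C]_n) :
  (0 < n)%N -> 0 < ga <= 1 -> 0 < be -> polyb kap (1 - ga) X ->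
  polyb kap be (fun i => X i - ncampl n T i) -> n2 x = 1 -> n2 v = 1 ->
  ga * sqn (dot x (phi n X *m v) - om * dot x v) <=
    18 * M * be * (1 - sqn (dot x (phi n X *m x))).
Proof.
move=> n0 ga01 be0 hX hD x1 v1; have /andP[ga0 _] := ga01.
rewrite mulrC -ler_pdivlMr //; apply: sqn_le_closed => e e0.
have m0 : 0 < Num.min e (be / 2) by rewrite lt_min e0 divr_gt0.
have [z [g [/andP[g0 ge] hz hzT hM]] zo] := T_approach_om m0.
have le1 : Num.min e (be / 2) <= e by rewrite ge_min lexx.
have le2 : Num.min e (be / 2) <= be / 2 by rewrite ge_min lexx orbT.
exists (dot x (phi n X *m v) - phi 1 z 0 0 * dot x v).
  have -> : dot x (phi n X *m v) - om * dot x v -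
      (dot x (phi n X *m v) - phi 1 z 0 0 * dot x v) =
      (phi 1 z 0 0 - om) * dot x v by ring.
  rewrite sqnM; have := dot_CS x v; rewrite x1 v1 mulr1 => h.
  apply: le_trans (le_trans zo le1); rewrite -[leRHS]mulr1.
  by apply: ler_wpM2l => //; exact: sqn_ge0.
rewrite ler_pdivlMr // mulrC.
have e3 : 0 < 3 * be by rewrite mulr_gt0.
have hXz : polyb kap (3 * be) (fun i => X i - ncampl n z i).
  have -> : (fun i => X i - ncampl n z i) =
     (fun i => (X i - ncampl n T i) + -1 *: ncampl n (fun j => z j - T j) i).
    apply/funext => i; rewrite /ncampl scaleN1r !mxE raddfB /= opprB.
    by rewrite addrA subrK.
  have h2 := @polyb_ampl _ _ _ kap n _ _ (polyb_le le2 hzT).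
  have {}h2 : polyb kap (be / 2) (fun i => -1 *: ncampl n (fun j => z j - T j) i).
    by move=> k w; rewrite blockn2Z sqnN sqn1 mul1r; exact: h2.
  by apply: polyb_le (polybD hD h2); lra.
have := schwarz_pick_scalar n0 ga01 g0 e3 hX hz hXz hM x1 v1.
by congr (_ <= _); ring.
Qed.

(** * Difference quotients at the boundary point *)

Definition dquot n (H : nctuple R d n) (t : R) : 'M[C]_n :=
  (t^-1)%:C *: (phi n (ray T H t) - om%:M).

(** For [x = v] the Julia inequality bounds [|om - a|^2], where [a] is the
    diagonal coefficient, by a multiple of [t (1 - |a|^2)]. Since
    [1 - |a|^2 <= 2 |om - a|], the defect [1 - |a|^2] is itself of order [t];
    inserting this into the Julia inequality controls all coefficients by [t]. *)
Lemma ray_linear_bound n (H : nctuple R d n) mu B t x v :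
  (0 < n)%N -> 0 < mu -> 0 < B -> inward kap T mu H -> polyb kap B H ->
  0 < t -> t * B <= mu -> t * mu <= 1 -> n2 x = 1 -> n2 v = 1 ->
  sqn (dot x ((phi n (ray T H t) - om%:M) *m v)) <= (36 * M * B / mu * t) ^+ 2.
Proof.
move=> n0 mu0 B0 hm hB t0 tB tmu x1 v1.
have ga01 : 0 < t * mu <= 1 by rewrite mulr_gt0.
have be0 : 0 < t ^+ 2 * B by rewrite mulr_gt0 // exprn_gt0.
have pX := ray_polyb T_unit hm hB t0 tB.
have hD : polyb kap (t ^+ 2 * B) (fun i => ray T H t i - ncampl n T i).
  have -> : (fun i => ray T H t i - ncampl n T i) = (fun i => t%:C *: H i).
    by apply/funext => i; rewrite /ray addrAC subrr add0r.
  by move=> k w; rewrite blockn2Z sqnC -[leRHS]mulrA ler_wpM2l ?sqr_ge0.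
set ka := 18 * M * B / mu.
have ka0 : 0 < ka by rewrite divr_gt0 // !mulr_gt0.
have J y w : n2 y = 1 -> n2 w = 1 ->
    sqn (dot y ((phi n (ray T H t) - om%:M) *m w)) <=
    ka * t * (1 - sqn (dot y (phi n (ray T H t) *m y))).
  move=> y1 w1; rewrite scal_dot.
  have := julia n0 ga01 be0 pX hD y1 w1.
  rewrite mulrC -ler_pdivlMr ?mulr_gt0 // => h; apply: le_trans h _.
  rewrite le_eqVlt; apply/orP; left; apply/eqP; rewrite /ka.
  by field; rewrite !gt_eqF.
apply: le_trans (J x v x1 v1) _.
set a := dot x (phi n (ray T H t) *m x).
have a1 : sqn a <= 1.
  exact: (phi_dot_le1 (ray_polyball T_unit n0 mu0 hm hB t0 tB) x1).
have := J x x x1 x1; rewrite scal_dot dotvv x1 mulr1 -/a => h.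
have h4 : (1 - sqn a) ^+ 2 <= 4 * sqn (a - om).
  have := sqnB_le a om; rewrite om_unit -sqrrN opprB => h'.
  apply: le_trans h' _; rewrite mulrC ler_wpM2r ?sqn_ge0 //.
  by apply: le_trans (sqnD2 _ _) _; rewrite om_unit; lra.
have {h}h5 : 1 - sqn a <= 4 * (ka * t).
  have : (1 - sqn a) * (1 - sqn a - 4 * (ka * t)) <= 0 by nra.
  have kt0 := mulr_gt0 ka0 t0.
  have [->|ane] := eqVneq (sqn a) 1; first by lra.
  rewrite pmulr_rle0; last by rewrite subr_gt0 lt_neqAle ane.
  by rewrite subr_le0.
apply: (@le_trans _ _ (ka * t * (4 * (ka * t)))).
  by rewrite ler_wpM2l // ltW // mulr_gt0.
rewrite le_eqVlt; apply/orP; left; apply/eqP.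
have -> : 36 * M * B / mu = 2 * ka by rewrite /ka; field; rewrite gt_eqF.
ring.
Qed.

Lemma dquot_bound n (H : nctuple R d n) mu B t i j :
  (0 < n)%N -> 0 < mu -> 0 < B -> inward kap T mu H -> polyb kap B H ->
  0 < t -> t * B <= mu -> t * mu <= 1 ->
  sqn (dquot H t i j) <= (36 * M * B / mu) ^+ 2.
Proof.
move=> n0 mu0 B0 hm hB t0 tB tmu.
rewrite -dot_ecol -scalemxAl dotZr sqnM sqnC exprVn mulrC.
rewrite ler_pdivrMr ?exprn_gt0 // -exprMn.
by apply: ray_linear_bound => //; rewrite n2_ecol.
Qed.

(** * Directions with Hermitian components *)

(** The corner of [sym_triang] tends to its extremal size. *)
Lemma sym_schwarz_pick n (H : nctuple R d n) mu B s t u :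
  (0 < n)%N -> 0 < mu -> 0 < B -> inward kap T mu H -> polyb kap B H -> symdir kap T H ->
  0 < s -> 0 < t -> t * (B / mu) <= 1 -> s * (B / mu) <= 1 -> s != t ->
  n2 u = 1 ->
  (2 * t - B / mu * t ^+ 2) * (2 * s - B / mu * s ^+ 2) *
    sqn (dot u (phi n (ray T H t) *m u) - dot u (phi n (ray T H s) *m u)) <=
  (t - s) ^+ 2 * ((1 - sqn (dot u (phi n (ray T H t) *m u))) *
                  (1 - sqn (dot u (phi n (ray T H s) *m u)))).
Proof.
move=> n0 mu0 B0 hm hB hs s0 t0 tC sC st u1.
have Bmu a : a * (B / mu) <= 1 -> a * B <= mu.
  by rewrite mulrA ler_pdivrMr // mul1r.
have pt := ray_polyball T_unit n0 mu0 hm hB t0 (Bmu _ tC).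
have ps := ray_polyball T_unit n0 mu0 hm hB s0 (Bmu _ sC).
have ts0 : t - s != 0 by rewrite subr_eq0 eq_sym.
have pos1 x : polyball kap x -> 0 <= 1 - sqn (dot u (phi n x *m u)).
  by move=> hx; rewrite subr_ge0 (phi_dot_le1).
have gap0 : forall a : R, 0 < a -> a * (B / mu) <= 1 -> 0 < 2 * a - B / mu * a ^+ 2.
  move=> a a0 h; have : 0 < a * (2 - a * (B / mu)) by rewrite mulr_gt0 //; lra.
  by lra.
set G := (2 * t - _) * (2 * s - _).
have G0 : 0 < G by rewrite mulr_gt0 ?gap0.
apply: le_of_scaled => [th /andP[th0 th1]|]; last first.
  apply: mulr_ge0; first exact: sqr_ge0.
  by apply: mulr_ge0; exact: pos1.
have [c cE] : exists c, c ^+ 2 = th * G.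
  by exists (Num.sqrt (th * G)); rewrite sqr_sqrtr // ltW // mulr_gt0.
have hc : c ^+ 2 < G by rewrite cE -[ltRHS]mul1r ltr_pM2r.
have pT := sym_triang T_unit n0 mu0 B0 hm hB hs s0 t0 tC sC st hc.
have := schwarz_pick pt ps pT u1 u1.
rewrite sqnC mulmxBl dotBr exprMn cE exprVn => h.
have t2 : 0 < (t - s) ^+ 2 by rewrite exprn_even_gt0.
rewrite mulrAC ler_pdivrMr // in h.
by rewrite mulrA [leRHS]mulrC.
Qed.

Definition convdir n (H : nctuple R d n) : Prop :=
  forall i j, cauchy0 (fun t => dquot H t i j).

(** A quadratic form of the values along the ray satisfies the one-variable
    Schwarz--Pick inequality and has a B-point at [t = 0]. *)
Lemma sym_form_cauchy n (H : nctuple R d n) mu B u :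
  (0 < n)%N -> 0 < mu -> 0 < B -> inward kap T mu H -> polyb kap B H -> symdir kap T H ->
  cauchy0 (fun t => dot u (dquot H t *m u)).
Proof.
move=> n0 mu0 B0 hm hB hs.
have [u0|u0] := eqVneq (n2 u) 0.
  rewrite (n2_eq0 u0); apply: (@cauchy0_near _ (fun=> 0) _ 1) => //.
    by move=> t _; rewrite mulmx0 dot0r.
  exact: cauchy0_cst.
have un : 0 < n2 u by rewrite lt_neqAle eq_sym u0 n2_ge0.
pose a : C := (Num.sqrt (n2 u)^-1)%:C.
pose w := a *: u.
have w1 : n2 w = 1.
  by rewrite /w n2Z sqnC sqr_sqrtr ?invr_ge0 1?ltW // mulVf.
have a0 : a != 0.
  by apply/eqP => e; have := w1; rewrite /w e scale0r n2_0 => /eqP; rewrite eq_sym oner_eq0.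
have uE : u = a^-1 *: w by rewrite /w scalerA mulVf // scale1r.
pose g t := dot w (phi n (ray T H t) *m w).
pose t0 := Num.min (mu / B) (mu^-1).
have t00 : 0 < t0 by rewrite lt_min divr_gt0 //= invr_gt0.
have small t : t <= t0 -> t * B <= mu /\ t * mu <= 1.
  rewrite le_min ler_pdivlMr // -[mu^-1]mul1r ler_pdivlMr //.
  by case/andP.
have smallC t : t <= t0 -> t * (B / mu) <= 1.
  by move=> /small[h _]; rewrite mulrA ler_pdivrMr // mul1r.
have [al hal] : exists al : R, tends0 (fun t => (t^-1)%:C * (om - g t) * om^*) al%:C.
  apply: (@scalar_julia_caratheodory _ g om (B / mu) ((36 * M * B / mu) ^+ 2) t0) => //.
  - by rewrite divr_gt0.
  - exact: sqr_ge0.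
  - exact: smallC.
  - move=> t /andP[p /ltW/small[h _]].
    exact: (phi_dot_le1 (ray_polyball T_unit n0 mu0 hm hB p h) w1).
  - move=> t /andP[p /ltW/small[h h']].
    have := ray_linear_bound n0 mu0 B0 hm hB p h h' w1 w1.
    by rewrite scal_dot dotvv w1 mulr1 exprMn.
  - move=> s t /andP[s0 /ltW/smallC hs'] /andP[tp /ltW/smallC ht'] st.
    exact: sym_schwarz_pick.
have o1 : om * om^* = 1 by rewrite mulrC mul_conjc om_unit.
have := cauchy0Z (- om * (a^-1)^* * a^-1) (tends0_cauchy hal).
apply: (cauchy0_near t00) => t _.
rewrite uE dotZl -scalemxAr dotZr /dquot -scalemxAl dotZr scal_dot dotvv w1 mulr1.
rewrite -/(g t); ring: o1.
Qed.

(** Each quadratic form of the difference quotient falls under the scalar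
    theorem, and polarization recovers the matrix entries. *)
Lemma sym_convdir n (H : nctuple R d n) mu B :
  (0 < n)%N -> 0 < mu -> 0 < B -> inward kap T mu H -> polyb kap B H -> symdir kap T H ->
  convdir H.
Proof.
move=> n0 mu0 B0 hm hB hs i j.
have Q u := sym_form_cauchy u n0 mu0 B0 hm hB hs.
pose u := ecol R i; pose v := ecol R j.
have h1 := cauchy0D (Q (u + 1 *: v)) (cauchy0Z (-1) (Q (u + (-1) *: v))).
have h2 := cauchy0D (Q (u + im *: v)) (cauchy0Z (-1) (Q (u + (- im) *: v))).
have := cauchy0Z 4^-1 (cauchy0D h1 (cauchy0Z (- im) h2)).
apply: (cauchy0_near ltr01) => t _.
have four : 4 != 0 :> C by rewrite pnatr_eq0.
apply: (mulfI four); rewrite mulrA mulfV // mul1r -dot_ecol dot_polarize.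
have comb (a b c e z : C) : a + -1 * b + - z * (c + -1 * e) = a - b - z * (c - e).
  by ring.
exact: comb.
Qed.

(** * Convergence along every inward direction *)

Definition raydom (t : R) : ncset R d := fun n => [set H | polyball kap (ray T H t)].

Lemma raydom_dsum t p r (x : nctuple R d p) (y : nctuple R d r) :
  raydom t x -> raydom t y -> raydom t (ncdsum x y).
Proof. by rewrite /raydom /= ray_dsum; exact: polyball_dsum. Qed.

Lemma dquot_nc t : is_ncfun (raydom t) (fun n H => dquot H t).
Proof.
split=> [m n x y hx hy hxy|n s x us hx hsx].
  have e : phi _ (ray T (ncdsum x y) t) =
      block_mx (phi m (ray T x t)) 0 0 (phi n (ray T y t)).
    by rewrite ray_dsum; apply: phi_nc.1; rewrite -?ray_dsum.
  rewrite /dquot e scalar_mx_block opp_block_mx add_block_mx scale_block_mx.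
  by rewrite !subr0 !scaler0.
have e : phi n (ray T (ncconj s x) t) = invmx s *m phi n (ray T x t) *m s.
  by rewrite ray_conj //; apply: phi_nc.2; rewrite -?ray_conj.
by rewrite /dquot e -scalemxAr -scalemxAl mulmxBr mulmxBl conj_scalar.
Qed.

(** A Vitali theorem for the difference quotients: they are uniformly bounded on
    all staircase tuples, so the error of their interpolation decreases
    geometrically with the number of nodes, and convergence at the nodes
    propagates to the target. *)
Lemma vitali_step m (A B : nctuple R d m) (rho : C) (node : nat -> C) (l : C)
    (mu be B0 B1 : R) :
  (0 < m)%N -> 0 < mu -> 0 <= be -> 0 < B0 -> 0 <= B1 ->
  (forall k u v, complex.Re (dot u (tcomp kap T k (fun i => rho *: B i) *m v)) <=
    be * (n2 u + n2 v)) ->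
  polyb kap B1 (fun i => rho *: B i) ->
  (forall j, inward kap T (mu + 2 * be) (pencil A B (node j)) /\
             polyb kap B0 (pencil A B (node j))) ->
  inward kap T (mu + 2 * be) (pencil A B l) -> polyb kap B0 (pencil A B l) ->
  (forall i j, node i = node j -> i = j) -> (forall j, l != node j) ->
  (forall j, 4 <= sqn (coef rho node j l)) ->
  (forall j, convdir (pencil A B (node j))) ->
  convdir (pencil A B l).
Proof.
move=> m0 mu0 be0 B00 B10 hform hpoly hnode hl1 hl2 inj lneq hcoef hconv a b e e0.
set Bt := 2 * B0 + 2 * B1.
have Bt0 : 0 < Bt by rewrite /Bt; lra.
have B0' : 0 <= B0 by exact: ltW.
have inStair p := stair_inward be0 B0' B10 hform hpoly hnode p.
have inStep p := step_inward be0 B0' B10 hform hpoly hnode p (conj hl1 hl2).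
have inNode j := pencil_inward be0 B0' B10 (hnode j).
have inL := pencil_inward be0 B0' B10 (conj hl1 hl2).
have dim k : (0 < bdim m k)%N by case: k => [|k] //=; rewrite addn_gt0 m0.
set K := (36 * M * Bt / mu) ^+ 2.
have K0 : 0 <= K by rewrite sqr_ge0.
(* enough nodes to bring the interpolation error below [e] *)
have [k hk] : exists k, 16 * K <= e * 4 ^+ k.+1.
  have [k hk] : exists k : nat, 16 * K / e <= k%:R.
    by eexists; apply/ltW/truncnS_gt.
  exists k; move: hk; rewrite ler_pdivrMr // => hk; apply: le_trans hk _.
  rewrite mulrC ler_pM2l // -natrX ler_nat ltnW //.
  by apply: leq_trans (ltn_expl k.+1 (isT : 1 < 4)%N) => //; exact: ltnW.
have w4 := weight_large k hcoef.
set w := weight rho node k l in w4.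
have wpos : 0 < sqn w by apply: lt_le_trans w4; rewrite exprn_gt0.
have w0 : w != 0 by apply/eqP => e1; rewrite e1 sqn0 ltxx in wpos.
set nwt := fun t => newton rho node k l
  (fun z => dquot (pencil A B z) t) a b.
have nwt_c : cauchy0 nwt 
  by apply: (@newton_cauchy R m rho node k l (fun t z => dquot (pencil A B z) t)).
pose Fd t := dquot (pencil A B l) t a b.
have e8 : 0 < e * sqn w / 4 by rewrite divr_gt0 // mulr_gt0.
have [d1 d10 hd1] := nwt_c _ e8.
set t0 := Num.min d1 (Num.min (mu / Bt) (mu^-1)).
exists t0; first by rewrite !lt_min d10 divr_gt0 //= invr_gt0.
have err t : 0 < t < t0 ->
    0 < t < d1 /\ sqn (w * Fd t - nwt t) <= K.
  rewrite !lt_min ltr_pdivlMr // -[mu^-1]mul1r ltr_pdivlMr //.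
  move=> /andP[t_0 /andP[td1 /andP[/ltW tB /ltW tmu]]]; split; first by rewrite t_0.
  have inD n (H : nctuple R d n) : (0 < n)%N ->
      inward kap T mu H /\ polyb kap Bt H -> raydom t H.
    by move=> n0 [h1 h2]; exact: (ray_polyball T_unit n0 mu0 h1 h2 t_0 tB).
  have := @newton_error R d m A B rho node (raydom t) (fun n H => dquot H t)
    (dquot_nc t) (@raydom_dsum t) inj k l K a b.
  have -> : w * Fd t - nwt t = (w *: dquot (pencil A B l) t -
      newton rho node k l (fun z => dquot (pencil A B z) t)) a b.
    by rewrite [RHS]mxE [in RHS]mxE [X in _ = _ + X]mxE.
  apply.
  - by move=> j _; exact: lneq.
  - by move=> j; exact: inD m0 (inNode j).
  - by move=> j; exact: inD (dim j) (inStair j).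
  - exact: inD.
  - by apply: inD; [rewrite addn_gt0 m0 | exact: inStep].
  - move=> i j; have [h1 h2] := inStep k.
    apply: (dquot_bound i j _ mu0 Bt0 h1 h2 t_0 tB tmu).
    by rewrite addn_gt0 m0.
move=> s t /err[hs1 hs2] /err[ht1 ht2].
have hn := hd1 s t hs1 ht1; change (sqn (Fd s - Fd t) <= e).
move: hs2 ht2 hn; move: (Fd s) (Fd t) (nwt s) (nwt t) => Fs Ft ns nt.
set es := w * Fs - ns; set et := w * Ft - nt => hs2 ht2 hn.
rewrite -(ler_pM2l wpos) -sqnM.
have -> : w * (Fs - Ft) = (es - et) + (ns - nt) by rewrite /es /et; ring.
apply: le_trans (sqnD2 _ _) _.
have h1 : sqn (es - et) <= 4 * K.
  by apply: le_trans (sqnD2 _ _) _; rewrite sqnN; lra.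
have h2 : 16 * K <= sqn w * e.
  by apply: le_trans hk _; rewrite mulrC ler_pM2r.
by lra.
Qed.

Section Chain.
Variables (m : nat) (H : nctuple R d m) (mu : R).
Hypothesis m_gt0 : (0 < m)%N.
Hypothesis mu_gt0 : 0 < mu.
Hypothesis H_inward : inward kap T mu H.

Let L k := tcomp kap T k H.

(** The pencil [hbase + l *: hslope] passes through [H] at [l = 'i]; for real [l]
    its components are Hermitian. *)
Let hbase : nctuple R d m :=
  fun i => H i + T i 0 0 *: (hre (L (kap i)) - L (kap i)).
Let hslope : nctuple R d m := fun i => T i 0 0 *: him (L (kap i)).

Let tcomp_hslope k : tcomp kap T k hslope = him (L k).
Proof. exact: (tcomp_along T_unit k (fun k' => him (L k'))). Qed.

Let tcomp_pencil k l : tcomp kap T k (pencil hbase hslope l) = hre (L k) + l *: him (L k).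
Proof.
rewrite tcompD tcompZ tcomp_hslope tcompD.
by rewrite (tcomp_along T_unit k (fun k' => hre (L k') - L k')) addrCA subrr addr0.
Qed.

Let pencil_i : pencil hbase hslope 'i%C = H.
Proof.
apply/funext => i; rewrite /pencil /hbase /hslope scalerA mulrC -scalerA -addrA.
by rewrite -scalerDr addrAC hre_him subrr scaler0 addr0.
Qed.

(** The bounds needed for interpolation only involve the real part of the
    parameter, so on a vertical strip the steps have a uniform length. Starting
    with real parameters, convergence on the horizontal segment above
    [[0, rho / 8]] is transported upwards in steps of at most [rho / 4] until the
    parameter ['i] is reached. *)
Lemma inward_convdir : convdir H.
Proof.
have [a a0 ha] := polyb_exists kap hbase; have [b b0 hb] := polyb_exists kap hslope.
pose qq := (1 + b) / 2; have q0 : 0 < qq by rewrite divr_gt0 // addr_gt0.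
(* on the strip of parameters with real part at most [rho], half of [mu] is left
   after paying for [hslope] and for the superdiagonal blocks *)
pose rho := mu / (8 * qq).
have rho0 : 0 < rho by rewrite divr_gt0 // mulr_gt0.
have rhoq : 8 * (rho * qq) = mu by rewrite /rho; field; rewrite gt_eqF.
have slope_form k u v :
    complex.Re (dot u (him (L k) *m v)) <= qq * (n2 u + n2 v).
  rewrite -tcomp_hslope; apply: le_trans (tcomp_form T_unit k u v hb) _; rewrite /qq.
  by have := n2_ge0 v; have := mulr_ge0 (ltW b0) (n2_ge0 u); lra.
have slope_diag k v (x : R) : `|x| <= rho ->
    x * complex.Re (dot v (him (L k) *m v)) <= 2 * (rho * qq) * n2 v.
  move=> hx; have h1 := slope_form k v v; have := slope_form k (- v) v.
  rewrite n2N -scaleN1r dotZl rmorphN rmorph1 mulN1r raddfN /=.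
  move: h1; set y := complex.Re _ => h1 h2.
  apply: le_trans (ler_norm _) _; rewrite normrM.
  apply: (@le_trans _ _ (rho * (2 * qq * n2 v))); last by lra.
  by apply: ler_pM => //; rewrite ler_norml; lra.
pose B0 := 2 * a + 2 * ((rho ^+ 2 + 1) * b); pose B1 := rho ^+ 2 * b.
have r2 : 0 <= rho ^+ 2 by exact: sqr_ge0.
have B00 : 0 < B0 by rewrite /B0 addr_gt0 ?mulr_gt0 // ltr_wpDl.
have B10 : 0 <= B1 by rewrite mulr_ge0 // ltW.
have be0 : 0 <= rho * qq by rewrite mulr_ge0 // ltW.
have mu2 : 0 < mu / 2 by rewrite divr_gt0.
have form1 k u v :
    complex.Re (dot u (tcomp kap T k (fun i => rho%:C%C *: hslope i) *m v)) <=
    rho * qq * (n2 u + n2 v).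
  rewrite tcompZ tcomp_hslope -scalemxAl dotZr Re_realM -mulrA ler_pM2l //.
have poly1 : polyb kap B1 (fun i => rho%:C%C *: hslope i).
  by move=> k v; rewrite blockn2Z sqnC -[leRHS]mulrA ler_wpM2l.
have goodi (x y : R) : `|x| <= rho -> 0 <= y <= 1 ->
    inward kap T (mu / 2 + 2 * (rho * qq)) (pencil hbase hslope (x +i* y)%C) /\
    polyb kap B0 (pencil hbase hslope (x +i* y)%C).
  move=> hx /andP[y0 y1]; split=> [k v|].
    rewrite tcomp_pencil him_comb_form /=.
    have := H_inward k v; have := slope_diag k v x hx.
    rewrite -/(L k); set n := n2 v; set z := complex.Re _; set z' := _ * _.
    move=> h1 h2; apply: le_trans (lerD h2 h1) _.
    have e : mu * n = 8 * (rho * qq) * n by rewrite rhoq.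
    by lra.
  have hs : polyb kap ((rho ^+ 2 + 1) * b) (fun i => (x +i* y)%C *: hslope i).
    move=> k v; rewrite blockn2Z -[leRHS]mulrA; apply: ler_pM.
    - exact: sqn_ge0.
    - exact: blockn2_ge0.
    - have x2 : x ^+ 2 <= rho ^+ 2.
        by rewrite -(real_normK (num_real x)) ler_sqr ?nnegrE // ltW.
      by rewrite /sqn /=; nra.
    - exact: hb.
  exact: polybD ha hs.
pose seg y := forall x, 0 <= x <= rho / 8 ->
  convdir (pencil hbase hslope (x +i* y)%C).
have rabs x : 0 <= x <= rho / 8 -> `|x| <= rho.
  by move=> /andP[h1 h2]; rewrite ger0_norm //; lra.
have seg0 : seg 0.
  move=> x hx; have [] := goodi x 0 (rabs x hx) _; first by rewrite lexx ler01.
  move=> h1 h2; apply: (sym_convdir m_gt0 _ B00 h1 h2); first by lra.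
  move=> k u v; rewrite tcomp_pencil.
  exact: (real_comb_sym x (real_form_sym (hre_form _)) (real_form_sym (him_form _))).
have segS y h : 0 <= y -> 0 < h <= rho / 4 -> y + h <= 1 -> seg y -> seg (y + h).
  move=> y0 /andP[h0 hr] yh hy x hx.
  pose node j := ((rho / 8 / j.+1%:R) +i* y)%C.
  have nodeP j : 0 <= rho / 8 / j.+1%:R <= rho / 8.
    have r8 : 0 <= rho / 8 by lra.
    apply/andP; split; first exact: divr_ge0.
    by rewrite ler_pdivrMr ?ltr0n // ler_peMr // ler1n.
  have y01 : 0 <= y <= 1 by rewrite y0; lra.
  have [g1 g2] : inward kap T (mu / 2 + 2 * (rho * qq))
      (pencil hbase hslope (x +i* (y + h))%C) /\
      polyb kap B0 (pencil hbase hslope (x +i* (y + h))%C).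
    by apply: goodi; [exact: rabs | apply/andP; split; lra].
  have nodeg j : inward kap T (mu / 2 + 2 * (rho * qq)) (pencil hbase hslope (node j))
      /\ polyb kap B0 (pencil hbase hslope (node j)).
    by apply: goodi => //; exact: rabs.
  have inj i j : node i = node j -> i = j.
    move=> /eqP; rewrite eq_complex /= eqxx andbT => /eqP e.
    have r8 : rho / 8 != 0 by rewrite gt_eqF // divr_gt0.
    by move: (mulfI r8 e) => /invr_inj/eqP; rewrite eqr_nat => /eqP[].
  have neq j : (x +i* (y + h))%C != node j.
    rewrite eq_complex /= negb_and; apply/orP; right.
    by rewrite -subr_eq0 addrAC subrr add0r gt_eqF.
  have cf j : 4 <= sqn (coef rho%:C%C node j (x +i* (y + h))%C).
    rewrite /coef sqnM sqnV sqnC.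
    have /andP[n1 n2'] := nodeP j; have /andP[x1 x2] := hx.
    set z := rho / 8 / j.+1%:R in n1 n2' *.
    have zE : sqn ((x +i* (y + h))%C - (z +i* y)%C) = (x - z) ^+ 2 + h ^+ 2.
      by rewrite /sqn /=; ring.
    rewrite -/z zE; have h2 : 0 < h ^+ 2 by rewrite exprn_gt0.
    have xz := sqr_ge0 (x - z).
    rewrite ler_pdivlMr; last by lra.
    have : (x - z) ^+ 2 <= (rho / 8) ^+ 2.
      have : 0 <= (rho / 8 - (x - z)) * (rho / 8 + (x - z)) by apply: mulr_ge0; lra.
      by lra.
    have : h ^+ 2 <= (rho / 4) ^+ 2 by rewrite ler_sqr ?nnegrE //; lra.
    by lra.
  exact: (vitali_step m_gt0 mu2 be0 B00 B10 form1 poly1 nodeg g1 g2 inj neq cf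
    (fun j => hy _ (nodeP j))).
have [N hN] : exists N : nat, 4 / rho <= N.+1%:R by eexists; apply/ltW/truncnS_gt.
have N0 : 0 < N.+1%:R :> R by rewrite ltr0n.
have segj j : (j <= N.+1)%N -> seg (j%:R / N.+1%:R).
  elim: j => [|j IH] hj; first by rewrite mul0r.
  rewrite -natr1 mulrDl; apply: segS; last exact: IH (ltnW hj).
  - by rewrite divr_ge0 ?ler0n.
  - rewrite mul1r invr_gt0 N0 /= -[leLHS]mul1r ler_pdivrMr //.
    by move: hN; rewrite ler_pdivrMr //; lra.
  - by rewrite -mulrDl natr1 ler_pdivrMr // mul1r ler_nat.
have := segj N.+1 (leqnn _) 0; rewrite divff ?gt_eqF // -[(0 +i* 1)%C]/('i%C) pencil_i.
by apply; rewrite lexx divr_ge0 // ltW.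
Qed.

End Chain.

(** * The derivative is a homogeneous free function *)

Definition dderiv : gradedfun R d := fun n H =>
  \matrix_(i, j) xget 0 [set l | tends0 (fun t => dquot H t i j) l].
Arguments dderiv : clear implicits.

Lemma dderiv_tends n (H : nctuple R d n) i j : inward_set kap T H ->
  tends0 (fun t => dquot H t i j) (dderiv n H i j).
Proof.
case=> n0 [mu mu0 hm]; rewrite mxE.
have [l hl] := cauchy0_tends
  (inward_convdir n0 mu0 hm i j).
exact: (@xgetPex _ 0 [set l | tends0 (fun t => dquot H t i j) l] (ex_intro _ l hl)).
Qed.

Lemma dderiv_eq n (H : nctuple R d n) i j l : inward_set kap T H ->
  tends0 (fun t => dquot H t i j) l -> dderiv n H i j = l.
Proof. by move=> hH hl; apply: tends0_unique (dderiv_tends i j hH) hl. Qed.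

Lemma inward_raydom n (H : nctuple R d n) : inward_set kap T H ->
  exists2 e, 0 < e & forall t, 0 < t < e -> raydom t H.
Proof.
case=> n0 [mu mu0 hm]; have [B B0 hB] := polyb_exists kap H.
exists (mu / B); first by rewrite divr_gt0.
move=> t /andP[t0]; rewrite ltr_pdivlMr // => /ltW tB.
exact: (ray_polyball T_unit n0 mu0 hm hB t0 tB).
Qed.

Lemma dderiv_nc : is_ncfun (inward_set kap T) dderiv.
Proof.
split=> [m n x y hx hy hxy|n s x us hx hsx].
  have [a a0 ha] := inward_raydom hx; have [b b0 hb] := inward_raydom hy.
  have dq t : 0 < t < Num.min a b -> block_mx (dquot x t) 0 0 (dquot y t) =
      dquot (ncdsum x y) t.
    rewrite lt_min => /and3P[t0 ta tb].
    rewrite (dquot_nc t).1 //; [apply: ha | apply: hb | ];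
      rewrite ?t0 //.
    by apply: raydom_dsum; [apply: ha | apply: hb]; rewrite t0.
  have ab0 : 0 < Num.min a b by rewrite lt_min a0.
  apply/matrixP => i j; apply: dderiv_eq => //.
  apply: (tends0_near ab0 (fun t ht => congr1 (fun N : 'M[C]_(m + n) => N i j) (dq t ht))).
  case: (split_ordP i) => i' ->; case: (split_ordP j) => j' ->.
  - by rewrite block_mxEul; under eq_fun do rewrite block_mxEul; exact: dderiv_tends.
  - by rewrite block_mxEur; under eq_fun do rewrite block_mxEur; exact: tends0_cst.
  - by rewrite block_mxEdl; under eq_fun do rewrite block_mxEdl; exact: tends0_cst.
  - by rewrite block_mxEdr; under eq_fun do rewrite block_mxEdr; exact: dderiv_tends.
have [a a0 ha] := inward_raydom hx; have [b b0 hb] := inward_raydom hsx.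
have ab0 : 0 < Num.min a b by rewrite lt_min a0.
apply/matrixP => i j; apply: dderiv_eq => //.
have := tends0_mulmx (invmx s) s (fun i j => dderiv_tends i j hx) i j.
apply: (tends0_near ab0) => t; rewrite lt_min => /and3P[t0 ta tb].
by rewrite (dquot_nc t).2 //; [apply: ha | apply: hb]; rewrite t0.
Qed.

Lemma dderiv_bound n (H : nctuple R d n) mu B i j :
  (0 < n)%N -> 0 < mu -> 0 < B -> inward kap T mu H -> polyb kap B H ->
  sqn (dderiv n H i j) <= (36 * M * B / mu) ^+ 2.
Proof.
move=> n0 mu0 B0 hm hB.
have h0 : 0 < Num.min (mu / B) (mu^-1) by rewrite lt_min divr_gt0 //= invr_gt0.
apply: (tends0_le h0 _ (dderiv_tends i j _)); last by split=> //; exists mu.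
move=> t /andP[t0]; rewrite lt_min => /andP[tB tmu].
have {}tB : t * B <= mu by rewrite -ler_pdivlMr // ltW.
have {}tmu : t * mu <= 1 by rewrite -ler_pdivlMr // mul1r ltW.
exact: (dquot_bound i j n0 mu0 B0 hm hB t0 tB tmu).
Qed.

Lemma dderiv_real n (H : nctuple R d n) (r : R) : 0 < r -> inward_set kap T H ->
  dderiv n (fun i => r%:C%C *: H i) = r%:C%C *: dderiv n H.
Proof.
move=> r0 hH; have [n0 [mu mu0 hm]] := hH.
have hrH : inward_set kap T (fun i => r%:C%C *: H i).
  by split=> //; exists (r * mu); [rewrite mulr_gt0 | exact: inward_scale].
apply/matrixP => i j; apply: dderiv_eq => //; rewrite [X in tends0 _ X]mxE.
have := tends0Z (r%:C%C) (tends0_rescale r0 (dderiv_tends i j hH)).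
apply: (tends0_near ltr01) => t /andP[t0 _].
have -> : dquot (fun i => r%:C%C *: H i) t =
   r%:C%C *: dquot H (r * t).
  rewrite /dquot scalerA invfM rmorphM /= mulrA -rmorphM mulfV ?gt_eqF // rmorph1 mul1r.
  congr (_ *: (phi n _ - _)); apply/funext => k.
  by rewrite /ray scalerA mulrC -rmorphM.
by rewrite [RHS]mxE.
Qed.

(** Within this distance of [1], scaling an inward direction with constants [mu]
    and [B] costs at most half of [mu]. *)
Definition hom_radius (mu B : R) : R := Num.min 1 (mu / (4 * (1 + B))).

(** Homogeneity for complex factors near one: the interpolant of the linear
    function [l |-> l *: dderiv H] at real nodes is that function itself, so the
    interpolation error bounds [dderiv (w H) - w dderiv H]. *)
Lemma dderiv_near_one n (H : nctuple R d n) mu B (w : C) :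
  (0 < n)%N -> 0 < mu -> 0 < B -> inward kap T mu H -> polyb kap B H ->
  sqn (w - 1) <= (hom_radius mu B / 8) ^+ 2 ->
  dderiv n (fun i => w *: H i) = w *: dderiv n H.
Proof.
move=> n0 mu0 B0 hm hB; set rho := hom_radius mu B.
have B1 : 0 < 4 * (1 + B) by rewrite mulr_gt0 // addr_gt0.
have rho0 : 0 < rho by rewrite lt_min ltr01 divr_gt0.
have rho1 : rho <= 1 by rewrite ge_min lexx.
have rhoB : rho * (4 * (1 + B)) <= mu.
  by rewrite -ler_pdivlMr // ge_min lexx orbT.
clearbody rho => hw; have hH : inward_set kap T H by split=> //; exists mu.
have r80 : 0 <= rho / 8 by lra.
have [w1 w2] := ReIm_sqn r80 hw.
have re1 : complex.Re (w - 1) = complex.Re w - 1 by case: (w).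
have im1 : complex.Im (w - 1) = complex.Im w by case: (w) => a b /=; rewrite subr0.
rewrite re1 in w1; rewrite im1 in w2.
(* a real factor could coincide with a node, but rescaling [t] covers it *)
have [wIm|wIm] := eqVneq (complex.Im w) 0.
  have wre : w = (complex.Re w)%:C%C by move: wIm; case: (w) => a b /= ->.
  rewrite wre; apply: dderiv_real => //.
  by move: w1; rewrite ler_norml => /andP[h1 _]; lra.
pose node j : C := ((1 + rho / 8 / j.+1%:R) +i* 0)%C.
have nodeP j : 0 <= rho / 8 / j.+1%:R <= rho / 8.
  apply/andP; split; first exact: divr_ge0.
  by rewrite ler_pdivrMr ?ltr0n // ler_peMr // ler1n.
pose A : nctuple R d n := fun=> 0.
have penE l : pencil A H l = (fun i => l *: H i).
  by apply/funext => i; rewrite /pencil add0r.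
pose qq := (1 + B) / 2; have q0 : 0 < qq by rewrite divr_gt0 // addr_gt0.
have be0 : 0 <= rho * qq by rewrite mulr_ge0 // ltW.
have B50 : 0 < 5 * B by rewrite mulr_gt0.
have B10 : 0 <= rho ^+ 2 * B by rewrite mulr_ge0 ?sqr_ge0 // ltW.
have mu2 : 0 < mu / 2 by rewrite divr_gt0.
have form k u v : complex.Re (dot u (tcomp kap T k H *m v)) <= qq * (n2 u + n2 v).
  apply: le_trans (tcomp_form T_unit k u v hB) _; rewrite /qq.
  by have := n2_ge0 v; have := mulr_ge0 (ltW B0) (n2_ge0 u); lra.
have diag k v (c : C) : sqn c = 1 ->
    complex.Re (c^* * dot v (tcomp kap T k H *m v)) <= qq * n2 v.
  move=> c1; rewrite -dotZl; apply: le_trans (tcomp_form T_unit k _ v hB) _.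
  by rewrite n2Z c1 /qq; lra.
have form1 k u v :
    complex.Re (dot u (tcomp kap T k (fun i => rho%:C%C *: H i) *m v)) <=
    rho * qq * (n2 u + n2 v).
  by rewrite tcompZ -scalemxAl dotZr Re_realM -mulrA ler_pM2l.
have poly1 : polyb kap (rho ^+ 2 * B) (fun i => rho%:C%C *: H i).
  by move=> k v; rewrite blockn2Z sqnC -[leRHS]mulrA ler_wpM2l ?sqr_ge0.
have goodl (x y : R) : `|x - 1| <= rho -> `|y| <= rho ->
    inward kap T (mu / 2 + 2 * (rho * qq)) (pencil A H (x +i* y)%C) /\
    polyb kap (5 * B) (pencil A H (x +i* y)%C).
  move=> hx hy; rewrite penE; split=> k v.
    rewrite tcompZ -scalemxAl dotZr Re_lmul /=.
    have i1 : sqn ('i%C : C) = 1 by rewrite /sqn /= expr0n expr1n add0r.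
    have := hm k v; have := diag k v 1 (sqn1 _); have := diag k v (-1) _.
    have := diag k v 'i%C i1; have := diag k v (- 'i%C) _.
    rewrite !sqnN sqn1 i1 => /(_ erefl) d1 d2 /(_ erefl) d3 d4.
    move: d1 d2 d3 d4; case: (dot v _) => za zb.
    have c1 : (1 : C)^* = 1 by rewrite rmorph1.
    have c2 : (-1 : C)^* = -1 by rewrite rmorphN rmorph1.
    have c3 : ('i%C : C)^* = - 'i%C.
      by apply/eqP; rewrite eq_complex /= ?oppr0 ?opprK !eqxx.
    have c4 : (- 'i%C : C)^* = 'i%C.
      by apply/eqP; rewrite eq_complex /= ?oppr0 ?opprK !eqxx.
    rewrite c1 c2 c3 c4 !Re_lmul /= => d1 d2 d3 d4 hmu.
    set nv := n2 v in d1 d2 d3 d4 hmu *.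
    have nv0 : 0 <= nv by exact: n2_ge0.
    have e1 : (x - 1) * za <= rho * (qq * nv).
      apply: le_trans (ler_norm _) _; rewrite normrM; apply: ler_pM => //.
      by rewrite ler_norml; lra.
    have e2 : - (y * zb) <= rho * (qq * nv).
      apply: le_trans (ler_norm _) _; rewrite normrN normrM; apply: ler_pM => //.
      by rewrite ler_norml; lra.
    have e3 : 8 * (rho * qq * nv) <= mu * nv.
      by apply: le_trans (ler_wpM2r nv0 rhoB); rewrite /qq; lra.
    by lra.
  rewrite blockn2Z -[leRHS]mulrA; apply: ler_pM.
  - exact: sqn_ge0.
  - exact: blockn2_ge0.
  - rewrite /sqn /=; move: hx hy; rewrite !ler_norml => /andP[x1 x2] /andP[y1 y2].
    have : 0 <= (rho - y) * (rho + y) by apply: mulr_ge0; lra.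
    have : 0 <= (1 + rho - x) * (1 + rho + x) by apply: mulr_ge0; lra.
    have : rho ^+ 2 <= 1 by rewrite expr_le1 // ltW.
    by lra.
  - exact: hB.
have nodeg j : inward kap T (mu / 2 + 2 * (rho * qq)) (pencil A H (node j))
    /\ polyb kap (5 * B) (pencil A H (node j)).
  have /andP[n1 n2'] := nodeP j.
  apply: goodl; last by rewrite normr0 ltW.
  by rewrite addrAC subrr add0r ger0_norm //; apply: le_trans n2' _; lra.
have [g1 g2] : inward kap T (mu / 2 + 2 * (rho * qq)) (pencil A H w)
    /\ polyb kap (5 * B) (pencil A H w).
  move: w1 w2; case: (w) => x y /= w1 w2; apply: goodl; lra.
have inj i j : node i = node j -> i = j.
  move=> /eqP; rewrite eq_complex /= eqxx andbT => /eqP/addrI e.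
  have r8 : rho / 8 != 0 by rewrite gt_eqF // divr_gt0.
  by move: (mulfI r8 e) => /invr_inj/eqP; rewrite eqr_nat => /eqP[].
have neq j : w != node j.
  by rewrite eq_complex /= negb_and wIm orbT.
have cf j : 4 <= sqn (coef rho%:C%C node j w).
  rewrite /coef sqnM sqnV sqnC; have /andP[n1 n2'] := nodeP j.
  have zE : sqn (w - node j) =
      (complex.Re w - 1 - rho / 8 / j.+1%:R) ^+ 2 + complex.Im w ^+ 2.
    by rewrite /node; case: (w) => a b; rewrite /sqn /=; ring.
  rewrite zE; set z := rho / 8 / _ in n1 n2' *.
  have h2 : 0 < complex.Im w ^+ 2 by rewrite exprn_even_gt0.
  have h1 := sqr_ge0 (complex.Re w - 1 - z).
  move: w1 w2; rewrite !ler_norml => /andP[x1 x2] /andP[y1 y2].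
  rewrite ler_pdivlMr; last by lra.
  have : 0 <= (rho / 4 - (complex.Re w - 1 - z)) * (rho / 4 + (complex.Re w - 1 - z)).
    by apply: mulr_ge0; lra.
  have : 0 <= (rho / 8 - complex.Im w) * (rho / 8 + complex.Im w).
    by apply: mulr_ge0; lra.
  by have := sqr_ge0 rho; lra.
have B50' := ltW B50.
have inStair p := stair_inward be0 B50' B10 form1 poly1 nodeg p.
have inStep p := step_inward be0 B50' B10 form1 poly1 nodeg p (conj g1 g2).
have inNode j := pencil_inward be0 B50' B10 (nodeg j).
have inW := pencil_inward be0 B50' B10 (conj g1 g2).
have dim k : (0 < bdim n k)%N by case: k => [|k] //=; rewrite addn_gt0 n0.
set Bt := 2 * (5 * B) + 2 * (rho ^+ 2 * B) in inStair inStep inNode inW.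
have Bt0 : 0 < Bt by rewrite /Bt; lra.
have toD p (X : nctuple R d p) : (0 < p)%N ->
    inward kap T (mu / 2) X /\ polyb kap Bt X -> inward_set kap T X.
  by move=> p0 [h _]; split=> //; exists (mu / 2).
set K := (36 * M * Bt / (mu / 2)) ^+ 2.
have err k a b : sqn (weight rho%:C%C node k.+1 w) *
    sqn ((dderiv n (fun i => w *: H i) - w *: dderiv n H) a b) <= K.
  have := @newton_error R d n A H rho%:C%C node (inward_set kap T) dderiv dderiv_nc
    (@inward_set_dsum R d q kap T) inj k.+1 w K a b.
  have -> : newton rho%:C%C node k.+1 w (fun z => dderiv n (pencil A H z)) =
      newton rho%:C%C node k.+1 w (fun z => z *: dderiv n H).
    apply: newton_ext => j; rewrite penE; have /andP[n1 _] := nodeP j.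
    by apply: dderiv_real => //; rewrite ltr_wpDr.
  rewrite newton_linear // penE -scalerA -scalerBr mxE sqnM; apply.
  - by move=> j _; exact: neq.
  - by move=> j; exact: toD n0 (inNode j).
  - by move=> j; exact: toD (dim j) (inStair j).
  - by rewrite -penE; exact: toD.
  - by apply: toD; [rewrite addn_gt0 n0 | exact: inStep].
  - move=> i j; have [h1 h2] := inStep k.+1.
    by apply: dderiv_bound => //; rewrite addn_gt0 n0.
apply/eqP; rewrite -subr_eq0; apply/eqP/matrixP => a b; rewrite [RHS]mxE.
apply/sqn_eq0/le_anti; rewrite sqn_ge0 andbT; apply/ler_addgt0Pr => e e0; rewrite add0r.
have [k hk] : exists k : nat, K / e <= k%:R by eexists; apply/ltW/truncnS_gt.
have w4 := weight_large k.+1 cf.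
set S := sqn _; have S0 : 0 <= S by exact: sqn_ge0.
have h4 : (k%:R : R) <= 4 ^+ k.+2.
  rewrite -natrX ler_nat ltnW //.
  by apply: leq_trans (ltn_expl k.+2 (isT : 1 < 4)%N) => //; exact/leqW/ltnW.
have KeS : K / e * S <= K.
  by apply: le_trans (err k a b); rewrite ler_wpM2r // (le_trans hk) // (le_trans h4).
have [K0|Kn] := eqVneq K 0.
  have : 4 ^+ k.+2 * S <= 0.
    by rewrite -K0; apply: le_trans (err k a b); rewrite ler_wpM2r.
  rewrite pmulr_rle0 ?exprn_gt0 // => h; exact: le_trans h (ltW e0).
have Kp : 0 < K by rewrite lt_neqAle eq_sym Kn sqr_ge0.
by move: KeS; rewrite mulrAC ler_pdivrMr // ler_pM2l.
Qed.

Variable k0 : 'I_q.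

(** The set of factors keeping [H] inward is convex, so a segment leads from one
    to [z]; it is covered by finitely many steps of the preceding lemma. *)
Lemma dderiv_homogeneous : homogeneous1 (inward_set kap T) dderiv.
Proof.
move=> n z H hH hz; have [n0 [m1 m10 h1]] := hH; have [_ [m2 m20 h2]] := hz.
pose mu := Num.min m1 m2; have mu0 : 0 < mu by rewrite lt_min m10.
have {}h1 : inward kap T mu H by apply: inward_le h1; rewrite ge_min lexx.
have {}h2 : inward kap T mu (fun i => z *: H i).
  by apply: inward_le h2; rewrite ge_min lexx orbT.
have [B B0 hB] := polyb_exists kap H.
pose W := 2 + 2 * sqn (z - 1).
have W0 : 0 < W by rewrite /W; have := sqn_ge0 (z - 1); lra.
have WB0 : 0 < W * B by rewrite mulr_gt0.
pose f (s : R) : C := 1 + s%:C%C * (z - 1).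
have fin s : 0 <= s <= 1 -> inward kap T mu (fun i => f s *: H i).
  move=> /andP[s0 s1] k v; have := h1 k v; have := h2 k v.
  rewrite !tcompZ -!scalemxAl !dotZr; set D := dot v _ => i2 i1.
  have -> : f s * D = (1 - s)%:C%C * D + s%:C%C * (z * D).
    by rewrite /f rmorphB rmorph1; ring.
  rewrite raddfD /= !Re_realM.
  have := ler_wpM2l s0 i2; have := ler_wpM2l (_ : 0 <= 1 - s) i1.
  by rewrite subr_ge0 => /(_ s1); lra.
have fpoly s : 0 <= s <= 1 -> polyb kap (W * B) (fun i => f s *: H i).
  move=> /andP[s0 s1] k v; rewrite blockn2Z -mulrA; apply: ler_pM.
  - exact: sqn_ge0.
  - exact: blockn2_ge0.
  - apply: le_trans (sqnD2 _ _) _; rewrite sqn1 sqnM sqnC /W.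
    have : s ^+ 2 <= 1 by rewrite expr_le1.
    by have := sqn_ge0 (z - 1); nra.
  - exact: hB.
(* [c0] bounds the inverse of the factors on the segment *)
pose v0 : 'cV[C]_n := ecol R (Ordinal n0).
pose c0 := sqn (dot v0 (tcomp kap T k0 H *m v0)).
have low s : 0 <= s <= 1 -> mu ^+ 2 <= sqn (f s) * c0.
  move=> hs; have := fin s hs k0 v0; rewrite tcompZ -scalemxAl dotZr -sqnM.
  rewrite n2_ecol mulr1; case: (f s * _) => a b /= h; rewrite /sqn /=.
  have : 0 <= (- a - mu) * (- a + mu) by apply: mulr_ge0; lra.
  by have := sqr_ge0 b; lra.
have f_neq0 s : 0 <= s <= 1 -> f s != 0.
  move=> hs; apply/eqP => e; have := low s hs; rewrite e sqn0 mul0r.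
  by rewrite leNgt exprn_gt0.
set del := hom_radius mu (W * B) / 8.
have del0 : 0 < del.
  by rewrite divr_gt0 // lt_min ltr01 divr_gt0 // mulr_gt0 // addr_gt0.
pose Q := sqn (z - 1) * c0 / (mu ^+ 2 * del ^+ 2).
have [N hN] : exists N : nat, Q <= N.+1%:R by eexists; apply/ltW/truncnS_gt.
have N0 : 0 < N.+1%:R :> R by rewrite ltr0n.
have step1 s : 0 <= s -> s + N.+1%:R^-1 <= 1 ->
    dderiv n (fun i => f s *: H i) = f s *: dderiv n H ->
    dderiv n (fun i => f (s + N.+1%:R^-1) *: H i) = f (s + N.+1%:R^-1) *: dderiv n H.
  move=> s0 s1 IH; set h := N.+1%:R^-1 in s1 *.
  have h0 : 0 < h by rewrite invr_gt0.
  have s01 : 0 <= s <= 1 by rewrite s0; lra.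
  have fs0 := f_neq0 s s01.
  have wE : f (s + h) = f (s + h) / f s * f s by rewrite divfK.
  have hw : sqn (f (s + h) / f s - 1) <= del ^+ 2.
    have -> : f (s + h) / f s - 1 = h%:C%C * (z - 1) / f s.
      rewrite -[X in _ - X](mulfV fs0) -mulrBl; congr (_ / _).
      by rewrite /f rmorphD; ring.
    have fsp : 0 < sqn (f s).
      by rewrite lt_neqAle sqn_ge0 andbT eq_sym; apply: contra_neq fs0; exact: sqn_eq0.
    rewrite !sqnM sqnV sqnC ler_pdivrMr //.
    have md : 0 < mu ^+ 2 * del ^+ 2 by rewrite mulr_gt0 ?exprn_gt0.
    have mu2 : 0 < mu ^+ 2 by rewrite exprn_gt0.
    rewrite -(ler_pM2l mu2).
    (* [h^2 <= h], and [h] times the constant [Q] is at most one *)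
    have hh : h ^+ 2 <= h.
      by rewrite expr2 ger_pMl //; apply: le_trans s1; rewrite lerDr.
    have hQ : h * (sqn (z - 1) * c0) <= mu ^+ 2 * del ^+ 2.
      move: hN; rewrite /Q ler_pdivrMr // => hN'.
      by rewrite /h mulrC ler_pdivrMr // [leRHS]mulrC.
    have c00 : 0 <= sqn (z - 1) * c0 by rewrite mulr_ge0 // sqn_ge0.
    have i1 : mu ^+ 2 * (h ^+ 2 * sqn (z - 1)) <=
        sqn (f s) * c0 * (h ^+ 2 * sqn (z - 1)).
      by rewrite ler_wpM2r ?low // mulr_ge0 ?sqr_ge0 ?sqn_ge0.
    apply: le_trans i1 _.
    have i2 : h ^+ 2 * (sqn (z - 1) * c0) <= mu ^+ 2 * del ^+ 2.
      by apply: le_trans hQ; rewrite ler_wpM2r.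
    by have := ler_wpM2l (ltW fsp) i2; lra.
  have := dderiv_near_one n0 mu0 WB0 (fin s s01) (fpoly s s01) hw.
  rewrite IH scalerA -wE => <-; congr (dderiv n _).
  by apply/funext => i; rewrite scalerA -wE.
have walk j : (j <= N.+1)%N ->
    dderiv n (fun i => f (j%:R / N.+1%:R) *: H i) = f (j%:R / N.+1%:R) *: dderiv n H.
  elim: j => [|j IH] hj.
    rewrite mul0r /f mul0r addr0 scale1r; congr (dderiv n _).
    by apply/funext => i; rewrite scale1r.
  rewrite -natr1 mulrDl mul1r; apply: step1; last exact: IH (ltnW hj).
    by rewrite divr_ge0.
  by rewrite -[X in _ + X]mul1r -mulrDl natr1 ler_pdivrMr // mul1r ler_nat.
have := walk N.+1 (leqnn _); rewrite divff ?gt_eqF //.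
have -> : f 1 = z by rewrite /f mul1r addrCA subrr addr0.
by [].
Qed.

End SchurFunction.

(** * Topology of matrices and tuples *)

Section Topology.
Variable R : realType.
Local Notation C := R[i].

Lemma norm_sqn (z : C) (e : R) : 0 <= e -> (`|z| <= e%:C%C) = (sqn z <= e ^+ 2).
Proof.
move=> e0; rewrite normc_def lecR -[X in _ <= X](ger0_norm e0) -sqrtr_sqr.
by rewrite ler_sqrt // sqr_ge0.
Qed.

Lemma cvg_complexP (S : Type) (F : set_system S) (f : S -> C) (l : C) :
  Filter F -> (f @ F --> l) <->
  (forall e : R, 0 < e -> \forall s \near F, sqn (f s - l) <= e).
Proof.
move=> FF; split=> [/cvgrPdist_le h e e0|h].
  have q0 : 0 < Num.sqrt e by rewrite sqrtr_gt0.
  have q0' : (0 : C) < (Num.sqrt e)%:C%C by rewrite ltcR.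
  apply: filterS (h _ q0') => s.
  by rewrite distrC (norm_sqn _ (ltW q0)) sqr_sqrtr // ltW.
apply/cvgrPdist_le => eps; rewrite ltcE => /andP[/eqP /= im0 re0].
have -> : eps = (complex.Re eps)%:C%C by move: im0; case: (eps) => a b /= ->.
apply: filterS (h _ (exprn_gt0 2 re0)) => s.
by rewrite distrC (norm_sqn _ (ltW re0)).
Qed.

Lemma cvg_mxP (S : Type) (F : set_system S) m n (f : S -> 'M[C]_(m, n))
    (L : 'M[C]_(m, n)) :
  Filter F -> (f @ F --> L) <-> (forall i j, (fun s => f s i j) @ F --> L i j).
Proof.
move=> FF; split=> [h i j U hU|h U [P hP PU]].
  apply: (h [set N | U (N i j)]).
  exists (fun i' j' => [set z | (i', j') = (i, j) -> U z]).
    move=> i' j'; have [[-> ->]|ne] := pselect ((i', j') = (i, j)).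
      by apply: filterS hU => z Uz _.
    by apply: filterS filterT => z _ /ne.
  by move=> N hN; exact: hN i j erefl.
have hf : \forall s \near F, forall ij : 'I_m * 'I_n, P ij.1 ij.2 (f s ij.1 ij.2).
  by apply: filter_forall => ij; exact: (h ij.1 ij.2 _ (hP ij.1 ij.2)).
by apply: filterS hf => s hs; apply: PU => i j; exact: (hs (i, j)).
Qed.

Lemma cvg_nctupleP (S : Type) (F : set_system S) d n (f : S -> nctuple R d n)
    (x : nctuple R d n) :
  Filter F -> (f @ F --> x) <-> (forall i, (fun s => f s i) @ F --> x i).
Proof.
move=> FF; split=> [h i|h].
  exact: (cvg_comp _ _ h (@proj_continuous 'I_d (fun=> 'M[C]_n) i x)).
apply/cvg_sup => i; rewrite cvg_image; last first.
  by rewrite eqEsubset; split=> v // _; exists (cst v).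
move=> U /= hU; have := h i U hU; rewrite /= => hF.
exists [set y | U (y i)]; first exact: hF.
by rewrite eqEsubset; split => [z [y ? <-//]|z Uz]; exists (fun=> z).
Qed.

Lemma near_rightP (P : R -> Prop) : (\forall t \near 0^'+, P t) <->
  exists2 dl, 0 < dl & forall t, 0 < t < dl -> P t.
Proof.
split=> [/nbhs_ballP[dl /= dl0 h]|[dl dl0 h]].
  exists dl => // t /andP[t0 td]; apply: h => //.
  by rewrite /ball /= sub0r normrN gtr0_norm.
near=> t; apply: h; apply/andP; split; near: t.
  exact: nbhs_right_gt.
exact: nbhs_right_lt.
Unshelve. all: by end_near.
Qed.

Lemma cvg_at0 n (f : R -> 'M[C]_n) (L : 'M[C]_n) :
  (forall i j, tends0 (fun t => f t i j) (L i j)) -> f @ 0^'+ --> L.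
Proof.
move=> h; apply/cvg_mxP => i j; apply/cvg_complexP => e e0.
exact/near_rightP/h.
Qed.

End Topology.

(** * Operator norms and the two domains *)

Section OperatorNorm.
Variable R : realType.
Local Notation C := R[i].

Lemma l2normE n (v : 'cV[C]_n) : l2norm v = Num.sqrt (n2 v).
Proof. by []. Qed.

Lemma l2norm_le m n (u : 'cV[C]_m) (v : 'cV[C]_n) c : 0 <= c ->
  (l2norm u <= c * l2norm v) = (n2 u <= c ^+ 2 * n2 v).
Proof.
move=> c0; rewrite !l2normE -[X in X * _](ger0_norm c0) -sqrtr_sqr.
rewrite -sqrtrM ?sqr_ge0 // ler_sqrt // mulr_ge0 ?sqr_ge0 ?n2_ge0 //.
Qed.

Let image m n (A : 'M[C]_(m, n)) : set R :=
  [set l2norm (A *m v) | v in [set v : 'cV[C]_n | l2norm v <= 1]].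

Let image_le m n (A : 'M[C]_(m, n)) c : 0 <= c -> contracts (c ^+ 2) A ->
  ubound (image A) c.
Proof.
move=> c0 hA _ [v /= v1 <-]; apply: (@le_trans _ _ (c * l2norm v)).
  by rewrite l2norm_le.
by rewrite -[leRHS]mulr1 ler_wpM2l.
Qed.

Let image_sup m n (A : 'M[C]_(m, n)) : has_sup (image A).
Proof.
split; first by exists (l2norm (A *m 0)), 0 => //=; rewrite l2normE n2_0 sqrtr0.
exists (Num.sqrt (frob A)); apply: image_le; rewrite ?sqrtr_ge0 //.
by rewrite sqr_sqrtr ?frob_ge0 //; exact: contracts_frob.
Qed.

Lemma opnorm_ge0 m n (A : 'M[C]_(m, n)) : 0 <= opnorm A.
Proof.
apply: (@le_trans _ _ (l2norm (A *m 0))); first exact: sqrtr_ge0.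
apply: (ub_le_sup (image_sup A).2); exists 0 => //=.
by rewrite l2normE n2_0 sqrtr0.
Qed.

Lemma opnorm_le m n (A : 'M[C]_(m, n)) c : 0 <= c -> contracts c A ->
  opnorm A ^+ 2 <= c.
Proof.
move=> c0 h; rewrite -(sqr_sqrtr c0) ler_sqr ?nnegrE ?opnorm_ge0 ?sqrtr_ge0 //.
apply: ge_sup; first exact: (image_sup A).1.
by apply: image_le; rewrite ?sqrtr_ge0 // sqr_sqrtr.
Qed.

Lemma contracts_opnorm m n (A : 'M[C]_(m, n)) : contracts (opnorm A ^+ 2) A.
Proof.
move=> v; rewrite -l2norm_le ?opnorm_ge0 //.
have [v0|vn] := eqVneq (n2 v) 0.
  by rewrite (n2_eq0 v0) mulmx0 !l2normE !n2_0 sqrtr0 mulr0.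
have vp : 0 < n2 v by rewrite lt_neqAle eq_sym vn n2_ge0.
have lp : 0 < l2norm v by rewrite l2normE sqrtr_gt0.
have e (w : 'cV[C]_m) : l2norm ((l2norm v)^-1%:C%C *: w) = (l2norm v)^-1 * l2norm w.
  by rewrite !l2normE n2Z sqnC sqrtrM ?sqr_ge0 // sqrtr_sqr ger0_norm // invr_ge0 sqrtr_ge0.
rewrite -ler_pdivrMr // mulrC -e scalemxAr.
apply: (ub_le_sup (image_sup A).2); exists ((l2norm v)^-1%:C%C *: v) => //=.
rewrite !l2normE n2Z sqnC sqrtrM ?sqr_ge0 // sqrtr_sqr ger0_norm.
  by rewrite mulVf // gt_eqF // sqrtr_gt0.
by rewrite invr_ge0 sqrtr_ge0.
Qed.

End OperatorNorm.

Section Realization.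
Variables (R : realType) (d q : nat) (kap : 'I_d -> 'I_q).
Local Notation C := R[i].

(** The matrices of polynomials considered here have a single non-zero entry in
    the [i]-th row, the variable [x i] in column [kap i]. *)
Definition monomial_rows (delta : 'M[ncpoly R d]_(d, q)) : Prop :=
  forall n (x : nctuple R d n) i j,
    nceval (delta i j) x = if kap i == j then x i else 0.

Variable delta : 'M[ncpoly R d]_(d, q).
Hypothesis delta_rows : monomial_rows delta.

Lemma n2_mxcol p (n_ : 'I_p -> nat) (V : forall i, 'cV[C]_(n_ i)) :
  n2 (\mxcol_i V i) = \sum_i n2 (V i).
Proof.
rewrite /n2 sig_big_dep /= (reindex _ tagnat.sig_bij_on) /=.
by apply: eq_bigr => l _; rewrite !mxE.
Qed.

Lemma n2_delta n (x : nctuple R d n) (V : 'I_q -> 'cV[C]_n) :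
  n2 (ncmxeval delta x *m \mxcol_j V j) = \sum_k blockn2 kap k x (V k).
Proof.
rewrite /ncmxeval mul_mxblock_mxrow n2_mxcol.
rewrite (eq_bigr (fun i => n2 (x i *m V (kap i)))) => [|i _]; last first.
  rewrite (bigD1 (kap i)) //= delta_rows eqxx big1 ?addr0 // => j jk.
  by rewrite delta_rows eq_sym (negbTE jk) mul0mx.
rewrite (partition_big kap xpredT) //=; apply: eq_bigr => k _.
by apply: eq_bigr => i /eqP ->.
Qed.

Let single n (k : 'I_q) (v : 'cV[C]_n) := \mxcol_j (if j == k then v else 0).

Lemma n2_single n k (v : 'cV[C]_n) : n2 (single k v) = n2 v.
Proof.
rewrite n2_mxcol (bigD1 k) //= big1 ?addr0 ?eqxx // => j jk.
by rewrite (negbTE jk) n2_0.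
Qed.

Lemma n2_delta_single n k (x : nctuple R d n) (v : 'cV[C]_n) :
  n2 (ncmxeval delta x *m single k v) = blockn2 kap k x v.
Proof.
rewrite n2_delta (bigD1 k) //= big1 ?addr0 ?eqxx // => j jk.
rewrite (negbTE jk) /blockn2 big1 // => i _.
by rewrite mulmx0 n2_0.
Qed.

Lemma contracts_delta c n (x : nctuple R d n) : 
  contracts c (ncmxeval delta x) <-> polyb kap c x.
Proof.
split=> h; last first.
  move=> v; rewrite -(submxcolK v) n2_delta n2_mxcol mulr_sumr.
  by apply: ler_sum => k _; exact: h.
by move=> k v; rewrite -n2_delta_single -(n2_single k v).
Qed.

Lemma isometry_unit (x : nctuple R d 1) : isometrymx (ncmxeval delta x) ->
  forall k, \sum_(i | kap i == k) sqn (x i 0 0) = 1.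
Proof.
move=> h k; have := h (single k (ecol R 0)).
rewrite !l2normE n2_delta_single n2_single n2_ecol => /eqP.
rewrite eqr_sqrt ?blockn2_ge0 // => /eqP.
by rewrite -{1}(ncampl1 x) blockn2_ampl n2_ecol mulr1.
Qed.

(** Both domains are polyballs: the squared operator norm of the value of [delta]
    is the best constant for [polyb]. *)
Lemma ncGE n : @ncG R d d q delta n = @polyball R d q kap n.
Proof.
apply/seteqP; split=> x [n0].
  move=> o1; split=> //; exists (opnorm (ncmxeval delta x) ^+ 2).
    by rewrite expr_lt1 // opnorm_ge0.
  exact/contracts_delta/contracts_opnorm.
case=> c c1 h; split=> //; have m0 : 0 <= Num.max c 0 by rewrite le_max lexx orbT.
have hm : polyb kap (Num.max c 0) x by apply: polyb_le h; rewrite le_max lexx.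
have := opnorm_le m0 ((contracts_delta _ x).2 hm) => h'.
rewrite -(@expr_lt1 _ 2) ?opnorm_ge0 //; apply: le_lt_trans h' _.
by rewrite gt_max c1 ltr01.
Qed.

End Realization.

(** * Boundary data and the theorem *)

Section BoundaryData.
Local Open Scope sesquilinear_scope.
Variables (R : realType) (d q : nat) (kap : 'I_d -> 'I_q).
Variables (delta : 'M[ncpoly R d]_(d, q)) (phi : gradedfun R d) (T : nctuple R d 1).
Local Notation C := R[i].
Arguments phi : clear implicits.
Hypothesis delta_rows : monomial_rows kap delta.
Hypothesis phi_schur : schur_class delta phi.
Hypothesis T_unit : forall k, \sum_(i | kap i == k) sqn (T i 0 0) = 1.

Lemma polyball_nc : is_ncfun (polyball kap) phi.
Proof.
case: phi_schur => -[h1 h2] _; split=> [m n x y|n s x]; rewrite -!(ncGE delta_rows);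
  [exact: h1 | exact: h2].
Qed.

Lemma polyball_contr n (x : nctuple R d n) : polyball kap x -> scontr (phi n x).
Proof.
rewrite -(ncGE delta_rows) => /(phi_schur.2 n x) h.
exists (opnorm (phi n x) ^+ 2); last exact: contracts_opnorm.
by rewrite expr_lt1 // opnorm_ge0.
Qed.

Lemma near_polyb (S : Type) (F : set_system S) n (Z : S -> nctuple R d n)
    (x : nctuple R d n) (e : R) : Filter F -> Z @ F --> x -> 0 < e ->
  \forall s \near F, polyb kap e (fun i => Z s i - x i).
Proof.
move=> FF hZ e0.
pose N : R := (n * n * d).+1%:R; have N0 : 0 < N by rewrite ltr0n.
have eN : 0 < e / N by rewrite divr_gt0.
have h : \forall s \near F, forall t : 'I_d * ('I_n * 'I_n),
    sqn (Z s t.1 t.2.1 t.2.2 - x t.1 t.2.1 t.2.2) <= e / N.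
  apply: filter_forall => -[i [a b]] /=.
  have /cvg_mxP/(_ a b)/cvg_complexP := (cvg_nctupleP _ _ FF).1 hZ i.
  exact.
apply: filterS h => s hs; apply: polyb_le (polyb_frob kap _).
apply: (@le_trans _ _ (\sum_(i < d) \sum_(a < n) \sum_(b < n) e / N)).
  apply: ler_sum => i _; apply: ler_sum => a _; apply: ler_sum => b _.
  by have := hs (i, (a, b)); rewrite !mxE.
rewrite !sumr_const !card_ord -!mulrnA -mulr_natr mulrAC ler_pdivrMr //.
by rewrite ler_pM2l // /N ler_nat mulnA leqnSn.
Qed.

(** A scalar point close to [T] has a small gap, since [T] itself has none. *)
Lemma gap_small (k : 'I_q) (z : nctuple R d 1) (g e : R) : 0 < e ->
  polyb kap (1 - g) z -> polyb kap (e / 2 / (1 + 2 / e)) (fun i => z i - T i) ->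
  g <= e \/ 1 < g.
Proof.
move=> e0 hz hzT; have [g1|g1] := leP g 1; [left | by right].
have e2 : 0 < e / 2 by rewrite divr_gt0.
have := blockn2D_le kap k z (fun i => -1 *: (z i - T i)) (ecol R 0) (ecol R 0) e2.
rewrite (eq_bigr (fun i => n2 (T i *m ecol R 0))) => [|i _]; last first.
  by rewrite -mulmxDl scaleN1r opprB addrC subrK.
rewrite -/(blockn2 kap k T (ecol R 0)) -{1}(ncampl1 T) blockn2_ampl T_unit.
rewrite n2_ecol mulr1 blockn2Z sqnN sqn1 mul1r.
have := hz k (ecol R 0); have := hzT k (ecol R 0); rewrite n2_ecol !mulr1.
set a := blockn2 _ _ _ _; set b := blockn2 _ _ _ _ => ha hb h.
have c0 : 0 < 1 + 2 / e by rewrite addr_gt0 // divr_gt0.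
have i1 : (1 + (e / 2)^-1) * a <= e / 2.
  by rewrite invf_div mulrC -ler_pdivlMr.
have i2 : (1 + e / 2) * b <= (1 + e / 2) * (1 - g).
  by rewrite ler_pM2l // addr_gt0.
have [g0|g0] := leP 0 g; last by lra.
have : 0 <= e / 2 * g by rewrite mulr_ge0 // ltW.
lra.
Qed.

Section Approach.
Variable k0 : 'I_q.
Hypothesis T_Bpoint : Bpoint delta phi T.

Lemma opnorm_delta_polyb n (z : nctuple R d n) :
  polyb kap (opnorm (ncmxeval delta z) ^+ 2) z.
Proof. exact/(contracts_delta delta_rows)/contracts_opnorm. Qed.

Lemma gap_gt0 n (z : nctuple R d n) : ncG delta z ->
  0 < 1 - opnorm (ncmxeval delta z) ^+ 2.
Proof. by case=> _ h; rewrite subr_gt0 expr_lt1 // opnorm_ge0. Qed.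

Lemma bquotP n (z : nctuple R d n) K : ncG delta z -> bquot delta phi z <= K ->
  opnorm (1%:M - (phi n z)^t* *m phi n z) <=
    K * (1 - opnorm (ncmxeval delta z) ^+ 2).
Proof. by move=> hz; rewrite /bquot ler_pdivrMr // gap_gt0. Qed.

Lemma adj_dot n (A : 'M[C]_n) u v : dot u (A^t* *m v) = (dot v (A *m u))^*.
Proof. exact: dot_adj. Qed.

Lemma defect_form n (A : 'M[C]_n) v :
  n2 v - n2 (A *m v) <= opnorm (1%:M - A^t* *m A) * n2 v.
Proof.
set D := 1%:M - _.
have [h|h] := ltP (n2 v - n2 (A *m v)) 0.
  by apply: le_trans (ltW h) _; rewrite mulr_ge0 ?opnorm_ge0 ?n2_ge0.
have DE : dot v (D *m v) = (n2 v - n2 (A *m v))%:C%C.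
  rewrite /D mulmxBl mul1mx dotBr -mulmxA adj_dot !dotvv rmorphB /=.
  by congr (_ - _); exact: conjc_real.
have := dot_CS v (D *m v); rewrite DE sqnC => h1.
rewrite -ler_sqr ?nnegrE ?mulr_ge0 ?opnorm_ge0 ?n2_ge0 // exprMn.
apply: le_trans h1 _.
have -> : opnorm D ^+ 2 * n2 v ^+ 2 = n2 v * (opnorm D ^+ 2 * n2 v) by ring.
by rewrite ler_wpM2l ?n2_ge0 //; exact: contracts_opnorm.
Qed.

Lemma defect11 (z : nctuple R d 1) :
  1 - sqn (phi 1 z 0 0) <= opnorm (1%:M - (phi 1 z)^t* *m phi 1 z).
Proof.
have := defect_form (phi 1 z) (ecol R 0); rewrite n2_ecol mulr1.
by rewrite {1}/n2 big_ord1 -colE mxE.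
Qed.

Lemma Bpoint_approach : exists2 M : R, 0 < M &
  forall e, 0 < e -> exists z, approach kap phi T M e z.
Proof.
case: T_Bpoint => _ [Z [hG hZ /cvg_ex[l hl]]].
pose M := Num.max 1 (l + 1); have M0 : 0 < M by rewrite lt_max ltr01.
exists M => // e e0.
have nearM : \forall j \near \oo, bquot delta phi (Z j) <= M.
  have /cvgrPdist_le/(_ 1 ltr01) := hl; apply: filterS => j.
  by rewrite ler_norml => /andP[h _]; rewrite /M le_max; apply/orP; right; lra.
have c0 : 0 < e / 2 / (1 + 2 / e) by rewrite !divr_gt0 // addr_gt0 // divr_gt0.
have na : \forall j \near \oo, polyb kap e (fun i => Z j i - T i).
  exact: near_polyb.
have nb : \forall j \near \oo,
    polyb kap (e / 2 / (1 + 2 / e)) (fun i => Z j i - T i) by exact: near_polyb.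
have [j [hM [h1 h2]]] := filter_ex (filterI nearM (filterI na nb)).
pose g := 1 - opnorm (ncmxeval delta (Z j)) ^+ 2.
have hz : polyb kap (1 - g) (Z j) by rewrite /g opprB addrC subrK; exact: opnorm_delta_polyb.
exists (Z j), g; split=> //.
  rewrite /g gap_gt0 //=; have [//|] := gap_small k0 e0 hz h2.
  by rewrite /g => g1; have := sqr_ge0 (opnorm (ncmxeval delta (Z j))); lra.
exact: le_trans (defect11 _) (bquotP (hG j) hM).
Qed.

End Approach.

Section BoundaryValue.
Variables (M : R) (om : C).
Hypothesis M_gt0 : 0 < M.
Hypothesis om_unit : sqn om = 1.
Hypothesis T_approach_om : forall e, 0 < e ->
  exists2 z, approach kap phi T M e z & sqn (phi 1 z 0 0 - om) <= e.

Let opp_T : nctuple R d 1 := fun i => - T i.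

Let opp_T_inward : inward kap T 1 opp_T.
Proof.
move=> k v; rewrite /tcomp.
rewrite (eq_bigr (fun i => (sqn (T i 0 0))%:C%C *: (- 1%:M))) => [|i _].
  rewrite -scaler_suml -rmorph_sum T_unit scale1r mulNmx mul1mx dotNr dotvv.
  by rewrite raddfN /= mulN1r.
rewrite -mul_conjc -scalerA; congr (_ *: _).
by apply/matrixP => a b; rewrite !ord1 !mxE eqxx mulr1n mulrN mulr1.
Qed.

Let opp_T_polyb : polyb kap 1 opp_T.
Proof.
move=> k v; apply: le_trans (polyb_T T_unit k v).
by rewrite /blockn2; apply: ler_sum => i _; rewrite mulNmx n2N.
Qed.

Let rad (t : R) : nctuple R d 1 := ray T opp_T t.

Let rad_polyb t : 0 < t <= 1 -> polyb kap (1 - t) (rad t).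
Proof.
move=> /andP[t0 t1]; rewrite -{1}[t]mulr1.
by apply: (ray_polyb T_unit opp_T_inward opp_T_polyb t0); rewrite mulr1.
Qed.

Let rad_polyball t : 0 < t <= 1 -> polyball kap (rad t).
Proof. by move=> h; apply: (gap_polyball _ _ (rad_polyb h)); case/andP: h. Qed.

Let rad_value t : 0 < t <= 1 -> sqn (phi 1 (rad t) 0 0 - om) <= (36 * M * t) ^+ 2.
Proof.
move=> /andP[t0 t1].
have := ray_linear_bound polyball_nc polyball_contr T_unit M_gt0 om_unit T_approach_om
  (ltn0Sn 0) ltr01 ltr01 opp_T_inward opp_T_polyb t0 _ _ (n2_ecol R 0) (n2_ecol R 0).
rewrite !mulr1 divr1 => /(_ t1 t1).
by rewrite dot_ecol 2!mxE [om%:M _ _]mxE eqxx mulr1n.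
Qed.

Lemma ampl_near m t : polyb kap (t ^+ 2) (fun i => ncampl m (rad t) i - ncampl m T i).
Proof.
have -> : (fun i => ncampl m (rad t) i - ncampl m T i) = ncampl m (fun i => (- t)%:C%C *: T i).
  apply/funext => i; rewrite /ncampl /rad /ray /opp_T !mxE eqxx mulr1n -raddfB /=.
  by congr (_%:M); rewrite rmorphN; ring.
apply: polyb_ampl => k v; rewrite blockn2Z sqnC sqrrN ler_wpM2l ?sqr_ge0 //.
by rewrite -[leRHS]mul1r polyb_T.
Qed.

(** Sequences with bounded quotient are compared with the radial points
    [(1 - t) T], whose values are scalar and tend to [om]. *)
Lemma bounded_quotient_near m (z : nctuple R d m) (t K : R) :
  (0 < m)%N -> 0 < t <= 1 -> 0 < K -> ncG delta z -> bquot delta phi z <= K ->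
  polyb kap (t ^+ 2 / 2) (fun i => z i - ncampl m T i) ->
  forall i j, sqn (phi m z i j - om%:M i j) <= 36 * K * t + 2 * (36 * M * t) ^+ 2.
Proof.
move=> m0 t01 K0 hz hq hd i j; have /andP[t0 t1] := t01.
pose g := 1 - opnorm (ncmxeval delta z) ^+ 2; have g0 : 0 < g by exact: gap_gt0.
have pz : polyb kap (1 - g) z by rewrite /g opprB addrC subrK; exact: opnorm_delta_polyb.
have e0 : 0 < 3 * t ^+ 2 by rewrite mulr_gt0 // exprn_gt0.
have hD : polyb kap (3 * t ^+ 2) (fun i => ncampl m (rad t) i - z i).
  have -> : (fun i => ncampl m (rad t) i - z i) = (fun i =>
     (ncampl m (rad t) i - ncampl m T i) + -1 *: (z i - ncampl m T i)).
    by apply/funext => k; rewrite scaleN1r opprB addrA subrK.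
  have h2 : polyb kap (t ^+ 2 / 2) (fun i => -1 *: (z i - ncampl m T i)).
    by move=> k v; rewrite blockn2Z sqnN sqn1 mul1r.
  have h3 := polybD (@ampl_near m t) h2.
  by apply: polyb_le h3; lra.
have e6 : 0 < 6 * (3 * t ^+ 2) by rewrite mulr_gt0.
(* the largest corner admitted by [polyball_triang] *)
set c := (Num.sqrt (t * g / (6 * (3 * t ^+ 2))))%:C%C.
have cE : sqn c = t * g / (6 * (3 * t ^+ 2)).
  by rewrite sqnC sqr_sqrtr // ltW // !(divr_gt0, mulr_gt0).
have hc : sqn c * (6 * (3 * t ^+ 2)) <= t * g by rewrite cE divfK // gt_eqF.
have pX := polyball_ampl m0 (rad_polyball t01).
have pZ := gap_polyball m0 g0 pz.
have pT := polyball_triang m0 t01 g0 (polyb_ampl (rad_polyb t01)) pz hD hc.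
have [cc cc1 hcc] := polyball_contr pT.
set f := phi 1 (rad t) 0 0.
have key v : t * n2 ((f%:M - phi m z) *m v) <= 18 * K * t ^+ 2 * n2 v.
  have := hcc (col_mx 0 v); rewrite (ncfun_triang polyball_nc) //; last first.
    exact: polyball_dsum.
  rewrite mul_block_col !mulmx0 !add0r !n2_col n2_0 add0r.
  rewrite mul_mx_scalar mul_scalar_mx -scalerBr -scalemxAl n2Z cE.
  rewrite (ncfun_ampl polyball_nc) //; last exact: rad_polyball.
  rewrite -/f; have := defect_form (phi m z) v.
  have := ler_wpM2r (n2_ge0 v) (bquotP hz hq); rewrite -/g.
  set S := n2 ((_ - _) *m v); set V := n2 v => h1 h2 h3.
  have V0 : 0 <= V by exact: n2_ge0.
  have h4 : cc * V <= V by rewrite -[leRHS]mul1r ler_wpM2r // ltW.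
  have {h1 h2 h3 h4}h : t * g / (6 * (3 * t ^+ 2)) * S <= K * g * V by lra.
  rewrite mulrAC ler_pdivrMr // in h.
  by rewrite -(ler_pM2l g0); lra.
have hij : sqn ((f%:M - phi m z) i j) <= 18 * K * t.
  rewrite -dot_ecol; apply: le_trans (dot_CS _ _) _; rewrite n2_ecol mul1r.
  by rewrite -(ler_pM2l t0); apply: le_trans (key _) _; rewrite n2_ecol mulr1; lra.
have -> : phi m z i j - om%:M i j = - (f%:M - phi m z) i j + (f%:M - om%:M) i j.
  by rewrite !mxE; ring.
apply: le_trans (sqnD2 _ _) _; rewrite sqnN.
have : sqn ((f%:M - om%:M : 'M[C]_m) i j) <= (36 * M * t) ^+ 2.
  rewrite -raddfB /= mxE; case: (i == j); last by rewrite mulr0n sqn0 sqr_ge0.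
  by rewrite mulr1n; exact: rad_value.
by lra.
Qed.

Lemma om_boundary_value m : (0 < m)%N ->
  is_boundary_value delta phi (ncampl m T) (om%:M : 'M[C]_m).
Proof.
move=> m0; split.
  apply/unitarymxP; rewrite tr_scalar_mx map_scalar_mx -scalar_mxM; congr (_%:M).
  by rewrite mulrC [LHS]mul_conjc om_unit.
move=> Z hG hZ [K hK]; apply/cvg_mxP => i j; apply/cvg_complexP => e e0.
pose K' := Num.max 1 K; have K'0 : 0 < K' by rewrite lt_max ltr01.
pose A := 36 * K' + 2 * (36 * M) ^+ 2.
have A0 : 0 < A by rewrite addr_gt0 ?mulr_gt0 ?exprn_gt0 ?mulr_gt0.
pose t := Num.min 1 (e / A).
have t01 : 0 < t <= 1 by rewrite lt_min ltr01 divr_gt0 //= ge_min lexx.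
have tA : t * A <= e by rewrite -ler_pdivlMr // ge_min lexx orbT.
have /andP[t0 t1] := t01.
have t2 : 0 < t ^+ 2 / 2 by rewrite divr_gt0 // exprn_gt0.
apply: filterS (near_polyb _ hZ t2) => k hk.
have hb : bquot delta phi (Z k) <= K' by rewrite le_max hK orbT.
apply: le_trans (bounded_quotient_near m0 t01 K'0 (hG k) hb hk i j) _.
apply: le_trans tA; rewrite /A.
have : (36 * M) ^+ 2 * t ^+ 2 <= (36 * M) ^+ 2 * t.
  by rewrite ler_wpM2l ?sqr_ge0 // expr2 ger_pMl.
by lra.
Qed.

(** Uniqueness is tested on the radial sequence: its quotient is bounded because
    the values differ from [om] by a multiple of [t]. *)
Lemma boundary_value_om m : (0 < m)%N ->
  boundary_value delta phi (ncampl m T) = om%:M.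
Proof.
move=> m0; have hom := om_boundary_value m0.
have [_ hW] : is_boundary_value delta phi (ncampl m T)
    (boundary_value delta phi (ncampl m T)).
  exact: (@xgetPex _ 0 (is_boundary_value delta phi (ncampl m T)) (ex_intro _ _ hom)).
set W := boundary_value _ _ _ in hW *.
pose t (j : nat) : R := j.+1%:R^-1.
have t01 j : 0 < t j <= 1 by rewrite invr_gt0 ltr0n /= invf_le1 ?ltr0n // ler1n.
pose Y j := ncampl m (rad (t j)).
have pY j : polyb kap (1 - t j) (Y j) by apply: polyb_ampl; exact: rad_polyb.
have GY j : ncG delta (Y j).
  by rewrite (ncGE delta_rows); apply: polyball_ampl => //; exact: rad_polyball.
have YT : Y @ \oo --> ncampl m T.
  apply/cvg_nctupleP => i; apply/cvg_mxP => a b; apply/cvg_complexP => e e0.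
  near=> j.
  have h := @ampl_near m (t j).
  have := h (kap i) (ecol R b); rewrite n2_ecol mulr1 => h'.
  have tj : t j ^+ 2 <= e.
    have /andP[tj0 tj1] := t01 j; apply: (@le_trans _ _ (t j)).
      by rewrite expr2 ger_pMl.
    by apply/ltW; near: j; exact: (near_infty_natSinv_lt (PosNum e0)).
  apply: le_trans tj; apply: le_trans h'.
  have -> : Y j i a b - ncampl m T i a b = (Y j i - ncampl m T i) a b by rewrite !mxE.
  rewrite -dot_ecol; apply: le_trans (dot_CS _ _) _; rewrite n2_ecol mul1r.
  rewrite /blockn2 (bigD1 i) //= lerDl; apply: sumr_ge0 => k _; exact: n2_ge0.
have YK : exists K : R, forall j, bquot delta phi (Y j) <= K.
  exists (72 * M) => j; have /andP[tj0 tj1] := t01 j.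
  rewrite /bquot ler_pdivrMr ?gap_gt0 //.
  have op : opnorm (ncmxeval delta (Y j)) ^+ 2 <= 1 - t j.
    by apply: opnorm_le; [lra | exact/(contracts_delta delta_rows)].
  have phiY : phi m (Y j) = (phi 1 (rad (t j)) 0 0)%:M.
    by rewrite (ncfun_ampl polyball_nc) //; exact: rad_polyball.
  have fv := rad_value (t01 j).
  have f1 := phi_dot_le1 polyball_contr (rad_polyball (t01 j)) (n2_ecol R 0).
  rewrite dot_ecol in f1; rewrite phiY; move: fv f1.
  set f := phi 1 (rad (t j)) 0 0 => fv f1.
  have d2 : (1 - sqn f) ^+ 2 <= (72 * M * t j) ^+ 2.
    have := sqnB_le f om; rewrite om_unit => h.
    rewrite -sqrrN opprB; apply: le_trans h _.
    have : sqn (f + om) <= 4.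
      by apply: le_trans (sqnD2 _ _) _; rewrite om_unit; lra.
    have -> : 72 * M * t j = 2 * (36 * M * t j) by ring.
    move=> f4; apply: le_trans (ler_pM (sqn_ge0 _) (sqn_ge0 _) fv f4) _.
    by move: (36 * M * t j) => y; rewrite exprMn mulrC -natrX.
  have DE : (1%:M - (f%:M)^t* *m f%:M : 'M[C]_m) = (1 - sqn f)%:C%C%:M.
    rewrite tr_scalar_mx map_scalar_mx -scalar_mxM -raddfB /=; congr (_%:M).
    by rewrite [_^* * f]mul_conjc rmorphB rmorph1.
  rewrite DE; apply: (@le_trans _ _ (72 * M * t j)); last first.
    apply: ler_wpM2l; first by rewrite mulr_ge0 // ltW.
    by rewrite lerBrDl -lerBrDr.
  have y0 : 0 <= 72 * M * t j by apply: mulr_ge0; [rewrite mulr_ge0 // ltW | exact: ltW].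
  rewrite -ler_sqr ?nnegrE ?opnorm_ge0 //.
  apply: le_trans d2; apply: opnorm_le; first exact: sqr_ge0.
  by move=> v; rewrite mul_scalar_mx n2Z sqnC.
have lim1 := hW Y GY YT YK; have lim2 := hom.2 Y GY YT YK.
apply/matrixP => i j; apply/eqP; rewrite -subr_eq0; apply/eqP/sqn_eq0/le_anti.
rewrite sqn_ge0 andbT; apply/ler_addgt0Pr => e e0; rewrite add0r.
have e4 : 0 < e / 4 by rewrite divr_gt0.
have /cvg_mxP/(_ i j)/cvg_complexP/(_ _ e4) h1 := lim1.
have /cvg_mxP/(_ i j)/cvg_complexP/(_ _ e4) h2 := lim2.
have [k [i1 i2]] := filter_ex (filterI h1 h2).
have -> : W i j - om%:M i j = - (phi m (Y k) i j - W i j) + (phi m (Y k) i j - om%:M i j).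
  by ring.
by apply: le_trans (sqnD2 _ _) _; rewrite sqnN; lra.
Unshelve. all: by end_near.
Qed.

End BoundaryValue.

(** Along a ray the squared norm of the [k]-th block is a quadratic polynomial in
    [t] with value one at zero. If it is smaller than one for a single positive
    [t], then its derivative at zero is negative, uniformly in the vector. *)
Lemma dirdomE : dirdom delta T = inward_set kap T.
Proof.
apply: functional_extensionality_dep => n; apply/seteqP; split=> H.
  move=> /near_rightP[dl dl0 h].
  have h2 : 0 < dl / 2 < dl by apply/andP; split; lra.
  have := h _ h2; rewrite (ncGE delta_rows) -[_ + _]/(ray T H (dl / 2)).
  set t := dl / 2 in h2 *; have /andP[t0 _] := h2 => -[n0 [c c1 hc]]; split=> //.
  exists ((1 - c) / (2 * t)); first by rewrite divr_gt0 ?subr_gt0 // mulr_gt0.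
  move=> k v; have := hc k v; rewrite ray_blockn2 //.
  have : 0 <= t ^+ 2 * blockn2 kap k H v by rewrite mulr_ge0 ?sqr_ge0 ?blockn2_ge0.
  set z := complex.Re _ => h3 h4.
  rewrite mulNr mulrAC lerNr ler_pdivrMr ?mulr_gt0 //; lra.
move=> hH; apply/near_rightP; have [e e0 he] := inward_raydom T_unit hH.
by exists e => // t ht; rewrite (ncGE delta_rows); exact: he.
Qed.

End BoundaryData.

Section Instances.
Variables (R : realType) (d : nat).

Lemma nceval_X n (x : nctuple R d n) i : nceval (ncpolyX R i) x = x i.
Proof. by rewrite /nceval big_seq1 /= big_seq1 scale1r. Qed.

Lemma polydisk_rows : monomial_rows id (polydisk_delta R d).
Proof.
move=> n x i j; rewrite /polydisk_delta mxE; case: eqP => _.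
  exact: nceval_X.
by rewrite /nceval big_nil.
Qed.

Lemma column_ball_rows : monomial_rows (fun=> ord0) (column_ball_delta R d).
Proof. by move=> n x i j; rewrite mxE nceval_X [j]ord1. Qed.

Lemma monomial_derivative q (kap : 'I_d -> 'I_q) (delta : 'M[ncpoly R d]_(d, q))
    (phi : gradedfun R d) (T : nctuple R d 1) :
  monomial_rows kap delta -> schur_class delta phi -> ncI delta T ->
  Bpoint delta phi T ->
  exists eta : gradedfun R d,
    [/\ forall (m : nat) (H : nctuple R d m), dirdom delta T H ->
          (fun t : R => (t^-1)%:C%C *: (phi m (ncampl m T + t%:C%C *: H)
                          - boundary_value delta phi (ncampl m T)))
            @ 0^'+ --> eta m H,
        is_ncfun (dirdom delta T) eta
      & homogeneous1 (dirdom delta T) eta].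
Proof.
move=> rows schur [[_ Tint] Tiso] TB.
(* without columns the domain is everything and has no boundary *)
have k0 : 'I_q.
  case: q kap delta rows schur Tint Tiso TB => [|q'] kap delta rows _ Tint _ _.
    exfalso; apply: Tint; rewrite (ncGE rows).
    apply: (@filterS _ _ _ setT); last exact: filterT.
    by move=> x _; split=> //; exists 0 => // -[].
  exact: ord0.
have T_unit := isometry_unit rows Tiso.
have nc := polyball_nc rows schur; have contr := polyball_contr rows schur.
have [M M0 Tap] := Bpoint_approach rows T_unit k0 TB.
have [om [om1 Tom]] := boundary_scalar_exists nc contr T_unit M0 Tap.
exists (dderiv phi T om); rewrite (dirdomE rows T_unit); split.
- move=> m H hH; have [m0 _] := hH.
  rewrite (boundary_value_om rows schur T_unit M0 om1 Tom m0).
  by apply: cvg_at0 => i j; exact: (dderiv_tends nc contr T_unit M0 om1 Tom i j hH).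
- exact: (dderiv_nc nc contr T_unit M0 om1 Tom).
- exact: (dderiv_homogeneous nc contr T_unit M0 om1 Tom k0).
Qed.

End Instances.

Local Open Scope complex_scope.

Theorem corollary1p12 (R : realType) (d p q : nat)
    (delta : 'M[ncpoly R d]_(p, q)) (phi : gradedfun R d)
    (T : nctuple R d 1) :
  polydisk_or_ball delta ->
  schur_class delta phi ->
  ncI delta T ->
  Bpoint delta phi T ->
  exists eta : gradedfun R d,
    [/\ forall (m : nat) (H : nctuple R d m), dirdom delta T H ->
          (fun t : R => t^-1%:C *: (phi m (ncampl m T + t%:C *: H)
                          - boundary_value delta phi (ncampl m T)))
            @ 0^'+ --> eta m H,
        is_ncfun (dirdom delta T) eta
      & homogeneous1 (dirdom delta T) eta].
Proof.
case; [exact: monomial_derivative (@polydisk_rows R d)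
     | exact: monomial_derivative (@column_ball_rows R d)].
Qed.
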